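(* Let $m\in\{1,\dots,N\}$, $0<\gamma<N$ and $\alpha>0$ be such that $\alpha<\dfrac{2}{\gamma+m}$. Let $u_0\in\mathcal X_{m,\gamma}$ with $u_0\ge0$, and let $u(t)=\mathcal S_m(t)u_0$ be the resulting solution of $u_t-\Delta u+|u|^\alpha u=0$. Suppose that there exist $R_0>0$ and $c_0>0$ such that $$u_0(x)\ge c_0\psi_0(x),\qquad x\in\Omega_m,\ |x|\ge R_0.$$ Then $$\lim_{t\to\infty}t^{1/\alpha}u(t,x\sqrt t)=g(x)$$ uniformly on compact subsets of $\overline{\Omega_m}$, where $g\in C_0^{b,u}(\Omega_m)$ is the profile of the self-similar solution $V(t,x)=t^{-1/\alpha}g(x/\sqrt t)$ given by $V=\lim_{\lambda\to\infty}\Gamma_\lambda^{2/\alpha}v$, $v$ being the solution of the same equation on $\Omega_m$ with initial value identically $1$.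
   Context: $N\ge1$ is an integer. $\Omega_m=\{x\in\mathbb R^N: x_1>0,\dots,x_m>0\}$. Let $\rho_m(x)=\dfrac{|x|^{\gamma+2m}}{x_1\cdots x_m}$ for $x\in\Omega_m$. $\mathcal X_{m,\gamma}$ is the Banach space of (a.e. classes of) measurable $\psi:\Omega_m\to\mathbb R$ with $\rho_m\psi\in L^\infty(\Omega_m)$, normed by $\|\psi\|_{\mathcal X_{m,\gamma}}=\|\rho_m\psi\|_{L^\infty(\Omega_m)}$. $C_0(\Omega_m)$ is the space of continuous $f:\overline{\Omega_m}\to\mathbb R$ with $f=0$ on $\partial\Omega_m$ and $f(x)\to0$ as $|x|\to\infty$ in $\Omega_m$, with the sup norm. $C_0^{b,u}(\Omega_m)$ is the space of bounded uniformly continuous functions on $\Omega_m$ which are zero on $\partial\Omega_m$ (not necessarily tending to $0$ at infinity). $\psi_0(x)=c_{m,\gamma}\,x_1\cdots x_m|x|^{-\gamma-2m}$ on $\Omega_m$, with $c_{m,\gamma}=\gamma(\gamma+2)\cdots(\gamma+2m-2)$. For $u_0\in\mathcal X_{m,\gamma}$, $\mathcal S_m(t)u_0=u(t)$, $t>0$, where $u\in C((0,\infty),C_0(\Omega_m))$ is the unique (classical on $(0,\infty)\times\Omega_m$) solution of $u_t-\Delta u+|u|^\alpha u=0$ such that $u(t)\to u_0$ in $L^1_{\rm loc}(\Omega_m)$ as $t\to0$ and $\|u(t)\|_{\mathcal X_{m,\gamma}}\le C\|u_0\|_{\mathcal X_{m,\gamma}}$ for all $t>0$ with $C$ independent of $u_0$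 (existence and uniqueness of such $u$ being known). The heat semigroup on $\Omega_m$ is $e^{t\Delta_m}\psi(x)=\int_{\Omega_m}K_t(x,y)\psi(y)\,dy$ with $K_t(x,y)=(4\pi t)^{-N/2}\prod_{j=m+1}^N e^{-|x_j-y_j|^2/4t}\prod_{i=1}^m[e^{-|x_i-y_i|^2/4t}-e^{-|x_i+y_i|^2/4t}]$. For $v_0\in L^\infty(\Omega_m)$, the solution with initial value $v_0$ is the unique $v\in C((0,\infty);C_0^{b,u}(\Omega_m))$ satisfying $v(t)=e^{t\Delta_m}v_0-\int_0^te^{(t-s)\Delta_m}(|v(s)|^\alpha v(s))\,ds$ for $t>0$; it is a classical solution for $t>0$ and $\|v(t)-e^{t\Delta_m}v_0\|_{L^\infty}\to0$ as $t\to0$. Dilations: $\Gamma_\lambda^{2/\alpha}v(t,x)=\lambda^{2/\alpha}v(\lambda^2t,\lambda x)$. With $v_0\equiv1$, the limit $V=\lim_{\lambda\to\infty}\Gamma_\lambda^{2/\alpha}v$ exists uniformly on compact subsets of $(0,\infty)\times\overline{\Omega_m}$ and is a self-similar solution (i.e. $\Gamma_\lambda^{2/\alpha}V=V$ for all $\lambda>0$), with $g=V(1,\cdot)\in C_0^{b,u}(\Omega_m)$. *)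

(* Defs.v *)
From HB Require Import structures.
From mathcomp Require Import all_boot all_order all_algebra.
From mathcomp Require Import all_classical all_reals all_analysis.
Set Implicit Arguments.
Unset Strict Implicit.
Unset Printing Implicit Defensive.
Import Order.TTheory GRing.Theory Num.Theory.
Import numFieldNormedType.Exports.
Local Open Scope classical_set_scope.
Local Open Scope ring_scope.

(* The product sigma-algebra on R^N, i.e. the Borel one, as for [n.-tuple T]. *)
Section measurable_row.
Context {R : realType} {n : nat}.

Let coor : 'I_n -> 'rV[R]_n -> R := fun i x => x ord0 i.

Let row_set0 : g_sigma_preimage coor set0.
Proof. exact: sigma_algebra0. Qed.

Let row_setC A : g_sigma_preimage coor A -> g_sigma_preimage coor (~` A).
Proof. exact: sigma_algebraC. Qed.

Let row_bigcup (F : _^nat) : (forall i, g_sigma_preimage coor (F i)) ->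
  g_sigma_preimage coor (\bigcup_i (F i)).
Proof. exact: sigma_algebra_bigcup. Qed.

HB.instance Definition _ := @isMeasurable.Build default_measure_display
  'rV[R]_n (g_sigma_preimage coor) row_set0 row_setC row_bigcup.

Lemma measurable_coord (i : 'I_n) :
  measurable_fun [set: 'rV[R]_n] (fun x => x ord0 i).
Proof.
move=> _ Y mY; rewrite setTI; apply: sub_sigma_algebra => /=.
rewrite -bigcup_seq/=; exists i => /=; first by rewrite mem_index_enum.
by exists Y => //; rewrite setTI.
Qed.

Lemma measurable_fun_row d (T : measurableType d) (f : T -> 'rV[R]_n) :
  (forall i, measurable_fun [set: T] (fun t => f t ord0 i)) ->
  measurable_fun [set: T] f.
Proof.
move=> mf _ A mA; rewrite setTI.
move: A mA; apply: smallest_sub.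
  split=> /=.
  - by rewrite preimage_set0.
  - by move=> A mA; rewrite setTD preimage_setC; exact: measurableC.
  - by move=> F mF; rewrite preimage_bigcup; exact: bigcup_measurable.
move=> A; rewrite -bigcup_seq => -[i _ [B mB <-]]; rewrite setTI.
have := mf i measurableT B mB; rewrite setTI; exact.
Qed.

End measurable_row.

(* N-dimensional Lebesgue measure, by iterated products with the library's
   one-dimensional one; [lebesgue_row_prod] characterizes it. *)
Section lebesgue_row.
Context {R : realType}.

Definition row_cons n (p : R * 'rV[R]_n) : 'rV[R]_n.+1 :=
  row_mx (p.1)%:M p.2.

Lemma row_cons0 n p : @row_cons n p ord0 ord0 = p.1.
Proof.
rewrite /row_cons mxE; case: splitP => [j|j //] _.
by rewrite !ord1 mxE.
Qed.

Lemma row_consS n p j : @row_cons n p ord0 (lift ord0 j) = p.2 ord0 j.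
Proof.
rewrite /row_cons mxE; case: splitP => [k|k /eqP].
  by rewrite ord1.
by rewrite /= /bump /= eqSS => /eqP/val_inj ->.
Qed.

Lemma measurable_row_cons n : measurable_fun setT (@row_cons n).
Proof.
apply: measurable_fun_row => i; have [j ->|->] := unliftP ord0 i.
  under eq_fun do rewrite row_consS.
  exact: (measurableT_comp (measurable_coord j) measurable_snd).
have -> : (fun t : R * 'rV[R]_n => row_cons t ord0 ord0) = fst.
  by apply/funext => t; rewrite row_cons0.
exact: measurable_fst.
Qed.

Section step.
Context n (mu : {sigma_finite_measure set 'rV[R]_n -> \bar R}).

Definition lebesgue_step : set 'rV[R]_n.+1 -> \bar R :=
  pushforward (@lebesgue_measure R \x mu)%E (@row_cons n).

Let lebesgue_step0 : lebesgue_step set0 = 0%E.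
Proof. by rewrite /lebesgue_step /pushforward preimage_set0 measure0. Qed.

Let lebesgue_step_ge0 A : (0 <= lebesgue_step A)%E.
Proof. by apply: integral_ge0 => *. Qed.

Let lebesgue_step_sigma_additive : semi_sigma_additive lebesgue_step.
Proof.
have mcons A : measurable A -> measurable (@row_cons n @^-1` A).
  by move=> mA; rewrite -[X in measurable X]setTI; exact: measurable_row_cons.
move=> F mF tF mUF; rewrite /lebesgue_step /pushforward preimage_bigcup.
apply: measure_semi_sigma_additive.
- by move=> i; exact: mcons.
- apply/trivIsetP => /= i j _ _ ij; rewrite -preimage_setI.
  by move/trivIsetP : tF => /(_ _ _ _ _ ij) ->//; rewrite preimage_set0.
- by rewrite -preimage_bigcup; exact: mcons.
Qed.

HB.instance Definition _ := isMeasure.Build _ _ _ lebesgue_step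
  lebesgue_step0 lebesgue_step_ge0 lebesgue_step_sigma_additive.

Let sigma_finite_step : sigma_finite setT lebesgue_step.
Proof.
pose split_row (x : 'rV[R]_n.+1) : R * 'rV[R]_n :=
  (x ord0 ord0, \row_j x ord0 (lift ord0 j)).
have sK : cancel (@row_cons n) split_row.
  move=> [a v]; rewrite /split_row row_cons0; congr pair.
  by apply/rowP => j; rewrite mxE row_consS.
have ms : measurable_fun setT split_row.
  apply/measurable_fun_pairP; split; first exact: measurable_coord.
  apply: measurable_fun_row => i; rewrite /comp /=.
  by under eq_fun do rewrite mxE; exact: measurable_coord.
have /sigma_finiteP[F [TF ndF Foo]] := sigma_finiteT (@lebesgue_measure R).
have /sigma_finiteP[G [TG ndG Goo]] := sigma_finiteT mu.
exists (fun k => split_row @^-1` (F k `*` G k)).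
  rewrite -preimage_bigcup (_ : \bigcup_k _ = setT) ?preimage_setT //.
  apply/seteqP; split => // -[x y] _.
  have [i _ Fx] : (\bigcup_i F i) x by rewrite -TF.
  have [j _ Gy] : (\bigcup_i G i) y by rewrite -TG.
  exists (maxn i j) => //; split.
  - by move: x Fx; exact/subsetPset/ndF/leq_maxl.
  - by move: y Gy; exact/subsetPset/ndG/leq_maxr.
move=> k; have [mF Fk] := Foo k; have [mG Gk] := Goo k; split.
  by rewrite -[X in measurable X]setTI; apply: ms => //; exact: measurableX.
rewrite /lebesgue_step /pushforward -comp_preimage.
have -> : split_row \o @row_cons n = id by apply/funext => p; exact: sK.
rewrite preimage_id.
by rewrite product_measure1E// lte_mul_pinfty// ge0_fin_numE.
Qed.

HB.instance Definition _ :=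
  Measure_isSigmaFinite.Build _ _ _ lebesgue_step sigma_finite_step.

End step.

Fixpoint lebesgue_row (n : nat) :
    {sigma_finite_measure set 'rV[R]_n -> \bar R} :=
  if n is n'.+1 then lebesgue_step (lebesgue_row n')
  else \d_(0 : 'rV[R]_0).

Lemma lebesgue_row_prod n (A : 'I_n -> set R) :
  (forall i, measurable (A i)) ->
  lebesgue_row n [set x | forall i, A i (x ord0 i)] =
  (\prod_(i < n) lebesgue_measure (A i))%E.
Proof.
elim: n A => [|n ih] A mA.
  by rewrite big_ord0 /= diracE mem_set // => -[].
have mB : measurable [set x : 'rV[R]_n | forall i, A (lift ord0 i) (x ord0 i)].
  rewrite (_ : [set _ | _] =
    \bigcap_i ((fun x : 'rV[R]_n => x ord0 i) @^-1` A (lift ord0 i))).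
    apply: fin_bigcap_measurable => // i _.
    by rewrite -[X in measurable X]setTI; exact: measurable_coord.
  by apply/seteqP; split => x /= => [h i _|h i]; exact: h.
rewrite big_ord_recl -ih //= /lebesgue_step /pushforward -product_measure1E //.
congr (_ _); apply/seteqP; split => -[a v] /= => [h|[h0 hS] i].
  split; first by have := h ord0; rewrite row_cons0.
  by move=> i; have := h (lift ord0 i); rewrite row_consS.
have [j ->|->] := unliftP ord0 i; last by rewrite row_cons0.
by rewrite row_consS.
exact: mA.
Qed.

End lebesgue_row.

Section function_spaces.
Context {R : realType} {N : nat}.
Implicit Types (x y : 'rV[R]_N) (f psi : 'rV[R]_N -> R) (m : nat).

(* The library's norm on 'rV[R]_N is the sup norm. *)
Definition enorm x : R := Num.sqrt (\sum_(i < N) x ord0 i ^+ 2).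

Definition Omega m : set 'rV[R]_N :=
  [set x | forall i : 'I_N, (i < m)%N -> 0 < x ord0 i].

Definition frontier (A : set 'rV[R]_N) := closure A `\` interior A.

Definition coord_prod m x : R := \prod_(i < N | (i < m)%N) x ord0 i.

Definition rho m (gam : R) x : R :=
  enorm x `^ (gam + 2 * m%:R) / coord_prod m x.

Definition Xnorm m (gam : R) psi : \bar R :=
  'N[lebesgue_row N]_+oo%E[EFin \o ((rho m gam \* psi)%R \_ (Omega m))].

(* Elements of X are given by representatives of the a.e. classes. *)
Definition Xspace m (gam : R) : set ('rV[R]_N -> R) :=
  [set psi | measurable_fun (Omega m) psi /\ (Xnorm m gam psi < +oo)%E].

Definition psi0 m (gam : R) x : R :=
  (\prod_(k < m) (gam + 2 * k%:R)) * coord_prod m x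
  * enorm x `^ (- gam - 2 * m%:R).

(* Below, functions are total on R^N, but only their values on the closure of
   [Omega m] are relevant. *)
Definition C0 m : set ('rV[R]_N -> R) := [set f |
  [/\ {within closure (Omega m), continuous f},
      forall x, frontier (Omega m) x -> f x = 0 &
      forall e : R, 0 < e -> exists M : R,
        forall x, Omega m x -> M <= enorm x -> `|f x| <= e]].

Definition C0bu m : set ('rV[R]_N -> R) := [set f |
  [/\ exists M : R, forall x, closure (Omega m) x -> `|f x| <= M,
      forall e : R, 0 < e -> exists2 d : R, 0 < d &
        forall x y, closure (Omega m) x -> closure (Omega m) y ->
          enorm (x - y) < d -> `|f x - f y| < e &
      forall x, frontier (Omega m) x -> f x = 0]].

(* [u] is in C((0,oo); Y), [Y] being normed by the sup norm. *)
Definition time_continuous m (Y : set ('rV[R]_N -> R))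
    (u : R -> 'rV[R]_N -> R) : Prop :=
  forall t, 0 < t ->
    Y (u t) /\ {uniform closure (Omega m), u @ t --> u t}.

Definition locally_uniformly (T : topologicalType) (D : set T)
    (F : R -> T -> R) (f : T -> R) : Prop :=
  {family [set K | compact K /\ K `<=` D], F @ +oo --> f}.

End function_spaces.

Section equation.
Context {R : realType} {N : nat}.
Implicit Types (x y : 'rV[R]_N) (psi : 'rV[R]_N -> R) (m : nat).
Implicit Types (u v V : R -> 'rV[R]_N -> R) (alpha gam : R).

Definition partial (i : 'I_N) psi : 'rV[R]_N -> R :=
  fun x => 'D_(delta_mx ord0 i) psi x.

Definition laplacian psi x : R := \sum_(i < N) partial i (partial i psi) x.

Definition absorption alpha (r : R) : R := `|r| `^ alpha * r.

(* u is of class C^1 in t and C^2 in x on (0,oo) x Omega. *)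
Definition regular m u : Prop := forall t x, 0 < t -> Omega m x ->
  [/\ derivable (u ^~ x) t 1,
      {for (t, x), continuous
        (fun p : R * 'rV[R]_N => derive1 (u ^~ p.2) p.1)},
      forall i, derivable (u t) x (delta_mx ord0 i) /\
        {for (t, x), continuous
          (fun p : R * 'rV[R]_N => partial i (u p.1) p.2)} &
      forall i j, derivable (partial i (u t)) x (delta_mx ord0 j) /\
        {for (t, x), continuous
          (fun p : R * 'rV[R]_N => partial j (partial i (u p.1)) p.2)}].

Definition classical_solution m alpha u : Prop :=
  regular m u /\
  forall t x, 0 < t -> Omega m x ->
    derive1 (u ^~ x) t - laplacian (u t) x + absorption alpha (u t x) = 0.

Definition L1loc_initial_value m u psi : Prop :=
  forall K, compact K -> K `<=` Omega m ->
    (\int[lebesgue_row N]_(x in K) (`|u t x - psi x|%R)%:E)%E @[t --> 0^'+] --> 0%E.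

(* The constant [C] is common to all initial values; for each of them these
   properties determine the solution. *)
Definition solution_operator m gam alpha
    (S : R -> ('rV[R]_N -> R) -> 'rV[R]_N -> R) : Prop :=
  exists C : R, forall u0 : 'rV[R]_N -> R, Xspace m gam u0 ->
    [/\ time_continuous m (C0 m) (S ^~ u0),
        classical_solution m alpha (S ^~ u0),
        L1loc_initial_value m (S ^~ u0) u0 &
        forall t, 0 < t ->
          (Xnorm m gam (S t u0) <= C%:E * Xnorm m gam u0)%E].

Definition heat_kernel m (t : R) x y : R :=
  (4 * pi * t) `^ (- (N%:R / 2))
  * (\prod_(j < N | (m <= j)%N)
       expR (- (x ord0 j - y ord0 j) ^+ 2 / (4 * t)))
  * (\prod_(i < N | (i < m)%N)
       (expR (- (x ord0 i - y ord0 i) ^+ 2 / (4 * t))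
        - expR (- (x ord0 i + y ord0 i) ^+ 2 / (4 * t)))).

Definition heat m (t : R) psi x : R :=
  \int[lebesgue_row N]_(y in Omega m) (heat_kernel m t x y * psi y).

(* Library integrals are total: the second clause says that the integral in
   Duhamel's formula converges absolutely (the kernel is nonnegative). *)
Definition mild_solution m alpha (v0 : 'rV[R]_N -> R) v : Prop :=
  [/\ time_continuous m (C0bu m) v,
      forall t x, 0 < t -> Omega m x ->
        (\int[lebesgue_measure]_(s in `]0%R, t[)
           \int[lebesgue_row N]_(y in Omega m)
             (heat_kernel m (t - s) x y * `|absorption alpha (v s y)|)%R%:E
         < +oo)%E &
      forall t x, 0 < t -> Omega m x ->
        v t x = heat m t v0 x
          - \int[lebesgue_measure]_(s in `]0, t[)
              heat m (t - s) (absorption alpha \o v s) x].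

Definition dilation (k lam : R) v : R -> 'rV[R]_N -> R :=
  fun t x => lam `^ k * v (lam ^+ 2 * t) (lam *: x).

Definition dilation_limit m alpha v V : Prop :=
  locally_uniformly
    ([set t : R | 0 < t] `*` closure (Omega m))
    (fun lam p => dilation (2 / alpha) lam v p.1 p.2)
    (fun p => V p.1 p.2).

Definition selfsimilar_profile m alpha V (g : 'rV[R]_N -> R) : Prop :=
  forall t x, 0 < t -> closure (Omega m) x ->
    V t x = t `^ (- alpha^-1) * g ((Num.sqrt t)^-1 *: x).

End equation.

(* Main.v *)
(* Comparison principle. If [w] satisfies Duhamel's formula between positive
   times and [u] is a classical solution, then [w t - u t] is at most the heat
   flow, from time [s] to time [t], of the positive part of [w s - u s]. At a
   positive maximum of the (penalized) difference, the restarted formula for [w]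
   is expanded for small time steps, averaged over the reflections of the
   coordinates, and contradicts the equation satisfied by [u].

   Upper bound. [u] is bounded from time 1 on, so [k u(1 + lam^2 t, lam x)], with
   [k^alpha = lam^2] and [k] small, starts below 1 and stays below [v]; the
   dilations of [v] converge to the self-similar solution.

   Lower bound. The dilation [u_lam] of [u] has an initial value which, as
   [lam -> oo], exceeds 1 on every compact subset of [Omega], since
   [2 / alpha > gam + m]. The comparison principle bounds [v T - u_lam T] by the
   integral of the positive part of [1 - u_lam s] against the weight
   [x_1 ... x_m exp(- c |x|^2)]. This integral is small: first let [s -> 0], where
   the X-norm controls the mass near the boundary, the origin and infinity, then
   let [lam -> oo]. *)

(* The two functions to be compared are given differently: [v] by Duhamel's formula alone, [u] as a
   classical solution that attains its initial value only in L^1_loc. So the comparison starts at a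
   positive time and mixes both notions: [w] is evaluated by its restarted formula over one small
   step h, [u] by a second-order jet. Every kernel error in that step (tails, reflected sources,
   truncation to a cube) has to be o(h), which is why these estimates carry the power t^2. Averaging
   over reflections leaves the Gaussian on a cube invariant and reduces Taylor's formula to second
   differences in one variable. The sign of [v] is not given. It follows by comparing [- v] with 0,
   and the absolute convergence of Duhamel's integral makes the initial error vanish. The weight
   comes from 1 - exp(- x y / t) <= x y / t, used once in each of the m Dirichlet directions. It is
   essential: a function in X may behave like |x|^(- gam - m) at the origin, which need not be
   integrable, while the weight leaves |x|^(- gam), integrable because gam < N. Nonnegative
   integrands are kept in the extended reals, so that Tonelli's theorem applies before finiteness is
   known. *)
Require Import Defs.
From HB Require Import structures.
From mathcomp Require Import all_boot all_order all_algebra.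
From mathcomp Require Import all_classical all_reals all_analysis.
From mathcomp Require Import measurable_realfun ess_sup_inf ring lra.
Import Order.TTheory GRing.Theory Num.Theory.
Import numFieldNormedType.Exports.
Local Open Scope classical_set_scope.
Local Open Scope ring_scope.
Set Implicit Arguments.
Unset Strict Implicit.

(** * Integration and continuity on row vectors *)

Section row_integration.
Context {R : realType}.
Local Notation leb := (@lebesgue_measure R).
Local Open Scope ereal_scope.

Lemma integral_row_cons n (f : 'rV[R]_n.+1 -> \bar R) :
  measurable_fun [set: 'rV[R]_n.+1] f -> (forall x, 0 <= f x) ->
  \int[lebesgue_row n.+1]_x f x =
  \int[leb]_a \int[lebesgue_row n]_v f (row_cons (a, v)).
Proof.
move=> mf f0.
have mrc := @measurable_row_cons R n.
transitivity (\int[pushforward (leb \x lebesgue_row n) (@row_cons R n)]_x f x).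
  by apply: eq_measure_integral.
rewrite ge0_integral_pushforward//.
rewrite preimage_setT fubini_tonelli1//.
- exact: measurableT_comp.
- by move=> x; exact: f0.
Qed.

Lemma measurable_scale_shift (c d : R) :
  measurable_fun setT (fun x : R => (c * x + d)%R).
Proof. by apply: measurable_funD => //; exact: measurable_funM. Qed.

(** The push-forward under the affine map, multiplied by |c|, agrees with Lebesgue measure on
    half-open intervals, and these determine it. For c < 0 the preimage of an interval open on the
    left is open on the right, hence the two cases. *)
Lemma lebesgue_measure_affine (c d : R) (A : set R) :
  c != 0%R -> measurable A ->
  leb ((fun x : R => (c * x + d)%R) @^-1` A) = `|c|^-1%:E * leb A.
Proof.
move=> c0; have mf := measurable_scale_shift c d.
have mf' : measurable_fun setT
  ((fun x : R => (c * x + d)%R) : measurableTypeR R -> measurableTypeR R) := mf.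
have cc0 : (0 <= `|c|)%R by [].
pose mu0 : {measure set (measurableTypeR R) -> \bar R} := mscale (NngNum cc0)
  (pushforward leb ((fun x : R => (c * x + d)%R) : _ -> measurableTypeR R)).
pose mu := mu0 mf'.
move=> mA.
suff -> : leb A = mu A.
  rewrite /mu /mu0 /mscale /= muleA -EFinM mulVf ?normr_eq0// mul1e.
  by rewrite /pushforward.
apply: lebesgue_measure_unique => // _ [[a b]] _ <-.
change (leb `]a, b] = `|c|%:E * leb ((fun x : R => (c * x + d)%R) @^-1` `]a, b])).
have [cp|cn|/eqP] := ltgtP 0%R c; last by rewrite eq_sym (negbTE c0).
- have -> : (fun x : R => (c * x + d)%R) @^-1` `]a, b] =
            [set` `](a - d) / c, (b - d) / c]%R].
    apply/seteqP; split=> x /=; rewrite !in_itv/= ltr_pdivrMr// ler_pdivlMr//.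
      by rewrite ltrBlDr lerBrDr (mulrC x).
    by rewrite ltrBlDr lerBrDr (mulrC x).
  rewrite !lebesgue_measure_itv/= !lte_fin ltr_pM2r ?invr_gt0// ltrD2r.
  case: ifP => _; last by rewrite mule0.
  rewrite -!EFinB -EFinM; congr EFin.
  by rewrite gtr0_norm//; field; rewrite c0.
- have -> : (fun x : R => (c * x + d)%R) @^-1` `]a, b] =
            [set` `[(b - d) / c, (a - d) / c[%R].
    apply/seteqP; split=> x /=; rewrite !in_itv/= ltr_ndivlMr// ler_ndivrMr//;
      by rewrite ltrBlDr lerBrDr (mulrC x) andbC.
  rewrite !lebesgue_measure_itv/= !lte_fin ltr_nM2r ?invr_lt0// ltrD2r.
  case: ifP => _; last by rewrite mule0.
  rewrite -!EFinB -EFinM; congr EFin.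
  by rewrite ltr0_norm//; field; rewrite c0.
Qed.

Lemma integral_affine (c d : R) (f : R -> \bar R) :
  c != 0%R -> measurable_fun setT f -> (forall x, 0 <= f x) ->
  \int[leb]_x f (c * x + d)%R = `|c|^-1%:E * \int[leb]_x f x.
Proof.
move=> c0 mf f0; have mh := measurable_scale_shift c d.
have cc0 : (0 <= `|c|^-1)%R by rewrite invr_ge0.
rewrite -(@ge0_integral_mscale _ _ _ leb _ _ (NngNum cc0))//.
transitivity (\int[pushforward leb
    ((fun x : R => (c * x + d)%R) : _ -> measurableTypeR R)]_x f x).
  by rewrite ge0_integral_pushforward.
apply: eq_measure_integral => A mA _ /=.
by rewrite /pushforward lebesgue_measure_affine.
Qed.

Definition row_affine n (c d x : 'rV[R]_n) : 'rV[R]_n :=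
  \row_i (c ord0 i * x ord0 i + d ord0 i)%R.

Lemma measurable_row_affine n (c d : 'rV[R]_n) :
  measurable_fun [set: 'rV[R]_n] (row_affine c d).
Proof.
apply: measurable_fun_row => i.
rewrite /row_affine; under eq_fun do rewrite mxE.
apply: measurable_funD => //; apply: measurable_funM => //.
exact: measurable_coord.
Qed.

Lemma integral_row_affine n (c d : 'rV[R]_n) (f : 'rV[R]_n -> \bar R) :
  (forall i, c ord0 i != 0%R) ->
  measurable_fun [set: 'rV[R]_n] f -> (forall x, 0 <= f x) ->
  \int[lebesgue_row n]_x f (row_affine c d x) =
  (\prod_i `|c ord0 i|^-1)%R%:E * \int[lebesgue_row n]_x f x.
Proof.
elim: n c d f => [|n ih] c d f c0 mf f0.
  rewrite big_ord0 mul1e; apply: eq_integral => x _.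
  by congr f; apply/rowP => -[].
have mrc := @measurable_row_cons R n.
rewrite !integral_row_cons//; last first.
  exact: measurableT_comp (measurable_row_affine _ _).
pose c' : 'rV[R]_n := \row_i c ord0 (lift ord0 i).
pose d' : 'rV[R]_n := \row_i d ord0 (lift ord0 i).
pose F (a : R) := \int[lebesgue_row n]_v f (row_cons (a, v)).
have mfr : measurable_fun setT (f \o @row_cons R n).
  exact: measurableT_comp.
have mF : measurable_fun setT F.
  by apply: (measurable_fun_fubini_tonelli_F (f \o @row_cons R n)) => // x; exact: f0.
have E a v : row_affine c d (row_cons (a, v)) =
    row_cons ((c ord0 ord0 * a + d ord0 ord0)%R, row_affine c' d' v).
  apply/rowP => i; rewrite mxE; have [j ->|->] := unliftP ord0 i.
    by rewrite !row_consS !mxE.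
  by rewrite !row_cons0.
transitivity (\int[leb]_a ((\prod_i `|c' ord0 i|^-1)%R%:E *
    F (c ord0 ord0 * a + d ord0 ord0)%R)).
  apply: eq_integral => a _; rewrite /F -(ih _ d')//.
  - by apply: eq_integral => v _; rewrite E.
  - by move=> i; rewrite mxE.
  - exact: (measurableT_comp mfr (pair1_measurable (c ord0 ord0 * a + d ord0 ord0)%R)).
have F0 x : 0 <= F x by apply: integral_ge0 => v _; exact: f0.
have mG : measurable_fun setT (fun a => F (c ord0 ord0 * a + d ord0 ord0)%R).
  exact: (measurableT_comp mF (measurable_scale_shift _ _)).
have k0 : (0 <= \prod_i `|c' ord0 i|^-1)%R.
  by apply: prodr_ge0 => i _; rewrite invr_ge0.
rewrite (ge0_integralZl_EFin leb measurableT (fun x _ => F0 _) mG k0).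
rewrite (integral_affine (d ord0 ord0) (c0 ord0) mF)//.
rewrite muleA -EFinM big_ord_recl mulrC; congr (EFin (_ * _)%R * _).
by apply: eq_bigr => i _; rewrite mxE.
Qed.

Lemma measurable_coord_prod n (f : 'I_n -> R -> R) :
  (forall i, measurable_fun setT (f i)) ->
  measurable_fun [set: 'rV[R]_n] (fun x => \prod_i f i (x ord0 i))%R.
Proof.
move=> mf; apply: (@measurable_prod _ _ _ _ _ _
  (fun i (x : 'rV[R]_n) => f i (x ord0 i))) => i _.
exact: measurableT_comp (measurable_coord _).
Qed.

Lemma integral_row_prod n (f : 'I_n -> R -> R) :
  (forall i, measurable_fun setT (f i)) -> (forall i x, 0 <= f i x)%R ->
  \int[lebesgue_row n]_x (\prod_i f i (x ord0 i))%R%:E =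
  \prod_i \int[leb]_a (f i a)%:E.
Proof.
elim: n f => [|n ih] f mf f0.
  under eq_integral do rewrite big_ord0.
  by rewrite big_ord0 integral_cst//= diracE mem_set// mul1e.
rewrite big_ord_recl integral_row_cons; last 2 first.
- by apply/measurable_EFinP; exact: (measurable_coord_prod mf).
- by move=> x; rewrite lee_fin; apply: prodr_ge0.
have mfl : measurable_fun [set: 'rV[R]_n]
    (fun v => (\prod_i f (lift ord0 i) (v ord0 i))%R%:E).
  apply/measurable_EFinP.
  exact: (@measurable_coord_prod n (fun i => f (lift ord0 i))).
have pl0 (v : 'rV[R]_n) : 0 <= (\prod_i f (lift ord0 i) (v ord0 i))%R%:E.
  by rewrite lee_fin; apply: prodr_ge0.
rewrite -(ih (fun i => f (lift ord0 i)))//.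
rewrite -ge0_integralZr//; last 3 first.
- by apply/measurable_EFinP; exact: mf.
- by move=> x _; rewrite lee_fin.
- by apply: integral_ge0.
apply: eq_integral => a _; rewrite -ge0_integralZl//; last by rewrite lee_fin.
apply: eq_integral => v _; rewrite big_ord_recl row_cons0 EFinM; congr (_ * _%:E).
by apply: eq_bigr => i _; rewrite row_consS.
Qed.

End row_integration.

(** * Measurability of continuous functions on row vectors *)

Section row_continuity.
Context {R : realType}.

(* Coordinatewise closeness: the sup norm, without its bigop. *)
Definition nearby n (d : R) (x y : 'rV[R]_n) :=
  forall i, `|y ord0 i - x ord0 i| < d.

Definition continuous_on n (D : set 'rV[R]_n) (f : 'rV[R]_n -> R) :=
  forall x, D x -> forall e, 0 < e -> exists2 d, 0 < d &
    forall y, D y -> nearby d x y -> `|f y - f x| < e.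

(** The index of the grid cell of mesh 1/(k+1) containing x. Since it takes countably many values,
    every function of it is measurable. *)
Definition floor_row n (k : nat) (x : 'rV[R]_n) : 'rV[int]_n :=
  \row_i Num.floor (x ord0 i * k.+1%:R).

Lemma measurable_floor_row n k (q : 'rV[int]_n) :
  measurable [set x : 'rV[R]_n | floor_row k x = q].
Proof.
rewrite (_ : [set _ | _] = \bigcap_i ((fun x : 'rV[R]_n => x ord0 i) @^-1`
   [set` `[(q ord0 i)%:~R / k.+1%:R, (q ord0 i + 1)%:~R / k.+1%:R[%R])).
  apply: fin_bigcap_measurable => // i _.
  by rewrite -[X in measurable X]setTI; exact: measurable_coord.
apply/seteqP; split => x /=.
  move=> <- i _ /=; rewrite in_itv/= mxE ler_pdivrMr// ltr_pdivlMr//.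
  exact: floor_itv.
move=> h; apply/rowP => i; rewrite mxE; apply: floor_def.
by have /= := h i I; rewrite in_itv/= ler_pdivrMr// ltr_pdivlMr.
Qed.

(* Rounding strictly upwards keeps the sampling points inside upward closed sets. *)
Definition round_up n (k : nat) (q : 'rV[int]_n) : 'rV[R]_n :=
  \row_i ((q ord0 i + 1)%:~R / k.+1%:R).

Lemma round_up_gt n k (x : 'rV[R]_n) i :
  x ord0 i < round_up k (floor_row k x) ord0 i <= x ord0 i + k.+1%:R^-1.
Proof.
rewrite !mxE ltr_pdivlMr// ler_pdivrMr//.
have /andP[h1 h2] := floor_itv (x ord0 i * k.+1%:R).
by rewrite h2/= mulrDl mulVf// intrD lerD2r.
Qed.

Lemma measurable_round_up n k (f : 'rV[R]_n -> R) :
  measurable_fun [set: 'rV[R]_n] (fun x => f (round_up k (floor_row k x))).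
Proof.
move=> _ B mB; rewrite setTI.
rewrite (_ : _ @^-1` _ = \bigcup_(q in [set: 'rV[int]_n])
   [set x : 'rV[R]_n | floor_row k x = q /\ B (f (round_up k q))]).
  apply: countable_bigcupT_measurable => [|q]; first exact: countableP.
  have [h|h] := pselect (B (f (round_up k q))).
    rewrite (_ : [set _ | _] = [set x | floor_row k x = q]).
      exact: measurable_floor_row.
    by apply/seteqP; split=> x //= -[].
  rewrite (_ : [set _ | _] = set0) //.
  by apply/seteqP; split=> x //= -[].
apply/seteqP; split=> x /=; first by exists (floor_row k x).
by move=> [q _ [<-]].
Qed.

Definition upward_closed n (D : set 'rV[R]_n) :=
  forall x y : 'rV[R]_n, D x -> (forall i, x ord0 i < y ord0 i) -> D y.

(** On D, f is the pointwise limit of its values at the rounded-up points. These approximations are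
    constant on each of countably many measurable cells, so the product sigma-algebra never has to
    be related to open sets. *)
Lemma continuous_on_measurable n (D : set 'rV[R]_n) f :
  measurable D -> upward_closed D -> continuous_on D f -> measurable_fun D f.
Proof.
move=> mD uD cf.
apply: (measurable_fun_cvg (h := fun k x => f (round_up k (floor_row k x)))).
  by move=> k; apply: measurable_funTS; exact: measurable_round_up.
move=> x Dx; apply/cvgrPdist_lt => e e0.
have [d d0 hd] := cf x Dx e e0.
near=> k.
rewrite distrC; apply: hd.
  by apply: (uD x) => // i; have /andP[] := round_up_gt k x i.
move=> i; have /andP[h1 h2] := round_up_gt k x i.
rewrite gtr0_norm ?subr_gt0// ltrBlDl (le_lt_trans h2)// ltrD2l.
by near: k; exact: near_infty_natSinv_lt (PosNum d0).
Unshelve. all: by end_near. Qed.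

Definition flow n := R -> 'rV[R]_n -> R.

Definition jointly_continuous n (D : set 'rV[R]_n) (u : flow n) :=
  forall t x, 0 < t -> D x -> forall e, 0 < e -> exists2 d, 0 < d &
    forall s y, 0 < s -> D y -> `|s - t| < d -> nearby d x y ->
      `|u s y - u t x| < e.

Lemma jointly_continuous_slice n (D : set 'rV[R]_n) (u : flow n) t :
  0 < t -> jointly_continuous D u -> continuous_on D (u t).
Proof.
move=> t0 cu x Dx e e0; have [d d0 hd] := cu t x t0 Dx e e0.
by exists d => // y Dy xy; apply: hd => //; rewrite subrr normr0.
Qed.

(** Time is prepended to x as one more coordinate. The set of positive times is upward closed too,
    so [continuous_on_measurable] applies in dimension n + 1. *)
Lemma jointly_continuous_measurable n (D : set 'rV[R]_n) (u : flow n) :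
  measurable D -> upward_closed D -> jointly_continuous D u ->
  measurable_fun ([set t : R | 0 < t] `*` D)
    (fun p : R * 'rV[R]_n => u p.1 p.2).
Proof.
move=> mD uD cu.
pose tail (z : 'rV[R]_n.+1) : 'rV[R]_n := \row_j z ord0 (lift ord0 j).
have mt : measurable_fun setT tail.
  apply: measurable_fun_row => i; rewrite /tail.
  by under eq_fun do rewrite mxE; exact: measurable_coord.
have tK t x : tail (row_cons (t, x)) = x.
  by apply/rowP => j; rewrite mxE row_consS.
pose D' := [set z : 'rV[R]_n.+1 | 0 < z ord0 ord0 /\ D (tail z)].
have mpos : measurable [set t : R | 0 < t].
  rewrite (_ : [set _ | _] = [set` `]0, +oo[%R]) //.
  by apply/seteqP; split=> x /=; rewrite in_itv/= andbT.
have mD' : measurable D'.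
  apply: (@measurableI _ _ ((fun z : 'rV[R]_n.+1 => z ord0 ord0) @^-1` [set t | 0 < t])
     (tail @^-1` D)).
    by rewrite -[X in measurable X]setTI; exact: measurable_coord.
  by rewrite -[X in measurable X]setTI; exact: mt.
have uD' : upward_closed D'.
  move=> x y [x0 Dx] xy; split; first exact: lt_trans (xy _).
  by apply: uD Dx _ => i; rewrite !mxE.
have cg : continuous_on D' (fun z => u (z ord0 ord0) (tail z)).
  move=> x [x0 Dx] e e0; have [d d0 hd] := cu _ _ x0 Dx e e0.
  exists d => // y [y0 Dy] xy; apply: hd => //.
  by move=> i; rewrite !mxE.
have mg := continuous_on_measurable mD' uD' cg.
have -> : (fun p : R * 'rV[R]_n => u p.1 p.2) =
    (fun z : 'rV[R]_n.+1 => u (z ord0 ord0) (tail z)) \o @row_cons R n.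
  by apply/funext => -[t x]; rewrite /= row_cons0 tK.
apply: (measurable_comp mD' _ mg); last first.
  exact: measurable_funTS (@measurable_row_cons R n).
by move=> _ [[t x] [/= t0 Dx] <-]; split; rewrite /= ?row_cons0 ?tK.
Qed.

End row_continuity.

(** * Integrals of nonnegative real functions *)

Section ge0_real_integrals.
Context d (T : measurableType d) (R : realType) (mu : {measure set T -> \bar R}).
Implicit Types f g : T -> R.
Local Open Scope ereal_scope.

Lemma integral_EFinD f g :
  measurable_fun setT f -> measurable_fun setT g ->
  (forall x, 0 <= f x)%R -> (forall x, 0 <= g x)%R ->
  \int[mu]_x (f x + g x)%:E = \int[mu]_x (f x)%:E + \int[mu]_x (g x)%:E.
Proof.
move=> mf mg f0 g0; under eq_integral do rewrite EFinD.
by apply: ge0_integralD => //; [move=> x _; rewrite lee_fin|exact/measurable_EFinP|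
  move=> x _; rewrite lee_fin|exact/measurable_EFinP].
Qed.

Lemma integral_EFinZ (k : R) f :
  measurable_fun setT f -> (forall x, 0 <= f x)%R -> (0 <= k)%R ->
  \int[mu]_x (k * f x)%:E = k%:E * \int[mu]_x (f x)%:E.
Proof.
move=> mf f0 k0; under eq_integral do rewrite EFinM.
by apply: ge0_integralZl_EFin => //; [move=> x _; rewrite lee_fin|exact/measurable_EFinP].
Qed.

Lemma le_integral_EFin f g :
  measurable_fun setT f -> measurable_fun setT g ->
  (forall x, 0 <= f x)%R -> (forall x, f x <= g x)%R ->
  \int[mu]_x (f x)%:E <= \int[mu]_x (g x)%:E.
Proof.
move=> mf mg f0 fg; apply: ge0_le_integral => //.
- by move=> x _; rewrite lee_fin.
- exact/measurable_EFinP.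
- exact/measurable_EFinP.
- by move=> x _; rewrite lee_fin.
Qed.

Lemma integral_EFin_ge0 f : (forall x, 0 <= f x)%R -> 0 <= \int[mu]_x (f x)%:E.
Proof. by move=> f0; apply: integral_ge0 => x _; rewrite lee_fin. Qed.

End ge0_real_integrals.

(** * The heat kernel *)

Section gauss.
Context {R : realType}.
Local Notation leb := (@lebesgue_measure R).
Implicit Types t s r w x y a : R.

(* Powers instead of a square root and an inverse make the measurability in [t]
   immediate. *)
Definition gauss t w : R :=
  (4 * pi * t) `^ (- 2^-1) * expR (- w ^+ 2 * (4 * t) `^ (-1)).

Lemma gaussE t w : 0 < t ->
  gauss t w = (Num.sqrt (4 * pi * t))^-1 * expR (- w ^+ 2 / (4 * t)).
Proof.
move=> t0; rewrite /gauss powR_inv1 ?mulr_ge0 ?(ltW t0)//.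
by rewrite powRN powR12_sqrt// !mulr_ge0 ?(ltW t0)// pi_ge0.
Qed.

Lemma gauss_ge0 t w : 0 <= gauss t w.
Proof. by rewrite mulr_ge0 ?powR_ge0 ?expR_ge0. Qed.

Lemma gaussN t w : gauss t (- w) = gauss t w.
Proof. by rewrite /gauss sqrrN. Qed.

Lemma measurable_gauss2 d (T : measurableType d) (f g : T -> R) :
  measurable_fun setT f -> measurable_fun setT g ->
  measurable_fun setT (fun z : T => gauss (f z) (g z)).
Proof.
move=> mf mg; apply: measurable_funM.
  apply: (measurableT_comp (measurable_powR _)).
  exact: measurable_funM.
apply: (measurableT_comp (@measurable_expR R)).
apply: measurable_funM.
  by apply: measurable_funN; exact: measurable_funX.
by apply: (measurableT_comp (measurable_powR _)); exact: measurable_funM.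
Qed.

Lemma measurable_gauss t : measurable_fun setT (gauss t).
Proof. exact: measurable_gauss2. Qed.

(** The heat kernel at time t is the normal density of variance 2 t, from which it inherits its
    total mass and its continuity. *)
Lemma gauss_normal_pdf t w c : 0 < t ->
  gauss t (w - c) = normal_pdf c (Num.sqrt (2 * t)) w.
Proof.
move=> t0; have t2 : 0 < 2 * t by rewrite mulr_gt0.
have s0 : Num.sqrt (2 * t) != 0 by rewrite gt_eqF ?sqrtr_gt0.
rewrite /normal_pdf (negbTE s0) /normal_peak /normal_fun gaussE//.
by rewrite sqr_sqrtr ?(ltW t2)//; congr (_^-1 * expR (_ / _));
  [congr Num.sqrt|]; rewrite -mulr_natr; ring.
Qed.

Lemma integral_gauss t c : 0 < t -> (\int[leb]_w (gauss t (w - c))%:E = 1)%E.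
Proof.
move=> t0; under eq_integral do rewrite gauss_normal_pdf//.
exact: integral_normal_pdf.
Qed.

Lemma integral_gauss0 t : 0 < t -> (\int[leb]_w (gauss t w)%:E = 1)%E.
Proof.
by move=> t0; rewrite -(integral_gauss 0 t0); apply: eq_integral => w _; rewrite subr0.
Qed.

(** Completing the square in y: the second factor on the right has unit mass in y, and the first
    does not contain y. *)
Lemma gauss_conv t s x y z : 0 < t -> 0 < s ->
  gauss t (x - y) * gauss s (y - z) =
  gauss (t + s) (x - z) * gauss (t * s / (t + s)) (y - (s * x + t * z) / (t + s)).
Proof.
move=> t0 s0; have ts0 : 0 < t + s by rewrite addr_gt0.
have tsd : 0 < t * s / (t + s) by rewrite divr_gt0 ?mulr_gt0.
rewrite !gaussE// mulrACA [RHS]mulrACA -!expRD -!invfM; congr (_^-1 * expR _).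
  rewrite -!sqrtrM ?mulr_ge0 ?pi_ge0 ?(ltW t0) ?(ltW ts0)//; congr Num.sqrt.
  by field; rewrite gt_eqF.
by field; rewrite !gt_eqF.
Qed.

Lemma integral_gauss_conv t s x z : 0 < t -> 0 < s ->
  (\int[leb]_y (gauss t (x - y) * gauss s (y - z))%:E = (gauss (t + s) (x - z))%:E)%E.
Proof.
move=> t0 s0; under eq_integral do rewrite gauss_conv//.
rewrite integral_EFinZ ?gauss_ge0//; last 2 first.
- by apply: measurable_gauss2 => //; exact: measurable_funB.
- by move=> y; exact: gauss_ge0.
by rewrite integral_gauss ?mule1// divr_gt0 ?mulr_gt0// addr_gt0.
Qed.

Lemma expR_ge_sqr w : 0 <= w -> w ^+ 2 / 2 <= expR w.
Proof.
move=> w0; apply: le_trans (expR_ge1Dxn 1 w0).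
by rewrite (_ : 2`!%:R = 2)// lerDr.
Qed.

(* [gauss t w] is [sqrt 2 * gauss (2 * t) w * exp (- w ^+ 2 / (8 * t))], and
   [exp (- q) <= 2 / q ^+ 2]. *)
Lemma gauss_tail t r w : 0 < t -> 0 < r -> r <= `|w| ->
  gauss t w <= 2 * 128 / r ^+ 4 * t ^+ 2 * gauss (2 * t) w.
Proof.
move=> t0 r0 rw; have t2 : 0 < 2 * t by rewrite mulr_gt0.
have ppi := @pi_gt0 R.
rewrite !gaussE//.
have -> : 4 * pi * (2 * t) = 2 * (4 * pi * t) by ring.
rewrite (sqrtrM (4 * pi * t)) ?ler0n//.
have s4 : 0 < Num.sqrt (4 * pi * t) by rewrite sqrtr_gt0 !mulr_gt0.
have s2 : 0 < Num.sqrt 2 :> R by rewrite sqrtr_gt0.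
have s2' : Num.sqrt 2 <= 2 :> R.
  by rewrite -[leRHS]ger0_norm// -sqrtr_sqr ler_sqrt// expr2; lra.
have -> : - w ^+ 2 / (4 * t) = - (w ^+ 2 / (8 * t)) + - w ^+ 2 / (4 * (2 * t)).
  by field; rewrite gt_eqF.
rewrite expRD.
have e1 : expR (- (w ^+ 2 / (8 * t))) <= 128 / r ^+ 4 * t ^+ 2.
  rewrite expRN; have -> : 128 / r ^+ 4 * t ^+ 2 = ((r ^+ 2 / (8 * t)) ^+ 2 / 2)^-1.
    by field; rewrite !gt_eqF.
  rewrite lef_pV2 ?posrE ?expR_gt0//; last first.
    by rewrite divr_gt0// exprn_gt0// divr_gt0 ?exprn_gt0// mulr_gt0.
  apply: (le_trans (expR_ge_sqr _)).
    by rewrite divr_ge0 ?sqr_ge0// mulr_ge0// ltW.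
  rewrite ler_expR ler_pM2r ?invr_gt0 ?mulr_gt0//.
  by rewrite -(real_normK (num_real w)) ler_pXn2r// nnegrE ltW.
have -> : 2 * 128 / r ^+ 4 * t ^+ 2 * ((Num.sqrt 2 * Num.sqrt (4 * pi * t))^-1 *
    expR (- w ^+ 2 / (4 * (2 * t)))) =
  (Num.sqrt (4 * pi * t))^-1 * ((128 / r ^+ 4 * t ^+ 2) * (2 / Num.sqrt 2) *
    expR (- w ^+ 2 / (4 * (2 * t)))).
  by field; rewrite !gt_eqF.
rewrite ler_pM2l ?invr_gt0// ler_pM2r ?expR_gt0//.
apply: (le_trans e1); rewrite ler_peMr//.
  by rewrite mulr_ge0 ?sqr_ge0// divr_ge0// exprn_ge0// ltW.
by rewrite ler_pdivlMr// mul1r.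
Qed.

(** From exp q >= q^3 / 6 with q = r^2 / (4 t); 384 is 6 * 4^3. One of the three powers of t pays
    for the normalization, which is at most 1 / t when t <= 1. *)
Lemma gauss_bound t r : 0 < t <= 1 -> 0 < r ->
  gauss t r <= 384 / r ^+ 6 * t ^+ 2.
Proof.
move=> /andP[t0 t1] r0; have ppi := @pi_gt0 R; have pi2 := @pi_ge2 R.
rewrite gaussE//.
have h1 : (Num.sqrt (4 * pi * t))^-1 <= t^-1.
  rewrite lef_pV2 ?posrE ?sqrtr_gt0 ?mulr_gt0//.
  rewrite -[leLHS]ger0_norm ?(ltW t0)// -sqrtr_sqr ler_sqrt ?mulr_ge0 ?pi_ge0 ?ltW//.
  by nra.
have h2 : expR (- r ^+ 2 / (4 * t)) <= 384 / r ^+ 6 * t ^+ 3.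
  have z0 : 0 <= r ^+ 2 / (4 * t) by rewrite divr_ge0 ?sqr_ge0// mulr_ge0// ltW.
  rewrite mulNr expRN.
  have -> : 384 / r ^+ 6 * t ^+ 3 = ((r ^+ 2 / (4 * t)) ^+ 3 / 6)^-1.
    by field; rewrite !gt_eqF.
  rewrite lef_pV2 ?posrE ?expR_gt0//; last first.
    by rewrite divr_gt0// exprn_gt0// divr_gt0 ?exprn_gt0// mulr_gt0.
  by apply: le_trans (expR_ge1Dxn 2 z0); rewrite (_ : 3`!%:R = 6)// lerDr.
have -> : 384 / r ^+ 6 * t ^+ 2 = t^-1 * (384 / r ^+ 6 * t ^+ 3).
  by field; rewrite !gt_eqF.
by apply: ler_pM => //; rewrite ?invr_ge0 ?sqrtr_ge0 ?expR_ge0.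
Qed.

End gauss.

(** * Truncated mass and second moment of the Gaussian *)

Section gauss_moments.
Context {R : realType}.
Local Notation leb := (@lebesgue_measure R).
Implicit Types t s r w x y a : R.

Definition ind (b : bool) : R := b%:R.

Lemma ind_ge0 b : 0 <= ind b. Proof. exact: ler0n. Qed.
Lemma ind_le1 b : ind b <= 1. Proof. by case: b; rewrite /ind/= ?ler01. Qed.

Lemma measurable_ind d (T : measurableType d) (b : T -> bool) :
  measurable_fun setT b -> measurable_fun setT (fun z : T => ind (b z)).
Proof.
move=> mb; rewrite (_ : (fun _ => _) = (fun z : T => if b z then 1 else 0 : R)).
  exact: measurable_fun_ifT.
by apply/funext => z; case: (b z).
Qed.

Lemma measurable_ind_lt d (T : measurableType d) (f g : T -> R) :
  measurable_fun setT f -> measurable_fun setT g ->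
  measurable_fun setT (fun z : T => ind (f z < g z)).
Proof. by move=> mf mg; apply: measurable_ind; exact: measurable_fun_ltr. Qed.

Lemma measurable_ind_le d (T : measurableType d) (f g : T -> R) :
  measurable_fun setT f -> measurable_fun setT g ->
  measurable_fun setT (fun z : T => ind (f z <= g z)).
Proof. by move=> mf mg; apply: measurable_ind; exact: measurable_fun_ler. Qed.

Lemma measurable_ind_ball a r : measurable_fun setT (fun w => ind (`|w - a| < r)).
Proof.
apply: measurable_ind_lt => //.
by apply: (measurableT_comp (@normr_measurable R setT)); exact: measurable_funB.
Qed.

Lemma measurable_ind_ball0 r : measurable_fun setT (fun w => ind (`|w| < r)).
Proof. exact: measurable_ind_lt. Qed.

Lemma integral_ball (f : R -> \bar R) r : (0 < r)%R ->
  measurable_fun setT f ->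
  (\int[leb]_(w in `[(- r)%R, r]) f w = \int[leb]_w ((ind (`|w| < r))%:E * f w))%E.
Proof.
move=> r0 mf; rewrite integral_itv_bndoo; last exact: measurable_funTS.
rewrite integral_mkcond; apply: eq_integral => w _.
rewrite patchE; case: ifPn => [|] h.
  have : `|w| < r by move: h; rewrite inE/= in_itv/= ltr_norml.
  by move=> ->; rewrite mul1e.
have : ~~ (`|w| < r).
  by apply: contra h; rewrite inE/= in_itv/= ltr_norml.
by move=> /negbTE ->; rewrite mul0e.
Qed.

Lemma continuous_gauss t : 0 < t -> continuous (gauss t).
Proof.
move=> t0; have -> : gauss t = normal_pdf 0 (Num.sqrt (2 * t)).
  by apply/funext => w; rewrite -[in LHS](subr0 w) gauss_normal_pdf.
by apply: continuous_normal_pdf; rewrite gt_eqF// sqrtr_gt0 mulr_gt0.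
Qed.

Lemma is_derive_gauss t w : 0 < t ->
  is_derive w 1 (gauss t) (- w / (2 * t) * gauss t w).
Proof.
move=> t0; rewrite /gauss; set A := _ `^ _; set B := (4 * t) `^ _.
have BE : B = (4 * t)^-1 by rewrite /B powR_inv1// mulr_ge0// ltW.
have h : is_derive w 1 (fun w : R => - w ^+ 2 * B) (- (2 * w) * B).
  apply: is_derive_eq; rewrite !scaler0 !add0r/= !scaler1/=.
  by change (B * - (w + w) = - (2 * w) * B); ring.
have h2 := @is_derive1_comp _ expR (fun w : R => - w ^+ 2 * B) w _ _ (is_derive_expR _) h.
have h3 : is_derive w 1 (fun w : R => A * expR (- w ^+ 2 * B))
   (A *: (expR (- w ^+ 2 * B) * (- (2 * w) * B))) by exact: is_deriveZ.
apply: is_derive_eq h3 _; rewrite /GRing.scale/= BE.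
by field; rewrite gt_eqF.
Qed.

(** Integration by parts: 2 t w gauss(w) has derivative (2 t - w^2) gauss(w), and its values at r
    and - r differ by 4 t r gauss(r). The identity is stated without subtraction in the extended
    reals. *)
Lemma gauss_second_moment t r : 0 < t -> 0 < r ->
  (\int[leb]_w (ind (`|w| < r) * (w ^+ 2 * gauss t w))%:E + (4 * t * r * gauss t r)%:E
   = (2 * t)%:E * \int[leb]_w (ind (`|w| < r) * gauss t w)%:E)%E.
Proof.
move=> t0 r0.
have mg := measurable_gauss t.
have mg2 : measurable_fun setT (fun w => w ^+ 2 * gauss t w).
  by apply: measurable_funM => //; exact: exprn_measurable.
have cg2 : continuous (fun w => w ^+ 2 * gauss t w).
  by move=> w; apply: (@continuousM _ _ (fun w : R => w ^+ 2)); [exact: exprn_continuous|exact: continuous_gauss].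
have cg1 : continuous (fun w => 2 * t * gauss t w).
  by move=> w; apply: (@continuousM _ _ (fun=> 2 * t)); [exact: cst_continuous|exact: continuous_gauss].
pose F w := 2 * t * w * gauss t w.
have dF w : is_derive w 1 F (2 * t * gauss t w - w ^+ 2 * gauss t w).
  have h := is_derive_gauss w t0.
  rewrite /F; apply: is_derive_eq; rewrite /GRing.scale/=.
  by field; rewrite gt_eqF.
have cF : continuous F.
  move=> w; apply: differentiable_continuous; apply/derivable1_diffP.
  by have [] := dF w.
have rr : - r < r by rewrite gtrN.
have cb w : {for w, continuous (fun w => 2 * t * gauss t w - w ^+ 2 * gauss t w)}.
  by apply: continuousB; [exact: cg1|exact: cg2].
have := @continuous_FTC2 R (fun w => 2 * t * gauss t w - w ^+ 2 * gauss t w) F _ _ rr.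
move=> /(_ (continuous_subspaceT cb)) ftc.
have {}ftc : (\int[leb]_(x in `[(- r)%R, r]) (2 * t * gauss t x - x ^+ 2 * gauss t x)%:E =
    (F r)%:E - (F (- r))%:E)%E.
  apply: ftc.
    split.
    - by move=> w _; have [] := dF w.
    - by apply: cvg_at_right_filter; exact: cF.
    - by apply: cvg_at_left_filter; exact: cF.
  by move=> w _; rewrite derive1E; exact: derive_val.
have i1 : leb.-integrable `[(- r)%R, r] (EFin \o (fun w => 2 * t * gauss t w)).
  apply: continuous_compact_integrable; first exact: segment_compact.
  exact: continuous_subspaceT.
have i2 : leb.-integrable `[(- r)%R, r] (EFin \o (fun w => w ^+ 2 * gauss t w)).
  apply: continuous_compact_integrable; first exact: segment_compact.
  exact: continuous_subspaceT.
move: ftc; under eq_integral do rewrite EFinB.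
rewrite (integralB (mu := leb) _ i1 i2)//=.
have E1 : (\int[leb]_(x in `[(- r)%R, r]) (2 * t * gauss t x)%:E =
    (2 * t)%:E * \int[leb]_w (ind (`|w| < r) * gauss t w)%:E)%E.
  rewrite integral_ball//; last first.
    by apply/measurable_EFinP; exact: measurable_funM.
  rewrite -integral_EFinZ.
  - by apply: eq_integral => w _; rewrite -EFinM mulrCA.
  - by apply: measurable_funM => //; exact: measurable_ind_ball0.
  - by move=> w; rewrite mulr_ge0 ?ind_ge0 ?gauss_ge0.
  - by rewrite mulr_ge0// ltW.
have E2 : (\int[leb]_(x in `[(- r)%R, r]) (x ^+ 2 * gauss t x)%:E =
    \int[leb]_w (ind (`|w| < r) * (w ^+ 2 * gauss t w))%:E)%E.
  by rewrite integral_ball//; exact/measurable_EFinP.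
have fin2 : (\int[leb]_w (ind (`|w| < r) * (w ^+ 2 * gauss t w))%:E)%E \is a fin_num.
  by rewrite -E2; exact: integrable_fin_num i2.
rewrite E1 E2.
set X := (X in (_ - X)%E); set Y := (2 * t)%:E.
have -> : (4 * t * r * gauss t r)%:E = ((F r)%:E - (F (- r))%:E)%E.
  by rewrite -EFinB /F gaussN; congr EFin; ring.
by move=> <-; rewrite addeC subeK.
Qed.

Lemma gauss_tail_integral t r c : 0 < t -> 0 < r ->
  (\int[leb]_w (ind (r <= `|w - c|) * gauss t (w - c))%:E <=
    (2 * 128 / r ^+ 4 * t ^+ 2)%:E)%E.
Proof.
move=> t0 r0; have t2 : 0 < 2 * t by rewrite mulr_gt0.
have k0 : 0 <= 2 * 128 / r ^+ 4 * t ^+ 2.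
  by rewrite mulr_ge0 ?sqr_ge0// divr_ge0// exprn_ge0// ltW.
have mg2 : measurable_fun setT (fun w => gauss (2 * t) (w - c)).
  by apply: measurable_gauss2 => //; exact: measurable_funB.
have E := @integral_EFinZ _ _ _ leb _ _ mg2 (fun w => gauss_ge0 _ _) k0.
rewrite (integral_gauss c t2) mule1 in E; rewrite -E.
apply: le_integral_EFin.
- apply: measurable_funM; last by apply: measurable_gauss2 => //; exact: measurable_funB.
  apply: measurable_ind_le => //.
  by apply: (measurableT_comp (@normr_measurable R setT)); exact: measurable_funB.
- exact: measurable_funM.
- by move=> w; rewrite mulr_ge0 ?ind_ge0 ?gauss_ge0.
- move=> w; case: (leP r `|w - c|) => h; rewrite /ind/=.
    by rewrite mul1r; exact: gauss_tail.
  by rewrite mul0r mulr_ge0 ?gauss_ge0.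
Qed.

(** The missing mass is O(t^2) for fixed r, hence still negligible after division by a time step of
    length t. *)
Lemma gauss_ball_mass t r c : 0 < t -> 0 < r ->
  (1 - (2 * 128 / r ^+ 4 * t ^+ 2)%:E <=
   \int[leb]_w (ind (`|w - c| < r) * gauss t (w - c))%:E <= 1)%E.
Proof.
move=> t0 r0.
have mg : measurable_fun setT (fun w => gauss t (w - c)).
  by apply: measurable_gauss2 => //; exact: measurable_funB.
have mi1 : measurable_fun setT (fun w => ind (`|w - c| < r) * gauss t (w - c)).
  by apply: measurable_funM => //; exact: measurable_ind_ball.
have mi2 : measurable_fun setT (fun w => ind (r <= `|w - c|) * gauss t (w - c)).
  apply: measurable_funM => //; apply: measurable_ind_le => //.
  by apply: (measurableT_comp (@normr_measurable R setT)); exact: measurable_funB.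
apply/andP; split; last first.
  rewrite -(integral_gauss c t0); apply: le_integral_EFin => // w.
  - by rewrite mulr_ge0 ?ind_ge0 ?gauss_ge0.
  - by rewrite ler_piMl ?gauss_ge0// ind_le1.
rewrite leeBlDr// -(integral_gauss c t0).
rewrite (_ : \int[leb]_w (gauss t (w - c))%:E =
    \int[leb]_w (ind (`|w - c| < r) * gauss t (w - c) +
       ind (r <= `|w - c|) * gauss t (w - c))%:E)%E; last first.
  apply: eq_integral => w _; congr EFin.
  by case: ltP => _; rewrite /ind/= mul1r mul0r ?addr0 ?add0r.
rewrite integral_EFinD//; last 2 first.
- by move=> w; rewrite mulr_ge0 ?ind_ge0 ?gauss_ge0.
- by move=> w; rewrite mulr_ge0 ?ind_ge0 ?gauss_ge0.
by apply: leeD => //; exact: gauss_tail_integral.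
Qed.

End gauss_moments.

(** * One-dimensional kernels: half-line with Dirichlet condition, and full line *)

Section half_line_kernel.
Context {R : realType}.
Local Notation leb := (@lebesgue_measure R).
Implicit Types (t s r x y a c : R) (b : bool).

(** The flag [b] selects the Dirichlet kernel of the half-line. The indicator extends it by zero in
    y, so that integrals over [Omega] become integrals over the whole space, where Tonelli's theorem
    is applied. *)
Definition k1 (b : bool) t a y : R :=
  if b then ind (0 < y) * (gauss t (a - y) - gauss t (a + y))
  else gauss t (a - y).

Lemma gauss_le t w w' : 0 < t -> `|w| <= `|w'| -> gauss t w' <= gauss t w.
Proof.
move=> t0 h; rewrite !gaussE// ler_wpM2l ?invr_ge0 ?sqrtr_ge0//.
rewrite ler_expR ler_pM2r ?invr_gt0 ?mulr_gt0// lerN2.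
by rewrite -(real_normK (num_real w)) -(real_normK (num_real w')) ler_pXn2r// nnegrE.
Qed.

Lemma k1_ge0 b t a y : 0 < t -> (b -> 0 <= a) -> 0 <= k1 b t a y.
Proof.
rewrite /k1; case: b => [|] t0 a0; last exact: gauss_ge0.
case: (ltP 0 y) => y0; last by rewrite mul0r.
rewrite mul1r subr_ge0; apply: gauss_le => //.
have := a0 isT => {}a0.
by rewrite [leRHS]ger0_norm ?addr_ge0 ?(ltW y0)// ler_norml; apply/andP; split; lra.
Qed.

Lemma k1_le b t a y : k1 b t a y <= gauss t (a - y).
Proof.
rewrite /k1; case: b => //; case: ltP => _; last by rewrite mul0r gauss_ge0.
by rewrite mul1r gerBl gauss_ge0.
Qed.

(** For y > 0 the reflected Gaussian is exp(- a y / t) times the direct one, and 1 - exp(- q) <= q.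
    The factor |y| gained here is the origin of the weight in the lower bound. *)
Lemma k1_le_weight t a y : 0 < t -> 0 <= a ->
  k1 true t a y <= gauss t (a - y) * (a * `|y| / t).
Proof.
move=> t0 a0; rewrite /k1; case: ltP => y0; last first.
  by rewrite mul0r mulr_ge0 ?gauss_ge0// divr_ge0 ?mulr_ge0// ltW.
rewrite mul1r gtr0_norm//.
have -> : gauss t (a + y) = gauss t (a - y) * expR (- (a * y / t)).
  by rewrite !gaussE// -[RHS]mulrA -expRD; congr (_ * expR _); field; rewrite gt_eqF.
rewrite -[X in X - _]mulr1 -mulrBr ler_wpM2l ?gauss_ge0//.
by rewrite lerBlDr -lerBlDl; apply: le_trans (expR_ge1Dx _).
Qed.

Lemma measurable_k1 d (T : measurableType d) b (f g h : T -> R) :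
  measurable_fun setT f -> measurable_fun setT g -> measurable_fun setT h ->
  measurable_fun setT (fun z : T => k1 b (f z) (g z) (h z)).
Proof.
move=> mf mg mh; rewrite /k1; case: b; last first.
  by apply: measurable_gauss2 => //; exact: measurable_funB.
apply: measurable_funM; first exact: measurable_ind_lt.
by apply: measurable_funB; apply: measurable_gauss2 => //;
  [exact: measurable_funB|exact: measurable_funD].
Qed.

Lemma integral_half_line (h : R -> R) : measurable_fun setT h ->
  (forall y, 0 <= h y) ->
  (\int[leb]_y (ind (0 < y)%R * (h y + h (- y)))%:E = \int[leb]_y (h y)%:E)%E.
Proof.
move=> mh h0.
have mhN : measurable_fun setT (fun y => h (- y)).
  by apply: (measurableT_comp mh); exact: oppr_measurable.
have mp : measurable_fun setT (fun y => ind (0 < y) : R) by exact: measurable_ind_lt.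
have mn : measurable_fun setT (fun y => ind (y < 0) : R) by exact: measurable_ind_lt.
transitivity (\int[leb]_y (ind (0 < y)%R * h y + ind (0 < y)%R * h (- y))%:E)%E.
  by apply: eq_integral => y _; rewrite mulrDr.
rewrite integral_EFinD; last 4 first.
- exact: measurable_funM.
- exact: measurable_funM.
- by move=> y; rewrite mulr_ge0 ?ind_ge0.
- by move=> y; rewrite mulr_ge0 ?ind_ge0.
have -> : (\int[leb]_y (ind (0 < y)%R * h (- y))%:E =
    \int[leb]_y (ind (y < 0)%R * h y)%:E)%E.
  have n1 : - 1 != 0 :> R by rewrite oppr_eq0 oner_eq0.
  have := @integral_affine R (- 1) 0 (fun y => (ind (y < 0)%R * h y)%:E) n1.
  rewrite normrN normr1 invr1 mul1e => <-//.
  - by apply: eq_integral => y _; rewrite mulN1r addr0 oppr_lt0.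
  - by apply/measurable_EFinP; exact: measurable_funM.
  - by move=> y; rewrite lee_fin mulr_ge0 ?ind_ge0.
rewrite -integral_EFinD; last 4 first.
- exact: measurable_funM.
- exact: measurable_funM.
- by move=> y; rewrite mulr_ge0 ?ind_ge0.
- by move=> y; rewrite mulr_ge0 ?ind_ge0.
apply: ge0_ae_eq_integral => //.
- apply/measurable_EFinP.
  by apply: measurable_funD; exact: measurable_funM.
- exact/measurable_EFinP.
- by move=> y _; rewrite lee_fin addr_ge0// mulr_ge0 ?ind_ge0.
- by move=> y _; rewrite lee_fin.
exists [set 0]; split => //; first exact: lebesgue_measure_set1.
move=> y /= hy; apply/eqP; apply: contra_notP hy => /negP y0 _.
congr EFin; move: y0; rewrite neq_lt => /orP[] y0.
  by rewrite y0 (lt_gtF y0) /ind/= mul0r mul1r add0r.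
by rewrite y0 (lt_gtF y0) /ind/= mul0r mul1r addr0.
Qed.

(** Method of images. [P] and [Q] are the products of the direct Gaussian with the direct and with
    the reflected one. On y > 0 the product of the kernels plus Q(y) + Q(- y) equals P(y) + P(- y);
    moving [Q] to the left keeps all integrands nonnegative, and the half-line integrals of the
    symmetrized terms are full Gaussian convolutions. *)
Lemma k1_semigroup b t s a c : 0 < t -> 0 < s -> (b -> 0 <= a) -> (b -> 0 < c) ->
  (\int[leb]_y (k1 b t a y * k1 b s y c)%:E = (k1 b (t + s) a c)%:E)%E.
Proof.
move=> t0 s0; case: b => [a0 c0|_ _]; last exact: integral_gauss_conv.
have {}a0 := a0 isT; have {}c0 := c0 isT.
pose P y := gauss t (a - y) * gauss s (y - c).
pose Q y := gauss t (a - y) * gauss s (y + c).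
have mP : measurable_fun setT P.
  by apply: measurable_funM; apply: measurable_gauss2 => //; exact: measurable_funB.
have mQ : measurable_fun setT Q.
  by apply: measurable_funM; apply: measurable_gauss2 => //;
    [exact: measurable_funB|exact: measurable_funD].
have P0 y : 0 <= P y by rewrite mulr_ge0 ?gauss_ge0.
have Q0 y : 0 <= Q y by rewrite mulr_ge0 ?gauss_ge0.
have iP : (\int[leb]_y (P y)%:E = (gauss (t + s) (a - c))%:E)%E.
  exact: integral_gauss_conv.
have iQ : (\int[leb]_y (Q y)%:E = (gauss (t + s) (a + c))%:E)%E.
  by have := integral_gauss_conv a (- c) t0 s0; rewrite opprK => <-.
have mk : measurable_fun setT (fun y => k1 true t a y * k1 true s y c).
  by apply: measurable_funM; exact: measurable_k1.
have k0 y : 0 <= k1 true t a y * k1 true s y c.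
  case: (ltP 0 y) => y0; first by rewrite mulr_ge0// k1_ge0// => _; exact: ltW.
  by rewrite /k1 ltNge y0 /ind/= mul0r mul0r.
have mQs : measurable_fun setT (fun y => ind (0 < y) * (Q y + Q (- y))).
  apply: measurable_funM; first exact: measurable_ind_lt.
  apply: measurable_funD => //; apply: (measurableT_comp mQ).
  exact: oppr_measurable.
have Qs0 y : 0 <= ind (0 < y) * (Q y + Q (- y)) by rewrite mulr_ge0 ?ind_ge0 ?addr_ge0.
have pw y : k1 true t a y * k1 true s y c + ind (0 < y) * (Q y + Q (- y)) =
    ind (0 < y) * (P y + P (- y)).
  rewrite /k1 c0 /P /Q; case: (ltP 0 y) => y0; last by rewrite !mul0r addr0.
  rewrite !mul1r !opprK -[gauss s (- y + c)]gaussN -[gauss s (- y - c)]gaussN.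
  rewrite !opprD !opprK.
  move: (gauss t _) (gauss t _) (gauss s _) (gauss s _) => A B C D.
  by ring.
have E : (\int[leb]_y (k1 true t a y * k1 true s y c)%:E +
    \int[leb]_y (ind (0 < y)%R * (Q y + Q (- y)))%:E =
    \int[leb]_y (ind (0 < y)%R * (P y + P (- y)))%:E)%E.
  by rewrite -integral_EFinD//; apply: eq_integral => y _; rewrite pw.
move: E; rewrite !integral_half_line// iP iQ => E.
have -> : (\int[leb]_y (k1 true t a y * k1 true s y c)%:E =
  (gauss (t + s) (a - c))%:E - (gauss (t + s) (a + c))%:E)%E by rewrite -E addeK.
by rewrite -EFinB /k1 c0 /ind/= mul1r.
Qed.

Lemma gauss_comm t a y : gauss t (a - y) = gauss t (y - a).
Proof. by rewrite -gaussN opprB. Qed.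

Lemma integral_k1_le1 b t a : 0 < t -> (b -> 0 <= a) ->
  (\int[leb]_y (k1 b t a y)%:E <= 1)%E.
Proof.
move=> t0 a0; rewrite -(integral_gauss a t0); apply: le_integral_EFin.
- exact: measurable_k1.
- by apply: measurable_gauss2 => //; exact: measurable_funB.
- by move=> y; exact: k1_ge0.
- by move=> y; rewrite -gauss_comm; exact: k1_le.
Qed.

(** Twice the error of [gauss_ball_mass]: once for the tail of the Gaussian, once for the image
    source at - a, whose distance to the ball around a is at least r. *)
Lemma k1_ball_mass b t r a : 0 < t -> 0 < r -> (b -> r < a) ->
  (1 - (4 * 128 / r ^+ 4 * t ^+ 2)%:E <=
   \int[leb]_y (ind (`|y - a| < r)%R * k1 b t a y)%:E)%E.
Proof.
move=> t0 r0 ra; have /andP[h1 h2] := gauss_ball_mass a t0 r0.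
have c0 : 0 <= 2 * 128 / r ^+ 4 * t ^+ 2.
  by rewrite mulr_ge0 ?sqr_ge0// divr_ge0// exprn_ge0// ltW.
have E4 : 4 * 128 / r ^+ 4 * t ^+ 2 =
    2 * 128 / r ^+ 4 * t ^+ 2 + 2 * 128 / r ^+ 4 * t ^+ 2 by field; rewrite gt_eqF.
have mga : measurable_fun setT (fun y => gauss t (y - a)).
  by apply: measurable_gauss2 => //; exact: measurable_funB.
have mi1 : measurable_fun setT (fun y => ind (`|y - a| < r) * gauss t (y - a)).
  by apply: measurable_funM => //; exact: measurable_ind_ball.
have mi3 : measurable_fun setT (fun y => ind (r <= `|y - - a|) * gauss t (y - - a)).
  apply: measurable_funM; last first.
    by apply: measurable_gauss2 => //; exact: measurable_funB.
  apply: measurable_ind_le => //.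
  by apply: (measurableT_comp (@normr_measurable R setT)); exact: measurable_funB.
case: b ra => ra; last first.
  apply: (@le_trans _ _ (1 - (2 * 128 / r ^+ 4 * t ^+ 2)%:E)%E).
    by rewrite leeB// lee_fin E4 lerDl.
  apply: (le_trans h1); rewrite le_eqVlt; apply/orP; left; apply/eqP.
  by apply: eq_integral => y _; rewrite /k1 gauss_comm.
have {}ra := ra isT.
rewrite E4 EFinD oppeD// addeA leeBlDr//.
apply: (le_trans h1).
have mk : measurable_fun setT (fun y => ind (`|y - a| < r) * k1 true t a y).
  apply: measurable_funM; first exact: measurable_ind_ball.
  exact: measurable_k1.
have k0 y : 0 <= ind (`|y - a| < r) * k1 true t a y.
  by rewrite mulr_ge0 ?ind_ge0// k1_ge0// => _; lra.
have g0 y : 0 <= ind (r <= `|y - - a|) * gauss t (y - - a).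
  by rewrite mulr_ge0 ?ind_ge0 ?gauss_ge0.
apply: (le_trans _ (leeD2l _ (gauss_tail_integral (- a) t0 r0))).
rewrite -integral_EFinD//.
apply: le_integral_EFin => //.
- exact: measurable_funD.
- by move=> y; rewrite mulr_ge0 ?ind_ge0 ?gauss_ge0.
move=> y; case: (ltP `|y - a| r) => h; rewrite /ind/= ?mul0r ?add0r ?mul1r//; last first.
  by rewrite mulr_ge0 ?ler0n ?gauss_ge0.
move: h; rewrite ltr_norml => /andP[h h'].
have y0 : 0 < y by lra.
have -> : r <= `|y - - a| by rewrite opprK ger0_norm; lra.
by rewrite /k1 y0 opprK (gauss_comm t a y) (addrC a y) /ind/= !mul1r subrK.
Qed.

End half_line_kernel.

(** * The Dirichlet heat kernel of [Omega] *)

Section row_kernel.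
Context {R : realType} {N : nat}.
Variable m : nat.
Local Notation mu := (@lebesgue_row R N).
Implicit Types (t s r : R) (x y z : 'rV[R]_N).

Definition in_closure x := forall i : 'I_N, (i < m)%N -> 0 <= x ord0 i.

(** The inverse of 1 plus the sum of all inverse radii is below each radius; the summand 1 covers an
    empty index type. *)
Lemma common_radius (I : finType) (P : I -> R -> Prop) :
  (forall i, exists2 r, 0 < r & forall s, 0 < s <= r -> P i s) ->
  exists2 r, 0 < r & forall i s, 0 < s <= r -> P i s.
Proof.
move=> h; have /choice[f hf] : forall i, exists r, 0 < r /\
    forall s, 0 < s <= r -> P i s by move=> i; have [r] := h i; exists r.
have f0 i : 0 <= (f i)^-1 by rewrite invr_ge0 ltW//; have [] := hf i.
have s0 : 0 < 1 + \sum_i (f i)^-1 by rewrite ltr_pwDl// sumr_ge0.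
exists (1 + \sum_i (f i)^-1)^-1; first by rewrite invr_gt0.
move=> i s /andP[sp sr]; have [fi0 hi] := hf i; apply: hi; rewrite sp/=.
apply: (le_trans sr); rewrite -[leRHS]invrK lef_pV2 ?posrE ?invr_gt0//.
rewrite (bigD1 i)//= addrCA lerDl addr_ge0// sumr_ge0//.
Qed.

Lemma Omega_radius x : Omega m x ->
  exists2 r, 0 < r & forall i : 'I_N, (i < m)%N -> r < x ord0 i.
Proof.
move=> Ox; have [|r r0 hr] := @common_radius 'I_N
    (fun i s => (i < m)%N -> s < x ord0 i).
  move=> i; have [im|im] := boolP (i < m)%N; last by exists 1 => // s _.
  have x0 := Ox i im; exists (x ord0 i / 2); first by rewrite divr_gt0.
  by move=> s /andP[_ h] _; lra.
by exists r => // i im; apply: hr => //; rewrite r0/=.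
Qed.

Lemma Omega_in_closure x : Omega m x -> in_closure x.
Proof. by move=> Ox i im; exact/ltW/Ox. Qed.

Lemma closure_OmegaE : closure (@Omega R N m) = [set x | in_closure x].
Proof.
apply/seteqP; split => x /=.
  move=> cx i im; rewrite leNgt; apply/negP => xi.
  have [] := cx (ball x (- x ord0 i)).
    by apply: nbhsx_ballx; rewrite oppr_gt0.
  move=> y [Oy [_ /(_ ord0 i)]] /=.
  rewrite /ball/= ltr_norml => /andP[h1 h2]; have := Oy i im; lra.
move=> hx B /nbhs_ballP[e /= e0 hB].
exists (\row_i (x ord0 i + e / 2)); split.
  by move=> i im; rewrite mxE ltr_wpDl ?hx// divr_gt0.
apply: hB; split => // i j; rewrite /ball/= mxE !ord1 opprD addNKr normrN.
by rewrite gtr0_norm; lra.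
Qed.

Lemma in_closureE x : closure (Omega m) x = in_closure x.
Proof. by rewrite closure_OmegaE. Qed.

Lemma open_Omega : open (@Omega R N m).
Proof.
rewrite openE => x Ox; have [r r0 hr] := Omega_radius Ox.
apply/nbhs_ballP; exists r => //= y [_ hy] i im.
have := hy ord0 i; rewrite /ball/= ltr_norml => /andP[h1 h2].
by have := hr i im; lra.
Qed.

Lemma frontierE x : frontier (Omega m) x <-> in_closure x /\ ~ Omega m x.
Proof.
rewrite /frontier.
have -> : interior (@Omega R N m) = Omega m.
  by apply/seteqP; split; [exact: interior_subset|have := open_Omega; rewrite openE].
by split=> -[h1 h2]; split=> //; move: h1; rewrite in_closureE.
Qed.

Lemma measurable_Omega : measurable (@Omega R N m).
Proof.
rewrite (_ : Omega m = \bigcap_(i in [set i : 'I_N | (i < m)%N])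
   ((fun x : 'rV[R]_N => x ord0 i) @^-1` [set` `]0, +oo[%R])).
  apply: fin_bigcap_measurable => // i _.
  by rewrite -[X in measurable X]setTI; exact: measurable_coord.
by apply/seteqP; split=> x h i im; have := h i im; rewrite /= in_itv/= andbT.
Qed.

Lemma upward_closed_Omega : upward_closed (@Omega R N m).
Proof. by move=> x y Ox xy i im; exact: lt_trans (Ox i im) (xy i). Qed.

(** Equal to [heat_kernel] for y in [Omega] and zero for other y. The product form reduces the
    identities for the kernel to dimension one. *)
Definition kern t x y : R := \prod_(i < N) k1 (i < m)%N t (x ord0 i) (y ord0 i).

Definition gauss_row t x y : R := \prod_(i < N) gauss t (x ord0 i - y ord0 i).

Definition cube r x y : R := ind [forall i, `|y ord0 i - x ord0 i| < r].

Lemma cubeE r x y : cube r x y = \prod_i ind (`|y ord0 i - x ord0 i| < r).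
Proof.
rewrite /cube; case: forallP => [h|/forallP].
  by rewrite big1// => i _; rewrite h.
rewrite negb_forall => /existsP[i /negbTE hi].
by rewrite (bigD1 i)//= hi /ind/= mul0r.
Qed.

Lemma kern_ge0 t x y : 0 < t -> in_closure x -> 0 <= kern t x y.
Proof. by move=> t0 hx; apply: prodr_ge0 => i _; apply: k1_ge0 => //; exact: hx. Qed.

Lemma kern_le_gauss t x y : 0 < t -> in_closure x -> kern t x y <= gauss_row t x y.
Proof.
move=> t0 hx; apply: ler_prod => i _; rewrite k1_le andbT.
by apply: k1_ge0 => //; exact: hx.
Qed.

Lemma gauss_row_ge0 t x y : 0 <= gauss_row t x y.
Proof. by apply: prodr_ge0 => i _; exact: gauss_ge0. Qed.

Lemma kern_out t x y : ~ Omega m y -> kern t x y = 0.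
Proof.
move=> /existsNP[i /not_implyP[im /negP]]; rewrite -leNgt => yi.
by rewrite /kern (bigD1 i)//= /k1 im ltNge yi /ind/= !mul0r.
Qed.

Lemma kern_frontier t x y : in_closure x -> ~ Omega m x -> kern t x y = 0.
Proof.
move=> hx /existsNP[i /not_implyP[im /negP]]; rewrite -leNgt => xi.
have xi0 : x ord0 i = 0 by apply/eqP; rewrite eq_le xi hx.
by rewrite /kern (bigD1 i)//= /k1 im xi0 sub0r add0r gaussN subrr mulr0 mul0r.
Qed.

Lemma measurable_kern d (T : measurableType d) (f : T -> R) (g h : T -> 'rV[R]_N) :
  measurable_fun setT f -> measurable_fun setT g -> measurable_fun setT h ->
  measurable_fun setT (fun p : T => kern (f p) (g p) (h p)).
Proof.
move=> mf mg mh; rewrite /kern; apply: (@measurable_prod _ _ _ _ _ _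
  (fun (i : 'I_N) (p : T) => k1 (i < m)%N (f p) (g p ord0 i) (h p ord0 i))) => i _.
by apply: measurable_k1 => //; exact: measurableT_comp (measurable_coord i) _.
Qed.

Lemma measurable_kernr t x : measurable_fun [set: 'rV[R]_N] (kern t x).
Proof. exact: measurable_kern. Qed.

Lemma measurable_gauss_row t x : measurable_fun [set: 'rV[R]_N] (gauss_row t x).
Proof.
apply: (@measurable_coord_prod _ _ (fun i a => gauss t (x ord0 i - a))) => i.
by apply: measurable_gauss2 => //; exact: measurable_funB.
Qed.

Lemma measurable_cube r x : measurable_fun [set: 'rV[R]_N] (cube r x).
Proof.
rewrite (_ : cube r x = fun y => \prod_i ind (`|y ord0 i - x ord0 i| < r)).
  apply: (@measurable_coord_prod _ _ (fun i a => ind (`|a - x ord0 i| < r))) => i.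
  exact: measurable_ind_ball.
by apply/funext => y; rewrite cubeE.
Qed.

Lemma integral_kern_semigroup t s x z : 0 < t -> 0 < s ->
  in_closure x -> Omega m z ->
  (\int[mu]_y (kern t x y * kern s y z)%:E = (kern (t + s) x z)%:E)%E.
Proof.
move=> t0 s0 hx Oz.
under eq_integral do rewrite /kern -big_split/=.
rewrite (@integral_row_prod _ _ (fun i a =>
   k1 (i < m)%N t (x ord0 i) a * k1 (i < m)%N s a (z ord0 i))); last 2 first.
- by move=> i; apply: measurable_funM; exact: measurable_k1.
- move=> i a; have [im|im] := boolP (i < m)%N; last by rewrite mulr_ge0 ?gauss_ge0.
  case: (ltP 0 a) => a0; first by rewrite mulr_ge0 ?k1_ge0// => _; [exact: hx|exact: ltW].
  by rewrite /k1 (ltNge 0 a) a0 /ind/= !mul0r.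
rewrite [in RHS]/kern -prodEFin; apply: eq_bigr => i _.
by apply: k1_semigroup => //; [exact: hx|exact: Oz].
Qed.

(** Bernoulli's inequality for factors in [0, 1], stated in the extended reals because the factors
    are integrals. *)
Lemma prode_itv01 n (I : 'I_n -> \bar R) c : (forall i, 0 <= I i <= 1)%E ->
  (forall i, (1 - c)%:E <= I i)%E ->
  ((1 - n%:R * c)%:E <= \prod_i I i)%E /\ (0 <= \prod_i I i <= 1)%E.
Proof.
elim: n I => [|n ih] I I01 Ic.
  by rewrite big_ord0 mul0r subr0 lee01 lexx.
have [h1 /andP[h2 h3]] := ih (fun i => I (lift ord0 i)) (fun i => I01 _) (fun i => Ic _).
rewrite big_ord_recl; move: h1 h2 h3; set P := (\prod_(i < n) _)%E.
have := I01 ord0; have := Ic ord0.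
case: (I ord0) => [a| |]; [|by rewrite leye_eq andbF|by rewrite leeNy_eq].
case: P => [b| |]; [|by rewrite !leye_eq|by rewrite leeNy_eq].
rewrite -EFinM !lee_fin => h /andP[a0 a1] hb b0 b1.
split; first by rewrite -natr1 mulrDl mul1r; nra.
by rewrite mulr_ge0//= mulr_ile1.
Qed.

Lemma integral_kern_le1 t x : 0 < t -> in_closure x ->
  (\int[mu]_y (kern t x y)%:E <= 1)%E.
Proof.
move=> t0 hx; rewrite /kern (@integral_row_prod _ _ (fun i a =>
   k1 (i < m)%N t (x ord0 i) a)); last 2 first.
- by move=> i; exact: measurable_k1.
- by move=> i a; apply: k1_ge0 => //; exact: hx.
pose I (i : 'I_N) := (\int[lebesgue_measure]_a (k1 (i < m)%N t (x ord0 i) a)%:E)%E.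
have I0 i : (0 <= I i)%E.
  by apply: integral_EFin_ge0 => a; apply: k1_ge0 => //; exact: hx.
have [//||_ /andP[_ //]] := @prode_itv01 N I 1; last by move=> i; rewrite subrr.
by move=> i; rewrite I0/=; apply: integral_k1_le1 => //; exact: hx.
Qed.

Lemma kern_cube_mass t r x : 0 < t -> 0 < r ->
  (forall i : 'I_N, (i < m)%N -> r < x ord0 i) ->
  ((1 - N%:R * (4 * 128 / r ^+ 4 * t ^+ 2))%:E <=
    \int[mu]_y (cube r x y * kern t x y)%:E)%E.
Proof.
move=> t0 r0 hr.
have hx : in_closure x by move=> i im; have := hr i im; lra.
under eq_integral do rewrite cubeE /kern -big_split/=.
rewrite (@integral_row_prod _ _ (fun i a =>
   ind (`|a - x ord0 i| < r) * k1 (i < m)%N t (x ord0 i) a)); last 2 first.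
- by move=> i; apply: measurable_funM; [exact: measurable_ind_ball|exact: measurable_k1].
- by move=> i a; rewrite mulr_ge0 ?ind_ge0 ?k1_ge0//; exact: hx.
have [||//] := @prode_itv01 N (fun i : 'I_N => \int[lebesgue_measure]_a
   (ind (`|a - x ord0 i| < r)%R * k1 (i < m)%N t (x ord0 i) a)%:E)%E
   (4 * 128 / r ^+ 4 * t ^+ 2).
- move=> i; apply/andP; split.
    by apply: integral_EFin_ge0 => a; rewrite mulr_ge0 ?ind_ge0 ?k1_ge0//; exact: hx.
  apply: le_trans (@integral_k1_le1 _ (i < m)%N t (x ord0 i) t0 (hx i)).
  apply: le_integral_EFin.
  + by apply: measurable_funM; [exact: measurable_ind_ball|exact: measurable_k1].
  + exact: measurable_k1.
  + by move=> a; rewrite mulr_ge0 ?ind_ge0 ?k1_ge0//; exact: hx.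
  + move=> a; rewrite ler_piMl ?ind_le1//.
    by apply: k1_ge0 => //; exact: hx.
- by move=> i; rewrite EFinB; apply: k1_ball_mass => // im; exact: hr.
Qed.

Lemma heat_kernelE t x y : 0 < t -> Omega m y -> heat_kernel m t x y = kern t x y.
Proof.
move=> t0 Oy; rewrite /heat_kernel /kern.
have t4 : 4 * pi * t >= 0 by rewrite !mulr_ge0 ?pi_ge0// ltW.
have -> : (4 * pi * t) `^ (- (N%:R / 2)) = \prod_(i < N) (4 * pi * t) `^ (- 2^-1).
  rewrite prodr_const card_ord -powR_mulrn ?powR_ge0// -powRrM.
  by congr (_ `^ _); rewrite mulNr mulrC.
rewrite (bigID (fun i : 'I_N => (i < m)%N) predT)/= mulrAC -[LHS]mulrA mulrACA.
rewrite [RHS](bigID (fun i : 'I_N => (i < m)%N))/= -big_split/=.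
have B : (4 * t) `^ (-1) = (4 * t)^-1 by rewrite powR_inv1// mulr_ge0// ltW.
congr (_ * _).
  apply: eq_bigr => i im; rewrite /k1 im (Oy i im) mul1r /gauss B.
  by rewrite !mulNr -mulrBr.
rewrite [X in _ * X](eq_bigl (fun i : 'I_N => ~~ (i < m)%N)); last first.
  by move=> i; rewrite -leqNgt.
rewrite -big_split/=; apply: eq_bigr => i im.
by rewrite /k1 (negbTE im) /gauss B.
Qed.

Lemma heatE t psi x : 0 < t ->
  heat m t psi x = \int[mu]_y (kern t x y * psi y).
Proof.
move=> t0; rewrite /heat Rintegral_mkcond; apply: eq_Rintegral => y _.
rewrite patchE; case: ifPn => [|] h.
  by rewrite heat_kernelE//; exact: set_mem.
by rewrite kern_out ?mul0r//; apply: contraNnot h => h; exact: mem_set.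
Qed.

End row_kernel.

(** * Duhamel's formula *)

Section duhamel.
Context {R : realType} {N : nat}.
Variable m : nat.
Local Notation mu := (@lebesgue_row R N).
Local Notation leb := (@lebesgue_measure R).
Implicit Types (a b t s h tau : R) (x y z : 'rV[R]_N) (Phi : R * 'rV[R]_N -> R).

Definition between a b s : R := ind ((a < s) && (s < b)).

Lemma measurable_between a b : measurable_fun setT (between a b).
Proof.
apply: measurable_ind; apply: measurable_and; exact: measurable_fun_ltr.
Qed.

Definition duhamel_integrand a b t x Phi (p : R * 'rV[R]_N) : R :=
  between a b p.1 * (kern m (t - p.1) x p.2 * Phi p).

(** The contribution at (t, x) of the source acting during (a, b). Separating [b] from the
    observation time [t] lets [heat_duhamel] move the latter alone. *)
Definition duhamel a b t x Phi : \bar R :=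
  (\int[leb]_s \int[mu]_z (duhamel_integrand a b t x Phi (s, z))%:E)%E.

Definition source Phi := [/\ measurable_fun setT Phi, forall p, 0 <= Phi p &
  forall s z, ~ Omega m z -> Phi (s, z) = 0].

Lemma measurable_duhamel_integrand a b t x Phi : source Phi ->
  measurable_fun setT (duhamel_integrand a b t x Phi).
Proof.
case=> mPhi _ _; apply: measurable_funM.
  exact: (measurableT_comp (measurable_between a b)).
apply: measurable_funM => //; apply: measurable_kern => //.
exact: measurable_funB.
Qed.

Lemma duhamel_integrand_ge0 a b t x Phi p : source Phi -> b <= t ->
  in_closure m x -> 0 <= duhamel_integrand a b t x Phi p.
Proof.
case=> _ Phi0 _ bt hx; rewrite /duhamel_integrand /between.
case: andP => [[h1 h2]|_]; last by rewrite mul0r.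
by rewrite mul1r mulr_ge0// kern_ge0// subr_gt0 (lt_le_trans h2).
Qed.

Lemma duhamel_ge0 a b t x Phi : source Phi -> b <= t -> in_closure m x ->
  (0 <= duhamel a b t x Phi)%E.
Proof.
move=> sP bt hx; apply: integral_ge0 => s _; apply: integral_EFin_ge0 => z.
exact: duhamel_integrand_ge0.
Qed.

Lemma duhamel_split a b c t x Phi : source Phi -> a <= b <= c -> c <= t ->
  in_closure m x ->
  duhamel a c t x Phi = (duhamel a b t x Phi + duhamel b c t x Phi)%E.
Proof.
move=> sP /andP[ab bc] ct hx; have bt := le_trans bc ct.
have mD a' b' : b' <= t -> measurable_fun setT (fun s =>
    \int[mu]_z (duhamel_integrand a' b' t x Phi (s, z))%:E)%E.
  move=> bt'; apply: (measurable_fun_fubini_tonelli_F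
    (fun p => (duhamel_integrand a' b' t x Phi p)%:E)).
    by apply/measurable_EFinP; exact: measurable_duhamel_integrand.
  by move=> p; rewrite lee_fin duhamel_integrand_ge0.
have D0 a' b' s : b' <= t ->
    (0 <= \int[mu]_z (duhamel_integrand a' b' t x Phi (s, z))%:E)%E.
  by move=> bt'; apply: integral_EFin_ge0 => z; exact: duhamel_integrand_ge0.
rewrite /duhamel -ge0_integralD//; last 4 first.
- by move=> s _; exact: D0.
- exact: mD.
- by move=> s _; exact: D0.
- exact: mD.
apply: ge0_ae_eq_integral => //; first exact: mD.
- by apply: emeasurable_funD; exact: mD.
- by move=> s _; exact: D0.
- by move=> s _; rewrite adde_ge0 ?D0.
exists [set b]; split => //; first exact: lebesgue_measure_set1.
move=> s /= hs; apply/eqP; apply: contra_notP hs => /negP sb _.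
have K z : duhamel_integrand a c t x Phi (s, z) =
    duhamel_integrand a b t x Phi (s, z) + duhamel_integrand b c t x Phi (s, z).
  rewrite /duhamel_integrand -mulrDl; congr (_ * _); rewrite /between /=.
  move: sb; rewrite neq_lt => /orP[] sb.
    by rewrite sb (lt_gtF sb) (lt_le_trans sb bc)/= addr0.
  by rewrite (lt_gtF sb) sb andbF add0r (le_lt_trans ab sb).
under eq_integral do rewrite K.
rewrite integral_EFinD// => [||z|z]; try exact: duhamel_integrand_ge0.
- exact: (measurableT_comp (measurable_duhamel_integrand _ _ _ _ sP) (pair1_measurable s)).
- exact: (measurableT_comp (measurable_duhamel_integrand _ _ _ _ sP) (pair1_measurable s)).
Qed.

Lemma measurable_ind_Omega :
  measurable_fun setT (fun y : 'rV[R]_N => ind `[< Omega m y >] : R).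
Proof.
rewrite (_ : (fun _ => _) = \1_(Omega m)).
  by apply: measurable_indic; exact: measurable_Omega.
apply/funext => y; rewrite indicE /ind; congr (_%:R); congr nat_of_bool.
Qed.

Lemma measurable_duhamel_integrand3 a b t Phi : source Phi ->
  measurable_fun setT (fun q : ('rV[R]_N * R) * 'rV[R]_N =>
    duhamel_integrand a b t q.1.1 Phi (q.1.2, q.2)).
Proof.
case=> mP _ _.
have m11 : measurable_fun setT (fun q : ('rV[R]_N * R) * 'rV[R]_N => q.1.1).
  exact: (measurableT_comp measurable_fst).
have m12 : measurable_fun setT (fun q : ('rV[R]_N * R) * 'rV[R]_N => q.1.2).
  exact: (measurableT_comp measurable_snd).
apply: measurable_funM; first exact: (measurableT_comp (measurable_between a b)).
apply: measurable_funM.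
  exact: (measurable_kern m (measurable_funB (measurable_cst t) m12) m11 measurable_snd).
exact: (measurableT_comp mP (measurable_fun_pair m12 measurable_snd)).
Qed.

(** For y off the closure of [Omega] the kernel can be negative. The value 0 is therefore imposed
    outside [Omega], which makes the integrand nonnegative everywhere. *)
Lemma measurable_duhamel a b t Phi : source Phi -> b <= t ->
  measurable_fun setT (fun y => if pselect (Omega m y) then duhamel a b t y Phi else 0%E).
Proof.
move=> sP bt.
pose G (q : ('rV[R]_N * R) * 'rV[R]_N) : R :=
  ind (asbool (Omega m q.1.1)) * duhamel_integrand a b t q.1.1 Phi (q.1.2, q.2).
have mO : measurable_fun setT (fun y : 'rV[R]_N => ind (asbool (Omega m y)) : R).
  exact: measurable_ind_Omega.
have mG : measurable_fun setT G.
  apply: measurable_funM.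
    exact: (measurableT_comp mO (measurableT_comp measurable_fst measurable_fst)).
  exact: measurable_duhamel_integrand3.
have G0 q : 0 <= G q.
  rewrite /G; case: asboolP => h; last by rewrite mul0r.
  by rewrite mul1r duhamel_integrand_ge0//; exact: Omega_in_closure.
have mF1 : measurable_fun setT (fun q : 'rV[R]_N * R => \int[mu]_z (G (q, z))%:E)%E.
  apply: (measurable_fun_fubini_tonelli_F (fun q => (G q)%:E)).
    exact/measurable_EFinP.
  by move=> q; rewrite lee_fin.
have mF : measurable_fun setT (fun y => \int[leb]_s \int[mu]_z (G ((y, s), z))%:E)%E.
  apply: (@measurable_fun_fubini_tonelli_F _ _ _ _ _ leb
    (fun q : 'rV[R]_N * R => \int[mu]_z (G (q, z))%:E)%E) => //.
  by move=> q; apply: integral_EFin_ge0 => z.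
apply: eq_measurable_fun mF => y _.
case: pselect => Oy.
  apply: eq_integral => s _; apply: eq_integral => z _.
  by rewrite /G/=; case: asboolP => // _; rewrite mul1r.
apply: integral0_eq => s _; apply: integral0_eq => z _.
by rewrite /G/=; case: asboolP => // _; rewrite mul0r.
Qed.

Lemma kern_duhamel_integrand h a b t x y Phi p : source Phi -> b <= t -> 0 < h ->
  in_closure m x -> 0 <= kern m h x y * duhamel_integrand a b t y Phi p.
Proof.
move=> sP bt h0 hx; have [Oy|Oy] := pselect (Omega m y); last by rewrite kern_out ?mul0r.
by rewrite mulr_ge0 ?kern_ge0 ?duhamel_integrand_ge0//; exact: Omega_in_closure.
Qed.

Let mul4_rot (k c e p : R) : k * (c * (e * p)) = c * p * (k * e).
Proof. by ring. Qed.

(** Tonelli's theorem brings the integral in y inside, and the semigroup property composes the times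
    h and t - s to (t + h) - s: the heat flow only postpones the observation. *)
Lemma heat_duhamel h a b t x Phi : source Phi -> b <= t -> 0 < h -> in_closure m x ->
  (\int[mu]_y ((kern m h x y)%:E * duhamel a b t y Phi) = duhamel a b (t + h) x Phi)%E.
Proof.
move=> sP bt h0 hx.
pose H (q : ('rV[R]_N * R) * 'rV[R]_N) : R :=
  kern m h x q.1.1 * duhamel_integrand a b t q.1.1 Phi (q.1.2, q.2).
have [mP P0 PO] := sP.
have mH : measurable_fun setT H.
  apply: measurable_funM; last exact: measurable_duhamel_integrand3.
  apply: (measurableT_comp (measurable_kernr m h x)).
  exact: (measurableT_comp measurable_fst).
have H0 q : 0 <= H q by exact: kern_duhamel_integrand.
have mF1 : measurable_fun setT (fun q : 'rV[R]_N * R => \int[mu]_z (H (q, z))%:E)%E.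
  apply: (measurable_fun_fubini_tonelli_F (fun q => (H q)%:E)).
    exact/measurable_EFinP.
  by move=> q; rewrite lee_fin.
have mDu y : in_closure m y -> measurable_fun setT (fun s =>
    \int[mu]_z (duhamel_integrand a b t y Phi (s, z))%:E)%E.
  move=> hy; apply: (measurable_fun_fubini_tonelli_F
    (fun p => (duhamel_integrand a b t y Phi p)%:E)).
    by apply/measurable_EFinP; exact: measurable_duhamel_integrand.
  by move=> p; rewrite lee_fin duhamel_integrand_ge0.
transitivity (\int[mu]_y \int[leb]_s \int[mu]_z (H ((y, s), z))%:E)%E.
  apply: eq_integral => y _; have [Oy|Oy] := pselect (Omega m y); last first.
    rewrite kern_out// mul0e; apply/esym.
    apply: integral0_eq => s _; apply: integral0_eq => z _.
    by rewrite /H/= kern_out// mul0r.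
  have hy := Omega_in_closure Oy.
  rewrite /duhamel -ge0_integralZl//; last 3 first.
  - exact: mDu.
  - by move=> s _; apply: integral_EFin_ge0 => z; exact: duhamel_integrand_ge0.
  - by rewrite lee_fin kern_ge0.
  apply: eq_integral => s _; rewrite -integral_EFinZ ?kern_ge0//.
  - exact: (measurableT_comp (measurable_duhamel_integrand _ _ _ _ sP) (pair1_measurable s)).
  - by move=> z; exact: duhamel_integrand_ge0.
rewrite (@fubini_tonelli _ _ _ _ _ mu leb (fun q : 'rV[R]_N * R => \int[mu]_z (H (q, z))%:E)%E mF1); last first.
  by move=> q; apply: integral_EFin_ge0 => z; exact: H0.
apply: eq_integral => s _.
have mHs : measurable_fun setT (fun q : 'rV[R]_N * 'rV[R]_N => H ((q.1, s), q.2)).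
  exact: (measurableT_comp mH (measurable_fun_pair
    (measurable_fun_pair measurable_fst (measurable_cst s)) measurable_snd)).
rewrite (@fubini_tonelli _ _ _ _ _ mu mu (fun q : 'rV[R]_N * 'rV[R]_N => (H ((q.1, s), q.2))%:E)); last 2 first.
- exact/measurable_EFinP.
- by move=> q; rewrite lee_fin.
apply: eq_integral => z _; rewrite /H /duhamel_integrand /=.
(* The semigroup identity needs s < b and z in [Omega]; in all other cases the source factor is zero
   and both sides vanish. *)
have [zero|ab] : between a b s * Phi (s, z) = 0 \/
    [/\ between a b s = 1, s < b & Omega m z].
- rewrite /between; case: andP => [[h1 h2]|_]; last by left; rewrite mul0r.
  have [Oz|Oz] := pselect (Omega m z); first by right.
  by left; rewrite PO// mulr0.
- transitivity (\int[mu]_y (0 * kern m h x y)%:E)%E.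
    by apply: eq_integral => y _; rewrite mul4_rot zero !mul0r.
  rewrite mulrCA zero mulr0.
  by under eq_integral do rewrite mul0r; rewrite integral0.
have [-> sb Oz] := ab.
under eq_integral do rewrite mul1r mulrA (mulrC _ (Phi (s, z))).
have ts : 0 < t - s by rewrite subr_gt0 (lt_le_trans sb).
rewrite integral_EFinZ//; last 2 first.
- apply: measurable_funM; first exact: measurable_kernr.
  by apply: measurable_kern.
- move=> y; have [Oy|Oy] := pselect (Omega m y); last by rewrite kern_out ?mul0r.
  by rewrite mulr_ge0 ?kern_ge0//; exact: Omega_in_closure.
rewrite (integral_kern_semigroup h0 ts hx Oz) -EFinM mul1r mulrC.
by rewrite (_ : h + (t - s) = t + h - s)//; ring.
Qed.

(** [P] and [M] have finite integrals, so they are finite almost everywhere; off a null set [fine]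
    commutes with the subtraction. *)
Lemma Rintegral_fine_sub d (T : measurableType d) (nu : {measure set T -> \bar R})
    (P M : T -> \bar R) :
  measurable_fun setT P -> measurable_fun setT M ->
  (forall w, 0 <= P w)%E -> (forall w, 0 <= M w)%E ->
  (\int[nu]_w P w < +oo)%E -> (\int[nu]_w M w < +oo)%E ->
  \int[nu]_w (fine (P w - M w)) = fine (\int[nu]_w P w)%E - fine (\int[nu]_w M w)%E.
Proof.
move=> mP mM P0 M0 Poo Moo.
have iP : nu.-integrable setT P.
  by apply/integrableP; split => //; under eq_integral do rewrite gee0_abs//.
have iM : nu.-integrable setT M.
  by apply/integrableP; split => //; under eq_integral do rewrite gee0_abs//.
have mPM : measurable_fun setT (fun w => P w - M w)%E by exact: emeasurable_funB.
rewrite /Rintegral -fineB; last 2 first.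
- exact: integrable_fin_num iP.
- exact: integrable_fin_num iM.
congr fine; rewrite -(integralB measurableT iP iM).
apply: ae_eq_integral => //.
  by apply/measurable_EFinP; exact: (measurableT_comp (fine_measurable _)).
have [N1 [mN1 N10 h1]] := integrable_ae measurableT iP.
have [N2 [mN2 N20 h2]] := integrable_ae measurableT iM.
exists (N1 `|` N2); split; first exact: measurableU.
  by rewrite null_set_setU.
move=> z /= hz; have [|nz] := pselect (N1 z); first by left.
right; apply: h2 => /= hM; apply: hz => _.
have hP : P z \is a fin_num.
  by apply: contrapT => hP; apply: nz; apply: h1 => /= /(_ I).
by rewrite fineK// fin_numB hP hM.
Qed.

(** Extension by zero to all times and all of R^N, so that measurability can be stated on the full
    space. [k] will be the positive part, the negative part or the absolute value. *)
Definition restricted (f : R -> 'rV[R]_N -> R) (k : R -> R) (p : R * 'rV[R]_N) : R :=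
  ind ((0 < p.1) && `[< Omega m p.2 >]) * k (f p.1 p.2).

Definition pospart (c : R) : R := Num.max c 0.
Definition negpart (c : R) : R := Num.max (- c) 0.

Definition duhamel_slice a b t x f k s : \bar R :=
  (\int[mu]_z (duhamel_integrand a b t x (restricted f k) (s, z))%:E)%E.

Lemma measurable_duhamel_slice a b t x f k : b <= t -> in_closure m x ->
  source (restricted f k) -> measurable_fun setT (duhamel_slice a b t x f k).
Proof.
move=> bt hx sk; apply: (measurable_fun_fubini_tonelli_F
  (fun p => (duhamel_integrand a b t x (restricted f k) p)%:E)).
  by apply/measurable_EFinP; exact: measurable_duhamel_integrand.
by move=> p; rewrite lee_fin duhamel_integrand_ge0.
Qed.

(** The Lebesgue integral is by definition the difference of the integrals of the positive and
    negative parts, and a nonnegative kernel passes through both parts. Hence no integrability in y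
    is required. *)
Lemma heat_slice f a b t x s : 0 <= a -> b <= t -> in_closure m x ->
  ((fun s => heat m (t - s) (f s) x) \_ `]a, b[) s =
  fine (duhamel_slice a b t x f pospart s - duhamel_slice a b t x f negpart s)%E.
Proof.
move=> a0 bt hx; rewrite patchE.
have [|h] := boolP (s \in `]a, b[%classic); last first.
  have E k : duhamel_slice a b t x f k s = 0%E.
    rewrite /duhamel_slice [LHS](_ : _ = \int[mu]_z 0)%E; first by rewrite integral0.
    apply: eq_integral => z _; rewrite /duhamel_integrand /between/=.
    case: andP => [[h1 h2]|_]; last by rewrite mul0r.
    by exfalso; move/negP: h; apply; rewrite inE/= in_itv/= h1.
  by rewrite !E subee.
rewrite inE/= in_itv/= => /andP[as_ sb].
have ts : 0 < t - s by rewrite subr_gt0 (lt_le_trans sb).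
have s0 : 0 < s by rewrite (le_lt_trans a0).
rewrite heatE// /Rintegral; congr fine; rewrite integralE /duhamel_slice.
congr (_ - _)%E; apply: eq_integral => z _.
  rewrite funeposE/= /duhamel_integrand /between /restricted/= as_ sb s0/= mul1r.
  case: asboolP => Oz; last by rewrite kern_out// !mul0r maxxx.
  have k0 := kern_ge0 z ts hx.
  by rewrite /ind/= mul1r /pospart -[0%E]/(0%:E) -EFin_max maxr_pMr// mulr0.
rewrite funenegE/= /duhamel_integrand /between /restricted/= as_ sb s0/= mul1r.
case: asboolP => Oz; last by rewrite kern_out// !mul0r oppr0 maxxx.
have k0 := kern_ge0 z ts hx.
by rewrite /ind/= mul1r /negpart -[0%E]/(0%:E) -EFin_max maxr_pMr// mulr0 mulrN.
Qed.

Lemma measurable_heat_slice f a b t x :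
  source (restricted f pospart) -> source (restricted f negpart) ->
  0 <= a -> b <= t -> in_closure m x ->
  measurable_fun `]a, b[ (fun s => heat m (t - s) (f s) x).
Proof.
move=> sP sM a0 bt hx; apply/(measurable_restrictT _ _).2 => //.
rewrite (funext (fun s => heat_slice f s a0 bt hx)).
have mPM := emeasurable_funB (measurable_duhamel_slice a bt hx sP)
  (measurable_duhamel_slice a bt hx sM).
exact: (measurableT_comp (fine_measurable _) mPM).
Qed.

Lemma Rintegral_duhamel f a b t x :
  source (restricted f pospart) -> source (restricted f negpart) ->
  0 <= a -> b <= t -> in_closure m x ->
  (duhamel a b t x (restricted f pospart) < +oo)%E ->
  (duhamel a b t x (restricted f negpart) < +oo)%E ->
  \int[leb]_(s in `]a, b[) heat m (t - s) (f s) x =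
  fine (duhamel a b t x (restricted f pospart)) -
  fine (duhamel a b t x (restricted f negpart)).
Proof.
move=> sP sM a0 bt hx Poo Moo.
have D0 k s : source (restricted f k) -> (0 <= duhamel_slice a b t x f k s)%E.
  by move=> sk; apply: integral_EFin_ge0 => z; exact: duhamel_integrand_ge0.
have E := @Rintegral_fine_sub _ _ leb _ _ (measurable_duhamel_slice a bt hx sP)
  (measurable_duhamel_slice a bt hx sM)
  (fun s => D0 _ s sP) (fun s => D0 _ s sM) Poo Moo.
rewrite /duhamel -[RHS]E {E} Rintegral_mkcond; apply: eq_Rintegral => s _.
exact: heat_slice.
Qed.

End duhamel.

(** * Uniform convergence in epsilon form *)

Section uniform_convergence.
Context {R : realType}.

Lemma uniform_cvgP (T : Type) (U : choiceType) (F : set_system T) (A : set U)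
    (f : T -> U -> R) (g : U -> R) : Filter F ->
  {uniform A, f @ F --> g} <->
  (forall e : R, 0 < e -> \forall t \near F, forall x, A x -> `|f t x - g x| < e).
Proof.
move=> FF; split=> [fg e e0|h].
  have : nbhs (g : {uniform` A -> R})
      [set h : {uniform` A -> R} | forall y, A y -> ball (g y) e (h y)].
    apply/uniform_nbhs; exists [set xy : R * R | ball xy.1 e xy.2]; split => //.
    by rewrite -entourage_from_ballE; exists e.
  by move=> /fg; apply: (@filterS _ F) => t ht x Ax; rewrite distrC; exact: ht.
move=> P /uniform_nbhs[E [entE EP]].
move: entE; rewrite -entourage_from_ballE => -[e /= e0 he].
have := h e e0; apply: filterS => t ht; apply: EP => y Ay; apply: he.
by rewrite /= /ball/= distrC; exact: ht.
Qed.

Lemma locally_uniformlyP (T : topologicalType) (D : set T) (F : R -> T -> R)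
    (f : T -> R) :
  locally_uniformly D F f <->
  (forall K, compact K -> K `<=` D -> forall e, 0 < e ->
    exists M, forall t, M < t -> forall x, K x -> `|F t x - f x| < e).
Proof.
rewrite /locally_uniformly fam_cvgP; split.
  move=> h K cK KD e e0; have /uniform_cvgP /(_ e e0) := h K (conj cK KD).
  by move=> [M [_ hM]]; exists M => t /hM.
move=> h K [cK KD]; apply/uniform_cvgP => e e0.
have [M hM] := h K cK KD e e0.
by exists M; split; [exact: num_real|move=> t /hM].
Qed.

End uniform_convergence.

(** * Regularity shared by the two solutions *)

Section tame_flows.
Context {R : realType} {N : nat}.
Variable m : nat.
Implicit Types (t s e a b M : R) (x y : 'rV[R]_N) (u : R -> 'rV[R]_N -> R).
Local Notation clO := [set x : 'rV[R]_N | in_closure m x].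

Lemma enorm_ge x i : `|x ord0 i| <= enorm x.
Proof.
rewrite /enorm -sqrtr_sqr ler_wsqrtr// (bigD1 i)//= lerDl sumr_ge0// => j _.
exact: sqr_ge0.
Qed.

Lemma enorm_le x M : (forall i, `|x ord0 i| <= M) -> 0 <= M ->
  enorm x <= N%:R * M.
Proof.
move=> h M0; rewrite /enorm -[leRHS]ger0_norm ?mulr_ge0// -sqrtr_sqr ler_wsqrtr//.
apply: (@le_trans _ _ (\sum_(i < N) M ^+ 2)).
  by apply: ler_sum => i _; rewrite -(real_normK (num_real (x ord0 i))) ler_pXn2r ?nnegrE.
rewrite sumr_const card_ord -[leLHS]mulr_natl exprMn ler_wpM2r ?sqr_ge0//.
by case: (N) => [|n]; [rewrite expr0n|rewrite expr2 ler_peMr// ler1n].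
Qed.

Definition box (M : R) : set 'rV[R]_N := [set x | forall i, `|x ord0 i| <= M].

Lemma compact_coord_box (a b : 'I_N -> R) :
  compact [set x : 'rV[R]_N | forall i, a i <= x ord0 i <= b i].
Proof.
rewrite (_ : [set _ | _] = [set x : 'rV[R]_N | forall i,
    [set` `[a i, b i]%R] (x ord0 i)]).
  by apply: (@rV_compact _ _ (fun i => [set` `[a i, b i]%R])) => i; exact: segment_compact.
by apply/seteqP; split=> x h i; have := h i; rewrite /= in_itv.
Qed.

Lemma compact_closure_box M : compact (clO `&` box M).
Proof.
rewrite (_ : _ `&` _ = [set x : 'rV[R]_N | forall i : 'I_N,
   (if (i < m)%N then 0 else - M) <= x ord0 i <= M]).
  exact: (@compact_coord_box (fun i => if (i < m)%N then 0 else - M) (fun=> M)).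
apply/seteqP; split=> x /=.
  move=> [hx hM] i; have := hM i; rewrite ler_norml => /andP[h1 h2].
  by case: ifP => im; rewrite ?h1 ?h2 ?hx.
move=> h; split=> i.
  by move=> im; have := h i; rewrite im => /andP[].
have := h i; rewrite ler_norml; case: ifP => im /andP[h1 h2]; rewrite h2 andbT//.
by apply: (le_trans _ h1); rewrite oppr_le0 (le_trans h1 h2).
Qed.

Lemma compact_in_box (K : set 'rV[R]_N) : compact K -> exists2 M, 0 < M & K `<=` box M.
Proof.
move=> cK; have /ex_strict_bound_gt0[M M0 hM] := compact_bounded cK.
exists M => // x Kx i; apply/ltW/(le_lt_trans _ (hM x Kx)).
by rewrite [leRHS]mx_normrE; exact: (le_bigmax _ (fun ij : 'I_1 * 'I_N => `|x ij.1 ij.2|) (ord0, i)).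
Qed.

(** The common ground of solutions with values in [C0] and in [C0bu], so that one comparison
    principle serves [u], [v] and their negatives. Nothing is required at time 0. *)
Definition tame u := [/\ jointly_continuous clO u,
  forall t x, 0 < t -> in_closure m x -> ~ Omega m x -> u t x = 0 &
  forall a b, 0 < a -> exists M, forall t x, a <= t <= b -> in_closure m x ->
    `|u t x| <= M].

(** Continuity in time is uniform in x, so it combines with the continuity of a single time slice
    into joint continuity. Compactness of [a, b] turns the local bounds in time into one bound. *)
Lemma tame_time_continuous Y u :
  (forall f, Y f -> [/\ continuous_on clO f,
     forall x, in_closure m x -> ~ Omega m x -> f x = 0 &
     exists M, forall x, in_closure m x -> `|f x| <= M]) ->
  time_continuous m Y u -> tame u.
Proof.
move=> hY cu.
have cu' t e : 0 < t -> 0 < e -> \forall s \near t, forall x, in_closure m x ->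
    `|u s x - u t x| < e.
  move=> t0 e0; have [_ /uniform_cvgP/(_ e e0)] := cu t t0.
  by apply: filterS => s hs x hx; apply: hs; rewrite in_closureE.
split.
- move=> t x t0 hx e e0; have e2 : 0 < e / 2 by rewrite divr_gt0.
  have [d1 d10 hd1] : exists2 d, 0 < d & forall s, `|s - t| < d ->
      forall x, in_closure m x -> `|u s x - u t x| < e / 2.
    have /nbhs_ballP[d /= d0 hd] := cu' t (e / 2) t0 e2.
    by exists d => // s st; apply: hd; rewrite /ball/= distrC.
  have [cut _ _] := hY _ (cu t t0).1.
  have [d2 d20 hd2] := cut x hx (e / 2) e2.
  exists (Num.min d1 d2); first by rewrite lt_min d10.
  move=> s y s0 hy; rewrite lt_min => /andP[st _] xy.
  have h1 := hd1 s st y hy.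
  have h2 : `|u t y - u t x| < e / 2.
    by apply: hd2 => // i; have := xy i; rewrite lt_min => /andP[].
  rewrite -(subrK (u t y) (u s y)) -addrA (splitr e).
  by apply: (le_lt_trans (ler_normD _ _)); exact: ltrD.
- by move=> t x t0 hx nx; have [_ h _] := hY _ (cu t t0).1; exact: h.
- move=> a b a0.
  have /compact_near_coveringP cab := @segment_compact R a b.
  have : \forall M \near +oo, `[a, b] `<=` [set t | forall x, in_closure m x -> `|u t x| <= M].
    apply: cab => t; rewrite /= in_itv/= => /andP[at_ tb].
    have t0 : 0 < t by exact: lt_le_trans at_.
    have [_ _ [M hM]] := hY _ (cu t t0).1.
    exists ([set s | forall x, in_closure m x -> `|u s x - u t x| < 1], [set M' | M + 1 < M']).
      split => /=; first exact: cu'.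
      by exists (M + 1); split => //; exact: num_real.
    move=> [s M'] [/= hs hM'] x hx; apply/ltW/(le_lt_trans _ hM').
    rewrite -(subrK (u t x) (u s x)) addrC; apply: (le_trans (ler_normD _ _)).
    by apply: lerD; [exact: hM|exact/ltW/hs].
  move=> [M [_ hM]]; exists (M + 1) => t x tab hx.
  by apply: (hM (M + 1)) => //; rewrite ?ltrDl//= in_itv.
Qed.

Lemma C0bu_tame u : time_continuous m (@C0bu R N m) u -> tame u.
Proof.
apply: tame_time_continuous => f [[M hM] cf f0]; split.
- move=> x hx e e0; have [d d0 hd] := cf e e0.
  (* The Euclidean norm is at most N times the sup norm; adding 1 keeps the denominator positive and
     the inequality strict. *)
  exists (d / (N%:R + 1)); first by rewrite divr_gt0// ltr_wpDl.
  move=> y hy xy; rewrite distrC; apply: hd; rewrite ?in_closureE//.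
  apply: (@le_lt_trans _ _ (N%:R * (d / (N%:R + 1)))).
    apply: enorm_le; last by rewrite divr_ge0 ?ltW// ltr_wpDl.
    by move=> i; rewrite !mxE distrC ltW.
  rewrite mulrCA gtr_pMr// ltr_pdivrMr ?mul1r ?ltrDl// ltr_wpDl//.
- by move=> x hx nx; apply: f0; apply/frontierE.
- by exists M => x hx; apply: hM; rewrite in_closureE.
Qed.

Lemma C0_tame u : time_continuous m (@C0 R N m) u -> tame u.
Proof.
apply: tame_time_continuous => f [cf f0 fd].
have f0' x : in_closure m x -> ~ Omega m x -> f x = 0.
  by move=> hx nx; apply: f0; apply/frontierE.
split => //.
- move=> x hx e e0; move/subspace_continuousP : cf => /(_ x).
  rewrite in_closureE => /(_ hx)/cvgrPdist_lt/(_ e e0)/nbhs_ballP[d /= d0 hd].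
  exists d => // y hy xy; rewrite distrC; apply: hd; last by rewrite in_closureE.
  by split => // i j; rewrite !ord1 /ball/= distrC; exact: xy.
(* Inside the box of half-side [M'] compactness bounds f; outside it f is at most 1 on [Omega] by
   decay at infinity and 0 on the boundary. *)
- have [M hM] := fd 1 ltr01; pose M' := `|M| + 1.
  have M'0 : 0 <= M' by rewrite addr_ge0.
  have : bounded_set (f @` (clO `&` box M')).
    apply: compact_bounded; apply: continuous_compact; last exact: compact_closure_box.
    apply: continuous_subspaceW cf => x [hx _].
    by rewrite in_closureE.
  move=> /ex_strict_bound_gt0[B B0 hB].
  exists (Num.max B 1) => x hx; rewrite le_max.
  have [xM|/existsNP[i /negP]] := pselect (box M' x).
    by apply/orP; left; apply/ltW/hB; exists x.
  rewrite -ltNge => xi; apply/orP; right.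
  have [Ox|nx] := pselect (Omega m x); last by rewrite f0' ?normr0.
  apply: hM => //; apply: (le_trans (ler_norm M)); apply: le_trans (enorm_ge x i).
  by apply: ltW; apply: lt_trans xi; rewrite ltrDl.
Qed.

End tame_flows.

(** * The heat semigroup on bounded functions *)

Section heat_operator.
Context {R : realType} {N : nat}.
Variable m : nat.
Local Notation mu := (@lebesgue_row R N).
Implicit Types (t s h tau B c : R) (x y z : 'rV[R]_N) (psi phi : 'rV[R]_N -> R).

Definition bounded_on psi := measurable_fun (Omega m) psi /\
  exists B, forall y, Omega m y -> `|psi y| <= B.

Lemma measurable_kernM t x psi : measurable_fun (Omega m) psi ->
  measurable_fun setT (fun y => kern m t x y * psi y).
Proof.
move=> mpsi; rewrite (_ : (fun _ => _) =
    (fun y => kern m t x y * (psi \_ (Omega m)) y)).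
  apply: measurable_funM; first exact: measurable_kernr.
  exact: ((measurable_restrictT psi (measurable_Omega m)).1 mpsi).
apply/funext => y; rewrite patchE; case: ifPn => // Oy.
by rewrite kern_out ?mul0r//; apply: contraNnot Oy => Oy; exact: mem_set.
Qed.

Lemma kernM_ge0 t x psi y : 0 < t -> in_closure m x ->
  (forall y, Omega m y -> 0 <= psi y) -> 0 <= kern m t x y * psi y.
Proof.
move=> t0 hx psi0; have [Oy|Oy] := pselect (Omega m y).
  by rewrite mulr_ge0 ?kern_ge0 ?psi0.
by rewrite kern_out// mul0r.
Qed.

Lemma integrable_kern t x : 0 < t -> in_closure m x ->
  mu.-integrable setT (EFin \o kern m t x).
Proof.
move=> t0 hx; apply/integrableP; split.
  by apply/measurable_EFinP; exact: measurable_kernr.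
under eq_integral do rewrite /= ger0_norm ?kern_ge0//.
by apply: (le_lt_trans (integral_kern_le1 t0 hx)); rewrite ltry.
Qed.

Lemma integrable_kernM t x psi : 0 < t -> in_closure m x -> bounded_on psi ->
  mu.-integrable setT (EFin \o (fun y => kern m t x y * psi y)).
Proof.
move=> t0 hx [mpsi [B hB]].
have := integrableZl measurableT `|B| (integrable_kern t0 hx).
apply: le_integrable => //.
  by apply/measurable_EFinP; exact: measurable_kernM.
move=> y _.
change ((`|kern m t x y * psi y|)%:E <= (`| `|B| * kern m t x y |)%:E)%E; rewrite lee_fin.
have [Oy|Oy] := pselect (Omega m y); last by rewrite kern_out// mul0r normr0.
rewrite normrM (mulrC `|kern _ _ _ _|) normrM normr_id ler_wpM2r//.
by apply: (le_trans (hB y Oy)); exact: ler_norm.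
Qed.

Lemma heat_le t x psi phi : 0 < t -> in_closure m x ->
  bounded_on psi -> bounded_on phi ->
  (forall y, Omega m y -> psi y <= phi y) -> heat m t psi x <= heat m t phi x.
Proof.
move=> t0 hx bpsi bphi h; rewrite !heatE//; apply: le_Rintegral => //.
- exact: integrable_kernM.
- exact: integrable_kernM.
move=> y _; have [Oy|Oy] := pselect (Omega m y).
  by rewrite ler_wpM2l ?kern_ge0 ?h.
by rewrite kern_out// !mul0r.
Qed.

Lemma heat_ge0 t x psi : 0 < t -> in_closure m x ->
  (forall y, Omega m y -> 0 <= psi y) -> 0 <= heat m t psi x.
Proof.
by move=> t0 hx h; rewrite heatE//; apply: Rintegral_ge0 => y _; exact: kernM_ge0.
Qed.

Lemma bounded_on_cst c : bounded_on (cst c).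
Proof. by split; [exact: measurable_cst|exists `|c|]. Qed.

Lemma bounded_onD psi phi : bounded_on psi -> bounded_on phi ->
  bounded_on (fun y => psi y + phi y).
Proof.
move=> [m1 [B1 h1]] [m2 [B2 h2]]; split; first exact: measurable_funD.
by exists (B1 + B2) => y Oy; apply: (le_trans (ler_normD _ _)); apply: lerD; auto.
Qed.

Lemma bounded_onN psi : bounded_on psi -> bounded_on (fun y => - psi y).
Proof.
move=> [m1 [B1 h1]]; split; first exact: measurable_funN.
by exists B1 => y Oy; rewrite normrN; exact: h1.
Qed.

Lemma bounded_onB psi phi : bounded_on psi -> bounded_on phi ->
  bounded_on (fun y => psi y - phi y).
Proof. by move=> b1 b2; apply: bounded_onD => //; exact: bounded_onN. Qed.

Lemma heatB t x psi phi : 0 < t -> in_closure m x ->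
  bounded_on psi -> bounded_on phi ->
  heat m t (fun y => psi y - phi y) x = heat m t psi x - heat m t phi x.
Proof.
move=> t0 hx b1 b2; rewrite !heatE// -RintegralB//; try exact: integrable_kernM.
by apply: eq_Rintegral => y _; rewrite mulrBr.
Qed.

Lemma heatD t x psi phi : 0 < t -> in_closure m x ->
  bounded_on psi -> bounded_on phi ->
  heat m t (fun y => psi y + phi y) x = heat m t psi x + heat m t phi x.
Proof.
move=> t0 hx b1 b2; rewrite !heatE// -RintegralD//; try exact: integrable_kernM.
by apply: eq_Rintegral => y _; rewrite mulrDr.
Qed.

Lemma heat_cst_le t x c : 0 < t -> in_closure m x -> 0 <= c ->
  heat m t (cst c) x <= c.
Proof.
move=> t0 hx c0; rewrite heatE// /Rintegral.
have mk := measurable_kernr m t x.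
have E : (\int[mu]_y (kern m t x y * cst c y)%:E =
    c%:E * \int[mu]_y (kern m t x y)%:E)%E.
  rewrite -integral_EFinZ => [||y|]//; last exact: kern_ge0.
  by apply: eq_integral => y _; rewrite mulrC.
rewrite E fineM//; last exact: integrable_fin_num (integrable_kern t0 hx).
rewrite /= ler_piMr// -lee_fin fineK; last exact: integrable_fin_num (integrable_kern t0 hx).
exact: integral_kern_le1.
Qed.

Lemma heat_ubound t x psi B : 0 < t -> in_closure m x -> measurable_fun (Omega m) psi ->
  0 <= B -> (forall y, Omega m y -> `|psi y| <= B) -> `|heat m t psi x| <= B.
Proof.
move=> t0 hx mpsi B0 hB; have bpsi : bounded_on psi by split => //; exists B.
rewrite ler_norml; apply/andP; split.
  rewrite lerNl -sub0r.
  have -> : 0 - heat m t psi x = heat m t (cst 0) x - heat m t psi x.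
    congr (_ - _); rewrite heatE//; apply/esym.
    by rewrite /Rintegral (integral0_eq)// => y _; rewrite mulr0.
  rewrite -heatB//; last exact: bounded_on_cst.
  apply: le_trans (heat_cst_le t0 hx B0); apply: heat_le => //.
  - by apply: bounded_onB => //; exact: bounded_on_cst.
  - exact: bounded_on_cst.
  by move=> y Oy; rewrite /= sub0r; have := hB y Oy; rewrite ler_norml lerNl => /andP[].
apply: le_trans (heat_cst_le t0 hx B0); apply: heat_le => //; first exact: bounded_on_cst.
by move=> y Oy; have := hB y Oy; rewrite ler_norml => /andP[].
Qed.

(** The semigroup law in the extended reals, for nonnegative data without any bound; boundedness
    enters only when real values are taken in [heat_semigroup]. *)
Lemma integral_heat h tau x psi : 0 < h -> 0 < tau -> in_closure m x ->
  measurable_fun (Omega m) psi -> (forall y, Omega m y -> 0 <= psi y) ->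
  (\int[mu]_y ((kern m h x y)%:E * \int[mu]_z (kern m tau y z * psi z)%:E) =
   \int[mu]_z (kern m (h + tau) x z * psi z)%:E)%E.
Proof.
move=> h0 t0 hx mpsi psi0.
pose psi' := psi \_ (Omega m).
have mpsi' : measurable_fun setT psi'.
  exact: ((measurable_restrictT psi (measurable_Omega m)).1 mpsi).
have psi'E z : Omega m z -> psi' z = psi z by move=> Oz; rewrite /psi' patchE mem_set.
have kE t y z : kern m t y z * psi z = kern m t y z * psi' z.
  by have [Oz|Oz] := pselect (Omega m z); [rewrite psi'E|rewrite kern_out// !mul0r].
pose H (q : 'rV[R]_N * 'rV[R]_N) := kern m h x q.1 * (kern m tau q.1 q.2 * psi' q.2).
have mH : measurable_fun setT H.
  apply: measurable_funM; first exact: (measurableT_comp (measurable_kernr m h x)).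
  apply: measurable_funM; last exact: (measurableT_comp mpsi').
  exact: (measurable_kern m (measurable_cst tau) measurable_fst measurable_snd).
have H0 q : 0 <= H q.
  rewrite /H -kE; have [Oq|Oq] := pselect (Omega m q.1); last by rewrite kern_out ?mul0r.
  by rewrite mulr_ge0 ?kern_ge0//; apply: kernM_ge0 => //; exact: Omega_in_closure.
transitivity (\int[mu]_y \int[mu]_z (H (y, z))%:E)%E.
  apply: eq_integral => y _; have [Oy|Oy] := pselect (Omega m y); last first.
    rewrite kern_out// mul0e; apply/esym.
    by apply: integral0_eq => z _; rewrite /H/= kern_out// mul0r.
  have hy := Omega_in_closure Oy.
  rewrite -integral_EFinZ ?kern_ge0//.
  - by apply: eq_integral => z _; rewrite kE.
  - exact: measurable_kernM.
  - by move=> z; exact: kernM_ge0.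
rewrite (@fubini_tonelli _ _ _ _ _ mu mu (fun q => (H q)%:E)); last 2 first.
- exact/measurable_EFinP.
- by move=> q; rewrite lee_fin.
apply: eq_integral => z _; rewrite kE.
have [Oz|Oz] := pselect (Omega m z); last first.
  rewrite kern_out// mul0r; apply: integral0_eq => y _.
  by rewrite /H/= (kern_out _ _ Oz) mul0r mulr0.
have pz : 0 <= psi' z by rewrite psi'E ?psi0.
transitivity (\int[mu]_y (psi' z * (kern m h x y * kern m tau y z))%:E)%E.
  by apply: eq_integral => y _; rewrite /H/= mulrA mulrC.
have mk : measurable_fun setT (fun y => kern m h x y * kern m tau y z).
  apply: measurable_funM; first exact: measurable_kernr.
  exact: (measurable_kern m (measurable_cst tau) (@measurable_id _ _ _) (measurable_cst z)).
rewrite integral_EFinZ//; last first.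
  move=> y; apply: (@kernM_ge0 _ _ (fun y => kern m tau y z)) => // w Ow.
  by apply: kern_ge0 => //; exact: Omega_in_closure.
by rewrite (integral_kern_semigroup h0 t0 hx Oz) -EFinM mulrC.
Qed.

Lemma heat_semigroup h tau x psi : 0 < h -> 0 < tau -> in_closure m x ->
  bounded_on psi -> (forall y, Omega m y -> 0 <= psi y) ->
  heat m h (heat m tau psi) x = heat m (h + tau) psi x.
Proof.
move=> h0 t0 hx bpsi psi0.
rewrite (heatE _ _ _ (addr_gt0 h0 t0)) /Rintegral -(integral_heat h0 t0 hx bpsi.1 psi0).
rewrite heatE// /Rintegral; congr fine; apply: eq_integral => y _.
have [Oy|Oy] := pselect (Omega m y); last by rewrite kern_out// mul0r mul0e.
rewrite EFinM heatE// /Rintegral fineK//.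
by apply: integrable_fin_num => //; apply: integrable_kernM => //; exact: Omega_in_closure.
Qed.

Lemma measurable_heat t psi : 0 < t -> bounded_on psi ->
  (forall y, Omega m y -> 0 <= psi y) -> measurable_fun (Omega m) (heat m t psi).
Proof.
move=> t0 [mpsi _] psi0.
pose psi' := psi \_ (Omega m).
have mpsi' : measurable_fun setT psi'.
  exact: ((measurable_restrictT psi (measurable_Omega m)).1 mpsi).
have psi'0 z : 0 <= psi' z.
  by rewrite /psi' patchE; case: ifPn => // /set_mem/psi0.
pose H (q : 'rV[R]_N * 'rV[R]_N) :=
  ind `[< Omega m q.1 >] * (kern m t q.1 q.2 * psi' q.2).
have mH : measurable_fun setT H.
  apply: measurable_funM; first exact: (measurableT_comp (measurable_ind_Omega m) measurable_fst).
  apply: measurable_funM; last exact: (measurableT_comp mpsi').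
  exact: (measurable_kern m (measurable_cst t) measurable_fst measurable_snd).
have H0 q : 0 <= H q.
  rewrite /H; case: asboolP => Oq; last by rewrite mul0r.
  by rewrite mul1r mulr_ge0// kern_ge0//; exact: Omega_in_closure.
have mF : measurable_fun setT (fun y => \int[mu]_z (H (y, z))%:E)%E.
  apply: (@measurable_fun_fubini_tonelli_F _ _ _ _ _ mu (fun q => (H q)%:E)).
    exact/measurable_EFinP.
  by move=> q; rewrite lee_fin.
have mFf : measurable_fun setT (fun y => fine (\int[mu]_z (H (y, z))%:E)%E).
  exact: (measurableT_comp (fine_measurable _) mF).
apply: eq_measurable_fun (measurable_funTS mFf) => y /set_mem Oy.
rewrite heatE// /Rintegral; congr fine; apply: eq_integral => z _.
rewrite /H/=; case: asboolP => // _; rewrite mul1r /psi' patchE.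
case: ifPn => // Oz; rewrite kern_out ?mul0r//.
by apply: contraNnot Oz => Oz; exact: mem_set.
Qed.

Lemma bounded_on_heat t psi : 0 < t -> bounded_on psi ->
  (forall y, Omega m y -> 0 <= psi y) -> bounded_on (heat m t psi).
Proof.
move=> t0 bpsi psi0; split; first exact: measurable_heat.
have [mpsi [B hB]] := bpsi; exists `|B| => y Oy; apply: heat_ubound => //.
  exact: Omega_in_closure.
by move=> z Oz; apply: (le_trans (hB z Oz)); exact: ler_norm.
Qed.

End heat_operator.

(** * Restarting Duhamel's formula at a positive time *)

Section mild_restart.
Context {R : realType} {N : nat}.
Variables (m : nat) (alpha : R).
Local Notation mu := (@lebesgue_row R N).
Local Notation leb := (@lebesgue_measure R).
Implicit Types (t s h tau B c : R) (r : R) (x y z : 'rV[R]_N).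

Local Notation absr := (Num.Def.normr : R -> R).

Definition absorbed (v : R -> 'rV[R]_N -> R) s y := absorption alpha (v s y).

Definition restart (w : R -> 'rV[R]_N -> R) := forall tau t x, 0 < tau < t -> Omega m x ->
  w t x = heat m (t - tau) (w tau) x
    - \int[leb]_(s in `]tau, t[) heat m (t - s) (absorption alpha \o w s) x.

Lemma measurable_absorption : measurable_fun setT (@absorption R alpha).
Proof.
apply: measurable_funM => //.
by apply: (measurableT_comp (measurable_powR _)); exact: normr_measurable.
Qed.

Lemma absorptionN r : absorption alpha (- r) = - absorption alpha r.
Proof. by rewrite /absorption normrN mulrN. Qed.

Lemma jointly_continuous_Omega (v : R -> 'rV[R]_N -> R) : tame m v ->
  jointly_continuous (Omega m) v.
Proof.
move=> [cv _ _] t x t0 Ox e e0; have [d d0 hd] := cv t x t0 (Omega_in_closure Ox) e e0.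
by exists d => // s y s0 Oy; apply: hd => //; exact: Omega_in_closure.
Qed.

Lemma tame_measurable (v : R -> 'rV[R]_N -> R) t : tame m v -> 0 < t ->
  measurable_fun (Omega m) (v t).
Proof.
move=> tv t0; apply: continuous_on_measurable.
- exact: measurable_Omega.
- exact: upward_closed_Omega.
- by apply: jointly_continuous_slice => //; exact: jointly_continuous_Omega.
Qed.

Lemma tame_bounded_on (v : R -> 'rV[R]_N -> R) t : tame m v -> 0 < t ->
  bounded_on m (v t).
Proof.
move=> tv t0; split; first exact: tame_measurable.
have [_ _ /(_ t t t0)[B hB]] := tv; exists B => y Oy.
by apply: hB; rewrite ?lexx//; exact: Omega_in_closure.
Qed.

Section sources.
Variable v : R -> 'rV[R]_N -> R.
Hypothesis tv : tame m v.
Local Notation f := (absorbed v).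

Lemma measurable_restricted (k : R -> R) : measurable_fun setT k ->
  measurable_fun setT (restricted m f k).
Proof.
move=> mk.
have mpos : measurable [set t : R | 0 < t].
  rewrite (_ : [set _ | _] = [set` `]0, +oo[%R]) //.
  by apply/seteqP; split=> x /=; rewrite in_itv/= andbT.
have mD : measurable ([set t : R | 0 < t] `*` @Omega R N m).
  by apply: measurableX => //; exact: measurable_Omega.
have mv := jointly_continuous_measurable (measurable_Omega m)
  (@upward_closed_Omega R N m) (jointly_continuous_Omega tv).
have mf : measurable_fun ([set t : R | 0 < t] `*` @Omega R N m)
    (fun p : R * 'rV[R]_N => k (f p.1 p.2)).
  apply: (measurableT_comp mk); rewrite /absorbed.
  exact: (measurableT_comp measurable_absorption mv).
have := (measurable_restrictT _ mD).1 mf; apply: eq_measurable_fun => p _.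
rewrite patchE /restricted; case: ifPn => [/set_mem[/= p1 /asboolP ->]|].
  by rewrite p1/= /ind/= mul1r.
move=> np; case: (ltP 0 p.1) => p1/=; last by rewrite /ind/= mul0r.
case: asboolP => Op; last by rewrite /ind/= mul0r.
by exfalso; move/negP: np; apply; rewrite inE.
Qed.

Lemma source_restricted (k : R -> R) : measurable_fun setT k -> (forall r, 0 <= k r) ->
  source m (restricted m f k).
Proof.
move=> mk k0; split; first exact: measurable_restricted.
- by move=> p; rewrite /restricted mulr_ge0 ?ind_ge0.
- by move=> s z nz; rewrite /restricted/=; case: asboolP => // _; rewrite andbF /ind/= mul0r.
Qed.

Lemma source_pospart : source m (restricted m f (@pospart R)).
Proof.
apply: source_restricted; last by move=> r; rewrite /pospart le_max lexx orbT.
exact: measurable_maxr.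
Qed.

Lemma source_negpart : source m (restricted m f (@negpart R)).
Proof.
apply: source_restricted; last by move=> r; rewrite /negpart le_max lexx orbT.
by apply: measurable_maxr => //; exact: oppr_measurable.
Qed.

Lemma source_normr : source m (restricted m f absr).
Proof. by apply: source_restricted => //; exact: normr_measurable. Qed.

Lemma le_duhamel a b t x (k1 k2 : R -> R) : b <= t -> in_closure m x ->
  source m (restricted m f k1) -> source m (restricted m f k2) ->
  (forall r, k1 r <= k2 r) ->
  (duhamel m a b t x (restricted m f k1) <= duhamel m a b t x (restricted m f k2))%E.
Proof.
move=> bt hx s1 s2 h; apply: ge0_le_integral => //.
- by move=> s _; apply: integral_EFin_ge0 => z; exact: duhamel_integrand_ge0.
- apply: (measurable_fun_fubini_tonelli_F (fun p => (duhamel_integrand m a b t x _ p)%:E)).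
    by apply/measurable_EFinP; exact: measurable_duhamel_integrand.
  by move=> p; rewrite lee_fin duhamel_integrand_ge0.
- apply: (measurable_fun_fubini_tonelli_F (fun p => (duhamel_integrand m a b t x _ p)%:E)).
    by apply/measurable_EFinP; exact: measurable_duhamel_integrand.
  by move=> p; rewrite lee_fin duhamel_integrand_ge0.
move=> s _; apply: le_integral_EFin.
- exact: (measurableT_comp (measurable_duhamel_integrand a b t x s1) (pair1_measurable s)).
- exact: (measurableT_comp (measurable_duhamel_integrand a b t x s2) (pair1_measurable s)).
- by move=> z; exact: duhamel_integrand_ge0.
- move=> z; rewrite /duhamel_integrand /between.
  case: andP => [[h1 h2]|_]; last by rewrite !mul0r.
  rewrite !mul1r ler_wpM2l//; first by rewrite kern_ge0// subr_gt0 (lt_le_trans h2).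
  by rewrite /restricted ler_wpM2l ?ind_ge0.
Qed.

Lemma duhamel_normr t x : 0 < t -> in_closure m x ->
  (\int[leb]_(s in `]0%R, t[) \int[mu]_(y in Omega m)
     (heat_kernel m (t - s) x y * `|absorption alpha (v s y)|)%R%:E)%E =
  duhamel m 0 t t x (restricted m f absr).
Proof.
move=> t0 hx; rewrite integral_mkcond; apply: eq_integral => s _; rewrite patchE.
case: ifPn => [|ns].
  rewrite inE/= in_itv/= => /andP[s0 st]; rewrite integral_mkcond.
  apply: eq_integral => y _; rewrite patchE /duhamel_integrand /between /= s0 st.
  rewrite /restricted/= s0/=; case: ifPn => [/set_mem Oy|Oy].
    rewrite heat_kernelE ?subr_gt0//; case: asboolP => // _.
    by rewrite /ind/= !mul1r.
  rewrite kern_out ?mul0r ?mulr0//.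
  by apply: contraNnot Oy => Oy; exact: mem_set.
apply/esym; apply: integral0_eq => y _; rewrite /duhamel_integrand /between.
case: andP => [[/= s0 st]|_]; last by rewrite mul0r.
by exfalso; move/negP: ns; apply; rewrite inE/= in_itv/= s0.
Qed.

End sources.

Lemma duhamel_split_fin Phi a b t x : source m Phi -> a <= b -> b <= t ->
  in_closure m x -> (duhamel m a t t x Phi < +oo)%E ->
  exists p q, [/\ duhamel m a b t x Phi = p%:E, duhamel m b t t x Phi = q%:E &
    duhamel m a t t x Phi = (p + q)%:E].
Proof.
move=> sP ab bt hx; have abt : a <= b <= t by rewrite ab.
rewrite (duhamel_split sP abt (lexx t) hx).
have := duhamel_ge0 a sP bt hx; have := duhamel_ge0 b sP (lexx t) hx.
move: (duhamel m a b t x Phi) (duhamel m b t t x Phi) => [p| |] [q| |]//= _ _ _.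
by exists p, q.
Qed.

Lemma RintegralBB d (T : measurableType d) (nu : {measure set T -> \bar R})
    (f g k : T -> R) :
  nu.-integrable setT (EFin \o f) -> nu.-integrable setT (EFin \o g) ->
  nu.-integrable setT (EFin \o k) ->
  \int[nu]_p (f p - (g p - k p)) =
  \int[nu]_p f p - (\int[nu]_p g p - \int[nu]_p k p).
Proof.
move=> hf hg hk; have hgk : nu.-integrable setT (EFin \o (fun p => g p - k p)).
  exact: (integrableB measurableT hg hk).
by rewrite (RintegralB measurableT hf hgk) (RintegralB measurableT hg hk).
Qed.

(** The formula at tau is propagated by the heat flow for the time t - tau and subtracted from the
    formula at t. The linear parts cancel by the semigroup law, and the Duhamel parts up to tau
    cancel by [heat_duhamel]. Absolute convergence makes the contributions of both signs finite
    separately, so that the differences are meaningful. *)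
Lemma mild_restart v : mild_solution m alpha (cst 1) v -> restart v.
Proof.
move=> [/C0bu_tame tv habs hmild] tau t x /andP[tau0 taut] Ox.
have hx := Omega_in_closure Ox.
have t0 : 0 < t by exact: lt_trans taut.
have h0 : 0 < t - tau by rewrite subr_gt0.
pose f := absorbed v.
have sP := source_pospart tv; have sM := source_negpart tv; have sA := source_normr tv.
have DP0 a b s y := @duhamel_ge0 _ _ m a b s y _ sP.
have DM0 a b s y := @duhamel_ge0 _ _ m a b s y _ sM.
have Aoo s y : 0 < s -> Omega m y -> (duhamel m 0 s s y (restricted m f absr) < +oo)%E.
  by move=> s0 Oy; rewrite -duhamel_normr//; [exact: habs|exact: Omega_in_closure].
have Poo s y : 0 < s -> Omega m y -> (duhamel m 0 s s y (restricted m f (@pospart R)) < +oo)%E.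
  move=> s0 Oy; apply: le_lt_trans (Aoo s y s0 Oy).
  apply: le_duhamel => //; first exact: Omega_in_closure.
  by move=> r; rewrite /pospart ge_max normr_ge0 ler_norm.
have Moo s y : 0 < s -> Omega m y -> (duhamel m 0 s s y (restricted m f (@negpart R)) < +oo)%E.
  move=> s0 Oy; apply: le_lt_trans (Aoo s y s0 Oy).
  apply: le_duhamel => //; first exact: Omega_in_closure.
  by move=> r; rewrite /negpart ge_max normr_ge0 -[X in _ <= X]normrN ler_norm.
have vE s y : 0 < s -> Omega m y -> v s y = heat m s (cst 1) y -
   (fine (duhamel m 0 s s y (restricted m f (@pospart R))) -
    fine (duhamel m 0 s s y (restricted m f (@negpart R)))).
  move=> s0 Oy; rewrite hmild//; congr (_ - _).
  apply: (Rintegral_duhamel sP sM) => //; first exact: Omega_in_closure.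
  exact: Poo.
  exact: Moo.
have [p1 [p2 [EP1 EP2 EP]]] := duhamel_split_fin sP (ltW tau0) (ltW taut) hx (Poo t x t0 Ox).
have [q1 [q2 [EM1 EM2 EM]]] := duhamel_split_fin sM (ltW tau0) (ltW taut) hx (Moo t x t0 Ox).
rewrite (vE t x t0 Ox) EP EM.
have -> : \int[leb]_(s in `]tau, t[) heat m (t - s) (absorption alpha \o v s) x = p2 - q2.
  rewrite -[p2]/(fine p2%:E) -[q2]/(fine q2%:E) -EP2 -EM2.
  apply: (Rintegral_duhamel sP sM) => //; first exact: ltW.
    by rewrite EP2 ltry.
  by rewrite EM2 ltry.
suff -> : heat m (t - tau) (v tau) x = heat m t (cst 1) x - (p1 - q1).
  by rewrite /=; ring.
have one0 (y : 'rV[R]_N) : Omega m y -> 0 <= cst 1 y :> R by [].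
have b1 := @bounded_on_cst R N m 1.
have bh := bounded_on_heat tau0 b1 one0.
have hE : heat m t (cst 1) x = heat m (t - tau) (heat m tau (cst 1)) x.
  by rewrite (heat_semigroup h0 tau0 hx b1 one0) subrK.
rewrite hE !heatE//.
have iH := integrable_kernM h0 hx bh.
(* For one sign of the source: the real-valued Duhamel integral at tau is integrable against the
   kernel, and its heat flow is the contribution of (0, tau) observed at t. *)
have main k p : source m (restricted m f k) ->
    (forall y, Omega m y -> duhamel m 0 tau tau y (restricted m f k) < +oo)%E ->
    duhamel m 0 tau t x (restricted m f k) = p%:E ->
    mu.-integrable setT (EFin \o (fun y => kern m (t - tau) x y *
       fine (duhamel m 0 tau tau y (restricted m f k)))) /\
    \int[mu]_y (kern m (t - tau) x y * fine (duhamel m 0 tau tau y (restricted m f k)))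
      = p.
  move=> sk koo kfin.
  have E : (\int[mu]_y (kern m (t - tau) x y * fine (duhamel m 0 tau tau y
       (restricted m f k)))%:E = p%:E)%E.
    rewrite -kfin.
    have := @heat_duhamel _ _ m (t - tau) 0 tau tau x _ sk (lexx _) h0 hx.
    rewrite (_ : tau + (t - tau) = t); last by rewrite addrC subrK.
    move=> <-; apply: eq_integral => y _.
    have [Oy|Oy] := pselect (Omega m y); last by rewrite kern_out// mul0r mul0e.
    have d0 := duhamel_ge0 0 sk (lexx tau) (Omega_in_closure Oy).
    have := koo y Oy; move: d0; case: (duhamel _ _ _ _ _ _) => [r| |]//=.
  split; last by rewrite /Rintegral E.
  apply/integrableP; split.
    have md := @measurable_duhamel _ _ m 0 tau tau _ sk (lexx _).
    apply/measurable_EFinP.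
    have mfd := measurableT_comp (fine_measurable _) md.
    have mp := measurable_funM (measurable_kernr m (t - tau) x) (mfd measurableT).
    apply: eq_measurable_fun mp => y _ /=.
    by case: pselect => Oy//=; rewrite kern_out// !mul0r.
  rewrite (eq_integral (fun y => (kern m (t - tau) x y *
     fine (duhamel m 0 tau tau y (restricted m f k)))%:E)).
    by rewrite E ltry.
  move=> y _ /=; rewrite ger0_norm//.
  apply: (@kernM_ge0 _ _ _ _ _ (fun y => fine (duhamel m 0 tau tau y (restricted m f k))) y h0 hx).
  by move=> z Oz; rewrite fine_ge0// duhamel_ge0//; exact: Omega_in_closure.
have [iP <-] := main _ _ sP (fun y => Poo tau y tau0) EP1.
have [iM <-] := main _ _ sM (fun y => Moo tau y tau0) EM1.
rewrite -(RintegralBB iH iP iM).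
apply: eq_Rintegral => y _; have [Oy|Oy] := pselect (Omega m y).
  by rewrite (vE tau y tau0 Oy) mulrBr mulrBr.
by rewrite (kern_out _ _ Oy) -!mulrBr mul0r mul0r.
Qed.

(** Valid without integrability: negation swaps the positive and negative parts, and as soon as one
    of their integrals is infinite [fine] returns 0 on both sides. *)
Lemma RintegralN d (T : measurableType d) (nu : {measure set T -> \bar R}) (D : set T)
    (f : T -> R) : \int[nu]_(p in D) (- f p) = - \int[nu]_(p in D) f p.
Proof.
rewrite /Rintegral integralE [in RHS]integralE.
have -> : (fun p => (- f p)%:E)^\+%E = (fun p => (f p)%:E)^\-%E.
  by apply/funext => p; rewrite funeposE funenegE EFinN.
have -> : (fun p => (- f p)%:E)^\-%E = (fun p => (f p)%:E)^\+%E.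
  by apply/funext => p; rewrite funeposE funenegE EFinN oppeK.
move: (\int[nu]_(x in D) _^\-%E _)%E (\int[nu]_(x in D) _^\+%E _)%E.
by move=> [a| |] [b| |] //=; rewrite ?oppr0 ?opprB.
Qed.

Lemma heatN t psi x : 0 < t -> heat m t (fun y => - psi y) x = - heat m t psi x.
Proof.
by move=> t0; rewrite !heatE// -RintegralN; apply: eq_Rintegral => y _; rewrite mulrN.
Qed.

Lemma restartN w : restart w -> restart (fun t x => - w t x).
Proof.
move=> hw tau t x taut Ox; rewrite (hw tau t x taut Ox).
have /andP[tau0 tt] := taut.
rewrite heatN ?subr_gt0// opprD -RintegralN; congr (_ - _).
apply: eq_Rintegral => s; rewrite inE/= in_itv/= => /andP[_ st].
rewrite -heatN ?subr_gt0//; congr heat; apply/funext => y /=.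
by rewrite absorptionN.
Qed.

End mild_restart.

(** * Local expansion of the heat semigroup *)

Section gaussian_cube.
Context {R : realType} {N : nat}.
Variable m : nat.
Local Notation mu := (@lebesgue_row R N).
Local Notation leb := (@lebesgue_measure R).
Implicit Types (t s h r B : R) (x y z : 'rV[R]_N) (f : 'rV[R]_N -> R).

Lemma integral_gauss_row t x : 0 < t -> (\int[mu]_y (gauss_row t x y)%:E = 1)%E.
Proof.
move=> t0; rewrite /gauss_row (@integral_row_prod _ _ (fun i a => gauss t (x ord0 i - a))).
- rewrite big1// => i _; rewrite -(integral_gauss (x ord0 i) t0).
  by apply: eq_integral => a _; rewrite gauss_comm.
- by move=> i; apply: measurable_gauss2 => //; exact: measurable_funB.
- by move=> i a; exact: gauss_ge0.
Qed.

Lemma cube_ge0 r x y : 0 <= cube r x y. Proof. exact: ind_ge0. Qed.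
Lemma cube_le1 r x y : cube r x y <= 1. Proof. exact: ind_le1. Qed.

Definition flip_sign (b : bool) : R := if b then 1 else -1.

Definition flip (sg : {ffun 'I_N -> bool}) x y : 'rV[R]_N :=
  \row_i (x ord0 i + flip_sign (sg i) * (y ord0 i - x ord0 i)).

(** The even part of f about x in every coordinate at once; a second-order expansion of it contains
    neither odd terms nor mixed derivatives. *)
Definition average f x y : R :=
  (2 ^+ N)^-1 * \sum_(sg : {ffun 'I_N -> bool}) f (flip sg x y).

Lemma flipE sg x y : flip sg x y = row_affine (\row_i flip_sign (sg i))
  (\row_i (x ord0 i - flip_sign (sg i) * x ord0 i)) y.
Proof. by apply/rowP => i; rewrite !mxE; ring. Qed.

Lemma flip_signK b : flip_sign b * flip_sign b = 1.
Proof. by case: b; rewrite /flip_sign ?mulr1// mulrNN mulr1. Qed.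

Lemma normr_flip_sign b a : `|flip_sign b * a| = `|a|.
Proof. by case: b; rewrite /flip_sign ?mul1r ?mulN1r ?normrN. Qed.

Lemma gauss_row_flip sg t x y : gauss_row t x (flip sg x y) = gauss_row t x y.
Proof.
apply: eq_bigr => i _; rewrite mxE opprD addrA subrr add0r.
case: (sg i); rewrite /flip_sign ?mul1r ?mulN1r ?opprK.
  by rewrite opprB.
by rewrite gauss_comm.
Qed.

Lemma cube_flip sg r x y : cube r x (flip sg x y) = cube r x y.
Proof.
congr ind; apply: eq_forallb => i.
by rewrite mxE addrAC subrr add0r normr_flip_sign.
Qed.

Lemma measurable_flip sg x : measurable_fun [set: 'rV[R]_N] (flip sg x).
Proof.
rewrite (_ : flip sg x = row_affine (\row_i flip_sign (sg i))
  (\row_i (x ord0 i - flip_sign (sg i) * x ord0 i))).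
  exact: measurable_row_affine.
by apply/funext => y; rewrite flipE.
Qed.

Lemma integral_flip sg x (g : 'rV[R]_N -> \bar R) :
  measurable_fun [set: 'rV[R]_N] g -> (forall y, 0 <= g y)%E ->
  (\int[mu]_y g (flip sg x y) = \int[mu]_y g y)%E.
Proof.
move=> mg g0; under eq_integral do rewrite flipE.
rewrite integral_row_affine//.
  rewrite big1 ?mul1e// => i _; rewrite mxE /flip_sign.
  by case: (sg i); rewrite ?normrN normr1 invr1.
by move=> i; rewrite mxE /flip_sign; case: (sg i); rewrite ?oppr_eq0 oner_eq0.
Qed.

Definition weight t r x y := cube r x y * gauss_row t x y.

Lemma weight_ge0 t r x y : 0 <= weight t r x y.
Proof. by rewrite mulr_ge0 ?cube_ge0 ?gauss_row_ge0. Qed.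

Lemma measurable_weight t r x : measurable_fun [set: 'rV[R]_N] (weight t r x).
Proof. by apply: measurable_funM; [exact: measurable_cube|exact: measurable_gauss_row]. Qed.

Lemma integrable_weightM t r x f B : 0 < t -> measurable_fun setT (fun y => cube r x y * f y) ->
  (forall y, cube r x y != 0 -> `|f y| <= B) ->
  mu.-integrable setT (EFin \o (fun y => weight t r x y * f y)).
Proof.
move=> t0 mf hB.
have mw : measurable_fun setT (fun y => weight t r x y * f y).
  have := measurable_funM (measurable_gauss_row t x) mf; apply: eq_measurable_fun => y _ /=.
  by rewrite /weight; ring.
have ig : mu.-integrable setT (EFin \o gauss_row t x).
  apply/integrableP; split; first by apply/measurable_EFinP; exact: measurable_gauss_row.
  under eq_integral do rewrite /= ger0_norm ?gauss_row_ge0//.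
  by rewrite integral_gauss_row// ltry.
have := integrableZl measurableT `|B| ig; apply: le_integrable => //.
  exact/measurable_EFinP.
move=> y _.
change ((`|weight t r x y * f y|)%:E <= (`| `|B| * gauss_row t x y |)%:E)%E; rewrite lee_fin.
rewrite /weight -mulrA [leRHS]normrM normr_id normrM (mulrC (gauss_row _ _ _)) normrM mulrA.
rewrite ler_wpM2r//; have [->|c0] := eqVneq (cube r x y) 0.
  by rewrite normr0 mul0r.
rewrite ger0_norm ?cube_ge0//; apply: (@le_trans _ _ (1 * `|f y|)).
  by rewrite ler_wpM2r// cube_le1.
by rewrite mul1r; apply: (le_trans (hB y c0)); exact: ler_norm.
Qed.

(** Reflections about x preserve Lebesgue measure, the cube and the Gaussian. The change of
    variables is available for nonnegative functions, so the constant B is added to f first and its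
    integral is subtracted afterwards. *)
Lemma integral_weight_average t r x f B : 0 < t ->
  measurable_fun setT (fun y => cube r x y * f y) ->
  (forall y, cube r x y != 0 -> `|f y| <= B) -> 0 <= B ->
  \int[mu]_y (weight t r x y * f y) = \int[mu]_y (weight t r x y * average f x y).
Proof.
move=> t0 mf hB B0.
have mfs sg : measurable_fun setT (fun y => cube r x y * f (flip sg x y)).
  have := measurableT_comp mf (measurable_flip sg x); apply: eq_measurable_fun => y _ /=.
  by rewrite cube_flip.
have hBs sg y : cube r x y != 0 -> `|f (flip sg x y)| <= B.
  by move=> c0; apply: hB; rewrite cube_flip.
have If sg : \int[mu]_y (weight t r x y * f (flip sg x y)) = \int[mu]_y (weight t r x y * f y).
  have mw := measurable_weight t r x.
  have w0 g y : (cube r x y != 0 -> `|g y| <= B) -> 0 <= weight t r x y * (g y + B).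
    have [c0 _|c0 h] := eqVneq (cube r x y) 0; first by rewrite /weight c0 !mul0r.
    rewrite mulr_ge0 ?weight_ge0// -lerBlDr sub0r.
    by have := h isT; rewrite ler_norml => /andP[].
  have mg g : measurable_fun setT (fun y => cube r x y * g y) ->
      measurable_fun setT (fun y => weight t r x y * (g y + B)).
    move=> mcg.
    have := measurable_funM (measurable_gauss_row t x)
      (measurable_funD mcg (measurable_funM (measurable_cube r x) (measurable_cst B))).
    by apply: eq_measurable_fun => y _ /=; rewrite /weight; ring.
  have iw : mu.-integrable setT (EFin \o (fun y => weight t r x y * B)).
    apply: (@integrable_weightM _ _ _ (cst B) B) => //.
      by apply: measurable_funM => //; exact: measurable_cube.
    by move=> y _; rewrite ger0_norm.
  have E g : measurable_fun setT (fun y => cube r x y * g y) ->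
      (forall y, cube r x y != 0 -> `|g y| <= B) ->
      \int[mu]_y (weight t r x y * g y) =
      \int[mu]_y (weight t r x y * (g y + B)) - \int[mu]_y (weight t r x y * B).
    move=> mcg hg; rewrite -RintegralB//.
      by apply: eq_Rintegral => y _; rewrite mulrDr addrK.
    apply: (@integrable_weightM _ _ _ (fun y => g y + B) (B + B)) => //.
      have := (measurable_funD mcg (measurable_funM (measurable_cube r x) (measurable_cst B))).
      by apply: eq_measurable_fun => y _ /=; rewrite mulrDr.
    by move=> y c0; apply: (le_trans (ler_normD _ _)); rewrite lerD ?hg// ger0_norm.
  rewrite [LHS](E (fun y => f (flip sg x y)) (mfs sg) (hBs sg)) [RHS](E f mf hB); congr (_ - _).
  rewrite /Rintegral; congr fine.
  rewrite -[RHS](@integral_flip sg x).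
  - by apply: eq_integral => y _; rewrite /weight cube_flip gauss_row_flip.
  - by apply/measurable_EFinP; exact: mg.
  - by move=> y; rewrite lee_fin; apply: w0 => c0; exact: hB.
rewrite /average.
have -> : \int[mu]_y (weight t r x y * ((2 ^+ N)^-1 *
      \sum_(sg : {ffun 'I_N -> bool}) f (flip sg x y))) =
    (2 ^+ N)^-1 * \sum_(sg : {ffun 'I_N -> bool})
       \int[mu]_y (weight t r x y * f (flip sg x y)).
  have isg (sg : {ffun 'I_N -> bool}) :
     mu.-integrable setT (EFin \o (fun y => weight t r x y * f (flip sg x y))).
    exact: (integrable_weightM t0 (mfs sg) (hBs sg)).
  have isum : mu.-integrable setT (EFin \o
      (fun y => \sum_(sg : {ffun 'I_N -> bool}) weight t r x y * f (flip sg x y))).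
    have := @integrable_sum _ _ _ mu setT measurableT _
      (index_enum {ffun 'I_N -> bool}) xpredT
      (fun sg y => (weight t r x y * f (flip sg x y))%:E) (fun sg _ => isg sg).
    apply: eq_integrable => // y _ /=; by rewrite sumEFin.
  rewrite (_ : \sum_(_ | _) _ = \int[mu]_y \sum_(sg : {ffun 'I_N -> bool})
     weight t r x y * f (flip sg x y)).
    rewrite -RintegralZl//; apply: eq_Rintegral => y _.
    by rewrite mulrCA mulr_sumr.
  rewrite /Rintegral; under [in RHS]eq_integral do rewrite -sumEFin.
  rewrite integral_sum//.
  apply: EFin_inj; rewrite fineK; last first.
    by apply/sum_fin_numP => sg _ _; exact: (integrable_fin_num measurableT (isg sg)).
  rewrite -sumEFin; apply: eq_bigr => sg _; rewrite fineK//.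
  exact: (integrable_fin_num measurableT (isg sg)).
under eq_bigr do rewrite If.
move: (\int[mu]_y (weight t r x y * f y)) => I.
rewrite sumr_const card_ffun card_bool card_ord -(mulr_natl I) natrX mulrA mulVf ?mul1r//.
Qed.

Lemma weight_mass t r x : 0 < t -> 0 < r ->
  1 - N%:R * (4 * 128 / r ^+ 4 * t ^+ 2) <= \int[mu]_y (weight t r x y) <= 1.
Proof.
move=> t0 r0.
have E : (\int[mu]_y (weight t r x y)%:E = \prod_(i < N) \int[leb]_a
    (ind (`|a - x ord0 i| < r)%R * gauss t (a - x ord0 i))%:E)%E.
  rewrite -(@integral_row_prod _ _ (fun i a =>
     ind (`|a - x ord0 i| < r) * gauss t (a - x ord0 i))).
  - apply: eq_integral => y _; rewrite /weight cubeE /gauss_row -big_split/=.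
    by congr EFin; apply: eq_bigr => i _; rewrite gauss_comm.
  - move=> i; apply: measurable_funM; first exact: measurable_ind_ball.
    by apply: measurable_gauss2 => //; exact: measurable_funB.
  - by move=> i a; rewrite mulr_ge0 ?ind_ge0 ?gauss_ge0.
have [||h1 /andP[h2 h3]] := @prode_itv01 R N (fun i : 'I_N => \int[leb]_a
    (ind (`|a - x ord0 i| < r)%R * gauss t (a - x ord0 i))%:E)%E (4 * 128 / r ^+ 4 * t ^+ 2).
- move=> i; have /andP[_ ->] := gauss_ball_mass (x ord0 i) t0 r0.
  by rewrite integral_EFin_ge0// => a; rewrite mulr_ge0 ?ind_ge0 ?gauss_ge0.
- move=> i; have /andP[h _] := gauss_ball_mass (x ord0 i) t0 r0.
  apply: le_trans h; rewrite -EFinB lee_fin lerD2l lerN2.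
  have c0 : 0 <= 128 / r ^+ 4 * t ^+ 2.
    by rewrite mulr_ge0 ?sqr_ge0// divr_ge0// exprn_ge0// ltW.
  by rewrite -!mulrA !(mulrA _ (r ^- 4)); nra.
rewrite /Rintegral E; move: h1 h2 h3.
by case: (\prod_(i < N) _)%E => [p| |]//=; rewrite ?lee_fin// => -> _ ->.
Qed.

End gaussian_cube.
Section Rintegral_finite_sum.
Context d (T : measurableType d) (R : realType) (mu : {measure set T -> \bar R}).

Lemma Rintegral_sum (I : finType) (F : I -> T -> R) :
  (forall i, mu.-integrable setT (EFin \o F i)) ->
  mu.-integrable setT (EFin \o (fun y => \sum_i F i y)) /\
  \int[mu]_y (\sum_i F i y) = \sum_i \int[mu]_y F i y.
Proof.
move=> iF; split.
  have := @integrable_sum _ _ _ mu setT measurableT _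
    (index_enum I) xpredT (fun i y => (F i y)%:E) (fun i _ => iF i).
  by apply: eq_integrable => // y _ /=; rewrite sumEFin.
rewrite /Rintegral; under eq_integral do rewrite -sumEFin.
rewrite integral_sum//; apply: EFin_inj; rewrite fineK; last first.
  by apply/sum_fin_numP => i _ _; exact: (integrable_fin_num measurableT (iF i)).
rewrite -sumEFin; apply: eq_bigr => i _; rewrite fineK//.
exact: (integrable_fin_num measurableT (iF i)).
Qed.

Lemma integrable_lin a b (f g : T -> R) :
  mu.-integrable setT (EFin \o f) -> mu.-integrable setT (EFin \o g) ->
  mu.-integrable setT (EFin \o (fun y => a * f y + b * g y)) /\
  \int[mu]_y (a * f y + b * g y) = a * \int[mu]_y f y + b * \int[mu]_y g y.
Proof.
move=> i1 i2.
have j1 : mu.-integrable setT (EFin \o (fun y => a * f y)).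
  by have := integrableZl measurableT a i1; apply: eq_integrable => // y _ /=; rewrite EFinM.
have j2 : mu.-integrable setT (EFin \o (fun y => b * g y)).
  by have := integrableZl measurableT b i2; apply: eq_integrable => // y _ /=; rewrite EFinM.
split; last by rewrite RintegralD// !RintegralZl.
by have := integrableD measurableT j1 j2; apply: eq_integrable => // y _ /=; rewrite EFinD.
Qed.

End Rintegral_finite_sum.

(** * One-sided expansion of the heat flow at a point *)

Section heat_touching.
Context {R : realType} {N : nat}.
Variable m : nat.
Local Notation mu := (@lebesgue_row R N).
Local Notation leb := (@lebesgue_measure R).
Implicit Types (t s h r B : R) (x y z : 'rV[R]_N) (f : 'rV[R]_N -> R).

(** The first term is the mass defect of the Dirichlet kernel from [k1_ball_mass]; the second
    bounds, through [gauss_bound], the boundary term in the truncated second moment. One constant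
    covers masses and moments alike. *)
Definition defect r : R := 4 * (128 / r ^+ 4) + 2 * (384 / r ^+ 5).

Lemma quartic_ge0 r k n : 0 < r -> 0 <= n%:R / r ^+ k :> R.
Proof. by move=> r0; exact: (divr_ge0 (ler0n _ _) (exprn_ge0 _ (ltW r0))). Qed.

Lemma defect_ge0 r : 0 < r -> 0 <= defect r.
Proof.
move=> r0; have h4 := quartic_ge0 4 128 r0; have h5 := quartic_ge0 5 384 r0.
rewrite /defect; move: h4 h5; move: (128 / _) (384 / _) => p q; lra.
Qed.

Lemma gauss_second_moment_bounds t r c : 0 < t <= 1 -> 0 < r ->
  exists p, [/\ (\int[leb]_a (ind (`|a - c| < r)%R * ((a - c) ^+ 2 * gauss t (a - c)))%:E =
      (2 * t * p)%:E)%E, 0 <= p <= 1 & 1 - defect r * t ^+ 2 <= p].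
Proof.
move=> t01 r0; have /andP[t0 t1] := t01.
have mg := measurable_gauss t.
have mF : measurable_fun setT (fun w : R => ind (`|w| < r) * (w ^+ 2 * gauss t w)).
  apply: measurable_funM; first exact: measurable_ind_ball0.
  by apply: measurable_funM => //; exact: exprn_measurable.
have E : (\int[leb]_a (ind (`|a - c| < r)%R * ((a - c) ^+ 2 * gauss t (a - c)))%:E =
   \int[leb]_w (ind (`|w| < r)%R * (w ^+ 2 * gauss t w))%:E)%E.
  have := @integral_affine R 1 (- c)
    (fun w => (ind (`|w| < r)%R * (w ^+ 2 * gauss t w))%:E) (oner_neq0 _).
  rewrite normr1 invr1 mul1e => <-.
  - by apply: eq_integral => a _; rewrite mul1r.
  - exact/measurable_EFinP.
  - move=> w; rewrite lee_fin; exact: (mulr_ge0 (ind_ge0 _) (mulr_ge0 (sqr_ge0 _) (gauss_ge0 _ _))).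
have M := gauss_second_moment t0 r0.
have /andP[M1 M2] := gauss_ball_mass 0 t0 r0.
have M0 : (\int[leb]_w (ind (`|w - 0| < r)%R * gauss t (w - 0))%:E =
    \int[leb]_w (ind (`|w| < r)%R * gauss t w)%:E)%E.
  by apply: eq_integral => w _; rewrite subr0.
have gb := gauss_bound t01 r0.
have X0 : (0 <= \int[leb]_w (ind (`|w| < r)%R * (w ^+ 2 * gauss t w))%:E)%E.
  by apply: integral_EFin_ge0 => w; exact: (mulr_ge0 (ind_ge0 _) (mulr_ge0 (sqr_ge0 _) (gauss_ge0 _ _))).
rewrite E; move: M M1 M2 X0; rewrite M0.
move: (\int[leb]_w (ind (`|w| < r) * gauss t w)%:E)%E.
move: (\int[leb]_w (ind (`|w| < r) * (w ^+ 2 * gauss t w))%:E)%E.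
move=> [X| |] [Y| |] M M1 M2 X0; try by move: M1 M2 X0 M.
move: M M1 M2 X0; rewrite -?EFinB -?EFinD -?EFinM !lee_fin => -[M] M1 M2 X0.
have p2 : 0 < 2 * t by rewrite mulr_gt0.
have XE : X = 2 * t * Y - 4 * t * r * gauss t r by rewrite -M addrK.
(* Integration by parts gives the second moment as 2 t Y - 4 t r gauss(r), where Y is the truncated
   mass; dividing by 2 t gives this value. *)
exists (Y - 2 * r * gauss t r).
have g0 := gauss_ge0 t r.
have rg0 : 0 <= 2 * r * gauss t r.
  exact: (mulr_ge0 (mulr_ge0 (ler0n _ _) (ltW r0)) g0).
have pE : 2 * t * (Y - 2 * r * gauss t r) = X by rewrite XE; ring.
split; first by rewrite pE.
- apply/andP; split; last by lra.
  by rewrite -(pmulr_rge0 _ p2) pE.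
- have h1 : 2 * r * gauss t r <= 2 * (384 / r ^+ 5) * t ^+ 2.
    have -> : 2 * (384 / r ^+ 5) * t ^+ 2 = 2 * r * (384 / r ^+ 6 * t ^+ 2).
      by move: (384 : R) => k; field; rewrite gt_eqF.
    exact: (ler_wpM2l (mulr_ge0 (ler0n _ 2) (ltW r0)) gb).
  have h4 := quartic_ge0 4 128 r0; have h5 := quartic_ge0 5 384 r0.
  have t2 := sqr_ge0 t.
  have h2 : 1 - 2 * (128 / r ^+ 4) * t ^+ 2 <= Y.
    by apply: le_trans M1; rewrite (mulrA 2 128).
  have -> : defect r * t ^+ 2 =
      2 * (2 * (128 / r ^+ 4) * t ^+ 2) + 2 * (384 / r ^+ 5) * t ^+ 2.
    by rewrite /defect; move: (128 / _) (384 / _) => k4 k5; ring.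
  have : 0 <= 2 * (128 / r ^+ 4) * t ^+ 2 by rewrite mulr_ge0// mulr_ge0.
  move: h2 h1; move: (2 * (128 / _) * _) (2 * (384 / _) * _) (2 * r * _) => p q w.
  clear; lra.
Qed.

Lemma weight_second_moment t r x j : 0 < t <= 1 -> 0 < r ->
  2 * t * (1 - N%:R * (defect r * t ^+ 2)) <=
    \int[mu]_y (weight t r x y * (y ord0 j - x ord0 j) ^+ 2) <= 2 * t.
Proof.
move=> t01 r0; have /andP[t0 t1] := t01.
have p2 : 0 < 2 * t by rewrite mulr_gt0.
pose q (i : 'I_N) a : R := if i == j then (a - x ord0 i) ^+ 2 else 1.
have E : (\int[mu]_y (weight t r x y * (y ord0 j - x ord0 j) ^+ 2)%:E =
   \prod_(i < N) \int[leb]_a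
    (ind (`|a - x ord0 i| < r)%R * (q i a * gauss t (a - x ord0 i)))%:E)%E.
  rewrite -(@integral_row_prod _ _ (fun i a =>
     ind (`|a - x ord0 i| < r) * (q i a * gauss t (a - x ord0 i)))).
  - apply: eq_integral => y _; rewrite /weight cubeE /gauss_row; congr EFin.
    rewrite -mulrA [RHS]big_split/=; apply: f_equal2 => //.
    rewrite [RHS]big_split/= [LHS]mulrC; apply: f_equal2.
      by rewrite (bigD1 j)//= /q eqxx big1 ?mulr1// => i /negbTE ->.
    by apply: eq_bigr => i _; rewrite gauss_comm.
  - move=> i; apply: measurable_funM; first exact: measurable_ind_ball.
    apply: measurable_funM; last first.
      by apply: measurable_gauss2 => //; exact: measurable_funB.
    rewrite /q; case: (i == j) => //.
    by apply: measurable_funX; exact: measurable_funB.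
  - move=> i a; rewrite mulr_ge0 ?ind_ge0// mulr_ge0 ?gauss_ge0// /q.
    by case: (i == j); rewrite ?sqr_ge0.
have [p [Ep /andP[p0 p1] pd]] := gauss_second_moment_bounds (x ord0 j) t01 r0.
pose J (i : 'I_N) := (if i == j then p%:E else
  \int[leb]_a (ind (`|a - x ord0 i| < r)%R * gauss t (a - x ord0 i))%:E)%E.
have EJ : (\int[mu]_y (weight t r x y * (y ord0 j - x ord0 j) ^+ 2)%:E =
   (2 * t)%:E * \prod_(i < N) J i)%E.
  rewrite E (bigD1 j)//= [in RHS](bigD1 j)//= muleA; congr (_ * _)%E.
    by rewrite /J /q eqxx Ep EFinM.
  apply: eq_bigr => i ij; rewrite /J /q (negbTE ij); apply: eq_integral => a _.
  by rewrite mul1r.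
have [||h1 /andP[h2 h3]] := @prode_itv01 R N J (defect r * t ^+ 2).
- move=> i; rewrite /J; case: ifP => _; first by rewrite !lee_fin p0.
  have /andP[_ ->] := gauss_ball_mass (x ord0 i) t0 r0.
  by rewrite integral_EFin_ge0// => a; rewrite mulr_ge0 ?ind_ge0 ?gauss_ge0.
- move=> i; rewrite /J; case: ifP => _; first by rewrite lee_fin.
  have /andP[h _] := gauss_ball_mass (x ord0 i) t0 r0.
  apply: le_trans h; rewrite -EFinB lee_fin lerD2l lerN2 ler_wpM2r ?sqr_ge0//.
  have h4 := quartic_ge0 4 128 r0; have h5 := quartic_ge0 5 384 r0.
  rewrite /defect -mulrA; move: h4 h5; move: (128 / _) (384 / _) => k4 k5; lra.
rewrite /Rintegral EJ; move: h1 h2 h3.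
case: (\prod_(i < N) _)%E => [c| |]//=; rewrite ?lee_fin// => h1 h2 h3.
by rewrite ler_pM2l// h1/= -[leRHS]mulr1 ler_pM2l.
Qed.

(** With K the Dirichlet kernel, G the Gaussian and C the indicator of the cube: K F = C G F + (1 -
    C) K F - C (G - K) F, and in the last two terms |F| <= B. *)
Lemma masked_le (F K G C B : R) : - B <= F -> F <= B -> 0 <= K -> K <= G ->
  0 <= C -> C <= 1 ->
  K * F <= C * G * F + (B * (K + - (C * K)) + B * (C * G + - (C * K))).
Proof.
move=> b1 b2 k0 k1 c0 c1.
have p1 : 0 <= C * (G - K) * (F + B) by rewrite !mulr_ge0//; lra.
have p2 : 0 <= (1 - C) * K * (B - F) by rewrite !mulr_ge0//; lra.
nra.
Qed.

(** A may have either sign, so both bounds on W are used and the error involves |A|. *)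
Lemma mass_le (A W k : R) : W <= 1 -> 1 - k <= W -> A * W <= A + `|A| * k.
Proof.
have a1 := ler_norm (- A); rewrite normrN in a1; have a2 := ler_norm A.
move: (`|A|) a1 a2 => D a1 a2 w1 w2.
have q1 : 0 <= (D + A) * (1 - W) by rewrite mulr_ge0//; lra.
have q2 : 0 <= D * (W - (1 - k)) by rewrite mulr_ge0//; lra.
nra.
Qed.

(** As in [mass_le], c has no sign; the factor t of the error is discarded using t <= 1. *)
Lemma moment_le (c M t k : R) : 0 < t <= 1 -> 0 <= k ->
  2 * t * (1 - k) <= M -> M <= 2 * t -> c * M <= 2 * t * c + 2 * `|c| * k.
Proof.
have a1 := ler_norm (- c); rewrite normrN in a1; have a2 := ler_norm c.
move: (`|c|) a1 a2 => D a1 a2 /andP[t0 t1] k0 m1 m2.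
have q1 : 0 <= (D + c) * (2 * t - M) by rewrite mulr_ge0//; lra.
have q2 : 0 <= D * (M - 2 * t * (1 - k)) by rewrite mulr_ge0//; lra.
have q3 : 0 <= D * k * (1 - t) by rewrite mulr_ge0 ?mulr_ge0//; lra.
nra.
Qed.

Lemma cube_Omega r x y : (forall i : 'I_N, (i < m)%N -> r < x ord0 i) ->
  cube r x y != 0 -> Omega m y.
Proof.
move=> hr; rewrite /cube /ind; case: (boolP [forall _, _]) => [/forallP h _ i im|]; last by rewrite eqxx.
by have := hr i im; have := h i; rewrite ltr_norml => /andP[h1 _] h2; lra.
Qed.

(* The Gaussian weight is invariant under the reflections, so only the average of
   [f] matters, and the cube carries all but O(t^2) of the mass and of the second
   moments. *)
Lemma heat_touch t r x f A (c : 'I_N -> R) B : 0 < t <= 1 -> 0 < r ->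
  (forall i : 'I_N, (i < m)%N -> r < x ord0 i) ->
  measurable_fun (Omega m) f -> 0 <= B -> (forall y, Omega m y -> `|f y| <= B) ->
  (forall y, cube r x y != 0 ->
     average f x y <= A + \sum_j c j * (y ord0 j - x ord0 j) ^+ 2) ->
  heat m t f x <= A + 2 * t * (\sum_j c j) +
     (2 * B + `|A| + 2 * \sum_j `|c j|) * (N%:R * (defect r * t ^+ 2)).
Proof.
move=> t01 r0 hr mf B0 hB havg; have /andP[t0 t1] := t01.
have hx : in_closure m x by move=> i im; rewrite ltW// (lt_trans r0)// hr.
pose kap := N%:R * (defect r * t ^+ 2).
have kap0 : 0 <= kap by rewrite mulr_ge0// mulr_ge0 ?sqr_ge0 ?defect_ge0.
have kapE : N%:R * (4 * 128 / r ^+ 4 * t ^+ 2) <= kap.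
  rewrite ler_wpM2l// ler_wpM2r ?sqr_ge0// /defect -mulrA.
  have := quartic_ge0 5 384 r0; move: (128 / _) (384 / _) => k4 k5; lra.
have hBc y : cube r x y != 0 -> `|f y| <= B.
  by move=> /(cube_Omega hr); exact: hB.
have mcf : measurable_fun setT (fun y => cube r x y * f y).
  rewrite (_ : (fun _ => _) = (fun y => cube r x y * (f \_ (Omega m)) y)).
    apply: measurable_funM; first exact: measurable_cube.
    by apply/(measurable_restrictT _ _).1 => //; exact: measurable_Omega.
  apply/funext => y; have [->|c0] := eqVneq (cube r x y) 0; first by rewrite !mul0r.
  by rewrite patchE mem_set//; exact: cube_Omega c0.
have mc := measurable_cube r x.
have iwM := @integrable_weightM _ _ t r x.
have iw : mu.-integrable setT (EFin \o weight t r x).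
  have := iwM (cst 1) 1 t0; rewrite (_ : (fun y => weight t r x y * cst 1 y) = weight t r x).
    by apply => [|y _]; [exact: measurable_funM|rewrite normr1].
  by apply/funext => y; rewrite mulr1.
have ik := integrable_kern t0 hx.
have mck : measurable_fun setT (fun y => cube r x y * kern m t x y).
  by apply: measurable_funM => //; exact: measurable_kernr.
have ck0 y : 0 <= cube r x y * kern m t x y.
  by rewrite mulr_ge0 ?cube_ge0 ?kern_ge0.
have ick : mu.-integrable setT (EFin \o (fun y => cube r x y * kern m t x y)).
  apply: le_integrable ik => //; first exact/measurable_EFinP.
  move=> y _; change ((`|cube r x y * kern m t x y|)%:E <= (`|kern m t x y|)%:E)%E.
  rewrite lee_fin normrM ler_piMl// ger0_norm ?cube_ge0//; exact: cube_le1.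
have iwf := iwM f B t0 mcf hBc.
have [i1 e1] := integrable_lin 1 (-1) ik ick.
have [i2 e2] := integrable_lin 1 (-1) iw ick.
have [i3 e3] := integrable_lin B B i1 i2.
have [i4 e4] := integrable_lin 1 1 iwf i3.
have mcavg : measurable_fun setT (fun y => cube r x y * average f x y).
  rewrite (_ : (fun _ => _) = (fun y => \sum_(sg : {ffun 'I_N -> bool})
     (2 ^+ N)^-1 * (cube r x y * f (flip sg x y)))); last first.
    by apply/funext => y; rewrite /average mulr_sumr mulr_sumr; apply: eq_bigr => sg _; rewrite mulrCA.
  apply: measurable_sum => sg; apply: measurable_funM => //.
  have := measurableT_comp mcf (measurable_flip sg x); apply: eq_measurable_fun => y _ /=.
  by rewrite cube_flip.
have hBavg y : cube r x y != 0 -> `|average f x y| <= B.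
  move=> c0; rewrite /average normrM ger0_norm ?invr_ge0 ?exprn_ge0//.
  rewrite ler_pdivrMl ?exprn_gt0//; apply: (le_trans (ler_norm_sum _ _ _)).
  apply: (@le_trans _ _ (\sum_(sg : {ffun 'I_N -> bool}) B)).
    by apply: ler_sum => sg _; apply: hBc; rewrite cube_flip.
  by rewrite sumr_const card_ffun card_bool card_ord -(mulr_natl B) natrX.
have iwa := iwM (average f x) B t0 mcavg hBavg.
have msq j : measurable_fun setT (fun y : 'rV[R]_N => (y ord0 j - x ord0 j) ^+ 2).
  by apply: measurable_funX; apply: measurable_funB => //; exact: measurable_coord.
have iwq j : mu.-integrable setT (EFin \o (fun y => weight t r x y * (y ord0 j - x ord0 j) ^+ 2)).
  apply: (iwM _ (r ^+ 2)) => //; first exact: measurable_funM.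
  move=> y; rewrite /cube /ind; case: (boolP [forall _, _]) => [/forallP h _|]; last by rewrite eqxx.
  rewrite ger0_norm ?sqr_ge0// -real_normK ?num_real//.
  by rewrite ler_sqr ?nnegrE ?(ltW r0)//; exact: ltW (h j).
have iwcq j : mu.-integrable setT (EFin \o
     (fun y => c j * (weight t r x y * (y ord0 j - x ord0 j) ^+ 2))).
  by have := integrableZl measurableT (c j) (iwq j); apply: eq_integrable => // y _ /=; rewrite EFinM.
have [i5 e5] := Rintegral_sum iwcq.
have [i6 e6] := integrable_lin A 1 iw i5.
(* Passing from the Dirichlet kernel to the truncated Gaussian costs [B * kap] for the mass outside
   the cube and again [B * kap] for the Gaussian mass removed inside it by the images. *)
have step1 : heat m t f x <= \int[mu]_y (weight t r x y * f y) + 2 * B * kap.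
  rewrite heatE//.
  have ikf : mu.-integrable setT (EFin \o (fun y => kern m t x y * f y)).
    by apply: integrable_kernM => //; split => //; exists B.
  apply: le_trans (le_Rintegral measurableT ikf i4 _) _.
    move=> y _; rewrite !mul1r !mulN1r /weight.
    have c0 := cube_ge0 r x y; have c1 := cube_le1 r x y.
    have [Oy|Oy] := pselect (Omega m y).
      have := hB y Oy; rewrite ler_norml => /andP[b1 b2].
      have k0 := kern_ge0 y t0 hx; have k1 := kern_le_gauss y t0 hx.
      exact: masked_le.
    rewrite kern_out// !mulr0 mul0r subr0.
    have [->|c2] := eqVneq (cube r x y) 0; first by rewrite !mul0r oppr0 addr0 !mulr0 !addr0.
    by case: Oy; exact: cube_Omega c2.
  rewrite e4 e3 e2 e1 !mul1r !mulN1r lerD2l.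
  have /andP[_ w1] := weight_mass x t0 r0.
  have k1 : \int[mu]_y kern m t x y <= 1.
    have := integral_kern_le1 t0 hx; rewrite -lee_fin /Rintegral fineK//.
    exact: (integrable_fin_num measurableT ik).
  have k2 : 1 - kap <= \int[mu]_y (cube r x y * kern m t x y).
    have := kern_cube_mass t0 r0 hr; rewrite -lee_fin /Rintegral fineK; last first.
      exact: (integrable_fin_num measurableT ick).
    by apply: le_trans; rewrite lee_fin lerD2l lerN2.
  move: w1 k1 k2; move: (\int[mu]_y weight _ _ _ _) (\int[mu]_y kern _ _ _ _)
    (\int[mu]_y (cube _ _ _ * _)) => W K C w1 k1 k2.
  by clear -w1 k1 k2 B0; nra.
apply: (le_trans step1); rewrite (integral_weight_average t0 mcf hBc B0).
have step2 : \int[mu]_y (weight t r x y * average f x y) <=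
    A * \int[mu]_y weight t r x y +
    \sum_j c j * \int[mu]_y (weight t r x y * (y ord0 j - x ord0 j) ^+ 2).
  rewrite (_ : \sum_j _ = \sum_j \int[mu]_y
    (c j * (weight t r x y * (y ord0 j - x ord0 j) ^+ 2))); last first.
    by apply: eq_bigr => j _; rewrite RintegralZl.
  rewrite -e5 -[X in _ + X]mul1r -e6; apply: le_Rintegral => // y _.
  rewrite mul1r; under eq_bigr do rewrite mulrCA.
  rewrite -mulr_sumr (mulrC A) -mulrDr.
  case: (eqVneq (cube r x y) 0) => [c0|c0]; first by rewrite /weight c0 !mul0r.
  by rewrite ler_wpM2l ?weight_ge0// havg.
have step3 : A * \int[mu]_y weight t r x y <= A + `|A| * kap.
  have /andP[w0 w1] := weight_mass x t0 r0.
  move: w0 w1; move: (\int[mu]_y weight _ _ _ _) => W w0 w1.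
  have W0 : 1 - kap <= W by apply: le_trans w0; rewrite lerD2l lerN2.
  exact: mass_le.
have step4 : \sum_j c j * \int[mu]_y (weight t r x y * (y ord0 j - x ord0 j) ^+ 2) <=
   2 * t * (\sum_j c j) + 2 * (\sum_j `|c j|) * kap.
  rewrite [leRHS](_ : _ = \sum_j (2 * t * c j + 2 * `|c j| * kap)); last first.
    by rewrite big_split/= -mulr_sumr -mulr_suml -mulr_sumr.
  apply: ler_sum => j _.
  have := weight_second_moment x j t01 r0; rewrite -/kap => /andP[].
  move: (\int[mu]_y (weight t r x y * _)) => M M0 M1.
  exact: moment_le.
apply: (le_trans (lerD step2 (lexx (2 * B * kap)))).
apply: (le_trans (lerD (lerD step3 step4) (lexx (2 * B * kap)))).
by rewrite -/kap; lra.
Qed.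

End heat_touching.

(** * Continuity of the heat flow up to the boundary, and its behaviour at time 0 *)

Section heat_continuity.
Context {R : realType} {N : nat}.
Variable m : nat.
Local Notation mu := (@lebesgue_row R N).
Local Notation clO := [set x : 'rV[R]_N | in_closure m x].
Implicit Types (t s h r B : R) (x y z : 'rV[R]_N) (psi : 'rV[R]_N -> R).

Lemma heat_ge_cube t r x psi c : 0 < t -> 0 < r ->
  (forall i : 'I_N, (i < m)%N -> r < x ord0 i) -> bounded_on m psi ->
  (forall y, Omega m y -> 0 <= psi y) -> 0 <= c ->
  (forall y, cube r x y != 0 -> c <= psi y) ->
  c * (1 - N%:R * (4 * 128 / r ^+ 4 * t ^+ 2)) <= heat m t psi x.
Proof.
move=> t0 r0 hr bpsi psi0 c0 hc.
have hx : in_closure m x by move=> i im; rewrite ltW// (lt_trans r0)// hr.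
have ick : mu.-integrable setT (EFin \o (fun y => cube r x y * kern m t x y)).
  apply: le_integrable (integrable_kern t0 hx) => //.
    apply/measurable_EFinP; apply: measurable_funM; first exact: measurable_cube.
    exact: measurable_kernr.
  move=> y _; change ((`|cube r x y * kern m t x y|)%:E <= (`|kern m t x y|)%:E)%E.
  rewrite lee_fin normrM ler_piMl// ger0_norm ?cube_ge0//; exact: cube_le1.
apply: (@le_trans _ _ (c * \int[mu]_y (cube r x y * kern m t x y))).
  apply: (ler_wpM2l c0); have := kern_cube_mass t0 r0 hr.
  rewrite -lee_fin /Rintegral fineK//; exact: (integrable_fin_num measurableT ick).
rewrite heatE// -RintegralZl//; apply: le_Rintegral => //.
- by have := integrableZl measurableT c ick; apply: eq_integrable => // y _ /=; rewrite EFinM.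
- exact: integrable_kernM.
move=> y _; have [Oy|Oy] := pselect (Omega m y); last by rewrite kern_out// !(mulr0,mul0r).
have k0 := kern_ge0 y t0 hx.
case: (eqVneq (cube r x y) 0) => [->|c1]; first by rewrite mul0r mulr0 mulr_ge0// psi0.
rewrite mulrA [leRHS]mulrC; apply: ler_wpM2r => //.
apply: le_trans (hc y c1); apply: ler_piMr => //; exact: cube_le1.
Qed.

(** The kernel mass in a small cube around x tends to 1, and the part of psi outside the cube
    contributes nonnegatively. A lower estimate is enough, because the comparison argument contains
    the heat flow with a minus sign. *)
Lemma heat_initial_lower psi x0 e : continuous_on clO psi -> bounded_on m psi ->
  (forall y, Omega m y -> 0 <= psi y) -> Omega m x0 -> 0 < e ->
  exists2 d, 0 < d & forall h x, 0 < h < d -> nearby d x0 x ->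
    psi x0 - e <= heat m h psi x.
Proof.
move=> cpsi bpsi psi0 Ox e0.
have [r r0 hr] := Omega_radius Ox.
have [d1 d10 hd1] := cpsi x0 (Omega_in_closure Ox) (e / 2) (divr_gt0 e0 (ltr0n _ 2)).
(* Halved so that the cube of half-side q about any x within q of x0 stays in [Omega] and in the
   neighbourhood where psi is close to its value at x0. *)
pose q := Num.min d1 r / 2.
have m0 : 0 < Num.min d1 r by rewrite lt_min d10.
have q0 : 0 < q by rewrite divr_gt0.
have qd : 2 * q <= d1 by rewrite /q mulrCA divff// mulr1 ge_min lexx.
have qr : 2 * q <= r by rewrite /q mulrCA divff// mulr1 ge_min lexx orbT.
pose c := psi x0 - e / 2.
pose K := N%:R * (4 * 128 / q ^+ 4).
have K0 : 0 <= K by rewrite mulr_ge0// (divr_ge0 _ (exprn_ge0 _ (ltW q0)))// mulr_ge0// ler0n.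
have Kc : 0 < K * `|c| + 1 by rewrite ltr_wpDl// mulr_ge0.
pose d := Num.min q (Num.min 1 (e / 2 / (K * `|c| + 1))).
have e2 : 0 < e / 2 by rewrite divr_gt0.
exists d; first by rewrite !lt_min q0 ltr01 !divr_gt0.
move=> h x /andP[h0]; rewrite /d !lt_min => /and3P[_ h1 h2] xd.
have {}xd i : `|x ord0 i - x0 ord0 i| < q.
  by apply: (lt_le_trans (xd i)); rewrite ge_min lexx.
have hx (i : 'I_N) : (i < m)%N -> q < x ord0 i.
  move=> im; have := xd i; rewrite ltr_norml => /andP[a1 _]; have := hr i im; lra.
have cx : in_closure m x by move=> i im; rewrite ltW// (lt_trans q0)// hx.
have [c0|c0] := leP 0 c; last first.
  apply: (@le_trans _ _ 0); last exact: heat_ge0.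
  by move: c0; rewrite /c; lra.
apply: (le_trans _ (@heat_ge_cube h q x psi c h0 q0 hx bpsi psi0 c0 _)).
  have -> : c * (1 - N%:R * (4 * 128 / q ^+ 4 * h ^+ 2)) = c - K * `|c| * h * h.
    by rewrite (ger0_norm c0) /K; move: (4 * 128 / _) => k; ring.
  move: h2; rewrite ltr_pdivlMr// => h2.
  have p1 : K * `|c| * h * h <= K * `|c| * h.
    by rewrite -[leRHS]mulr1 ler_wpM2l ?(ltW h1)// mulr_ge0 ?(ltW h0)// mulr_ge0.
  have p2 : K * `|c| * h <= e / 2 by rewrite mulrDr mulr1 in h2; rewrite mulrC; lra.
  by rewrite {1}/c; lra.
move=> y; rewrite /cube /ind; case: (boolP [forall _, _]) => [/forallP hy _|]; last by rewrite eqxx.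
have yx i : `|y ord0 i - x0 ord0 i| < d1.
  have := hy i; have := xd i; rewrite !ltr_norml => /andP[a1 a2] /andP[a3 a4].
  by apply/andP; split; lra.
have cy : in_closure m y.
  move=> i im; have := hy i; rewrite ltr_norml => /andP[a1 _]; have := hx i im; lra.
have := hd1 y cy yx; rewrite ltr_norml => /andP[a1 _]; rewrite /c; lra.
Qed.

(** Since (a - y)^2 >= (a0 - y)^2 / 2 - L^2, shifting the center doubles the time, and t <= 2 t0
    doubles it again: hence 4 t0. The lower bound on t controls the normalization and the term in
    L. *)
Lemma gauss_dominated t0 a0 L : 0 < t0 -> exists2 C, 0 <= C & forall t a y : R,
  t0 / 2 <= t <= 2 * t0 -> `|a - a0| <= L ->
  gauss t (a - y) <= C * gauss (4 * t0) (a0 - y).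
Proof.
move=> p0; have q0 : 0 < 4 * t0 by rewrite mulr_gt0.
have s1 : 0 < Num.sqrt (4 * pi * (4 * t0)) by rewrite sqrtr_gt0 mulr_gt0// mulr_gt0// pi_gt0.
have s2 : 0 < Num.sqrt (4 * pi * (t0 / 2)).
  by rewrite sqrtr_gt0 mulr_gt0 ?divr_gt0// mulr_gt0// pi_gt0.
pose C1 := Num.sqrt (4 * pi * (4 * t0)) / Num.sqrt (4 * pi * (t0 / 2)).
have C10 : 0 <= C1 by rewrite divr_ge0 ?ltW.
exists (C1 * expR (L ^+ 2 / (2 * t0))); first by rewrite mulr_ge0// expR_ge0.
move=> t a y /andP[t1 t2] aa; have t00 : 0 < t by rewrite (lt_le_trans _ t1)// divr_gt0.
rewrite !gaussE//.
have -> : C1 * expR (L ^+ 2 / (2 * t0)) * ((Num.sqrt (4 * pi * (4 * t0)))^-1 *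
    expR (- (a0 - y) ^+ 2 / (4 * (4 * t0)))) =
   (Num.sqrt (4 * pi * (t0 / 2)))^-1 * expR (L ^+ 2 / (2 * t0) - (a0 - y) ^+ 2 / (16 * t0)).
  rewrite expRD /C1 (_ : - (a0 - y) ^+ 2 / (4 * (4 * t0)) = - ((a0 - y) ^+ 2 / (16 * t0))).
    by field; rewrite !gt_eqF.
  by field; rewrite gt_eqF.
apply: ler_pM; rewrite ?invr_ge0 ?sqrtr_ge0 ?expR_ge0//.
  rewrite lef_pV2 ?posrE//; last by rewrite sqrtr_gt0 mulr_gt0// mulr_gt0// pi_gt0.
  by rewrite ler_wsqrtr// ler_wpM2l// mulr_ge0// pi_ge0.
rewrite ler_expR.
have L2 : (a - a0) ^+ 2 <= L ^+ 2.
  by rewrite -(real_normK (num_real (a - a0))) ler_sqr// nnegrE (le_trans _ aa).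
have b1 : (a0 - y) ^+ 2 / 2 - L ^+ 2 <= (a - y) ^+ 2.
  have := sqr_ge0 (2 * (a - a0) + (a0 - y)); nra.
have L0 := sqr_ge0 L; move: (L ^+ 2) L0 {L2} b1 => Q Q0 b1.
rewrite mulNr lerNl opprB.
have [b2|b2] := leP 0 ((a0 - y) ^+ 2 / 2 - Q).
  apply: (@le_trans _ _ (((a0 - y) ^+ 2 / 2 - Q) / (8 * t0))).
    rewrite (_ : ((a0 - y) ^+ 2 / 2 - Q) / (8 * t0) = (a0 - y) ^+ 2 / (16 * t0) - Q / (8 * t0)).
      by rewrite lerD2l lerN2 ler_wpM2l// lef_pV2 ?posrE; lra.
    by field; rewrite gt_eqF.
  apply: ler_pM => //; first by rewrite invr_ge0; lra.
  rewrite lef_pV2 ?posrE; lra.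
apply: (@le_trans _ _ 0); last by rewrite divr_ge0 ?sqr_ge0//; lra.
rewrite subr_le0 (_ : Q / (2 * t0) = 8 * Q / (16 * t0)); last by field; rewrite gt_eqF.
by rewrite ler_wpM2r//; [rewrite invr_ge0; lra|lra].
Qed.

Lemma kern_dominated t0 x0 : 0 < t0 -> exists2 C, 0 <= C & forall t x y,
  t0 / 2 <= t <= 2 * t0 -> nearby 1 x0 x -> in_closure m x ->
  kern m t x y <= C * gauss_row (4 * t0) x0 y.
Proof.
move=> p0; have /choice[C hC] : forall i : 'I_N, exists C, 0 <= C /\ forall t a y : R,
    t0 / 2 <= t <= 2 * t0 -> `|a - x0 ord0 i| <= 1 ->
    gauss t (a - y) <= C * gauss (4 * t0) (x0 ord0 i - y).
  by move=> i; have [C C0 hC] := gauss_dominated (x0 ord0 i) 1 p0; exists C.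
exists (\prod_i C i); first by apply: prodr_ge0 => i _; have [] := hC i.
move=> t x y tt xx hx.
have t00 : 0 < t by have /andP[t1 _] := tt; rewrite (lt_le_trans _ t1)// divr_gt0.
apply: (le_trans (kern_le_gauss y t00 hx)); rewrite /gauss_row -big_split/=.
apply: ler_prod => i _; rewrite gauss_ge0/=; have [_ h] := hC i; apply: h => //.
exact: ltW (xx i).
Qed.

Lemma cvg_gauss (t : nat -> R) (w : nat -> R) (t0 w0 : R) : (forall n, 0 < t n) -> 0 < t0 ->
  t @ \oo --> t0 -> w @ \oo --> w0 -> gauss (t n) (w n) @[n --> \oo] --> gauss t0 w0.
Proof.
move=> tn p0 ct cw; rewrite gaussE//.
rewrite (_ : (fun n => gauss (t n) (w n)) = (fun n => (Num.sqrt (4 * pi * t n))^-1 *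
   expR (- w n ^+ 2 / (4 * t n)))); last by apply/funext => n; rewrite gaussE.
apply: cvgM.
  apply: cvgV; first by rewrite gt_eqF// sqrtr_gt0 mulr_gt0// mulr_gt0// pi_gt0.
  by apply: continuous_cvg; [exact: sqrt_continuous|exact: (cvgM (cvg_cst _) ct)].
apply: continuous_cvg; first exact: continuous_expR.
apply: cvgM; first by apply: cvgN; rewrite expr2; under eq_fun do rewrite expr2; exact: cvgM.
by apply: cvgV; [rewrite gt_eqF// mulr_gt0|exact: (cvgM (cvg_cst _) ct)].
Qed.

Lemma cvg_k1 b (t : nat -> R) (a : nat -> R) (t0 a0 y : R) : (forall n, 0 < t n) -> 0 < t0 ->
  t @ \oo --> t0 -> a @ \oo --> a0 -> k1 b (t n) (a n) y @[n --> \oo] --> k1 b t0 a0 y.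
Proof.
move=> tn p0 ct ca; rewrite /k1; case: b; last first.
  by apply: cvg_gauss => //; apply: cvgB => //; exact: cvg_cst.
have c1 : a n - y @[n --> \oo] --> a0 - y by exact: (cvgB ca (cvg_cst _)).
have c2 : a n + y @[n --> \oo] --> a0 + y by exact: (cvgD ca (cvg_cst _)).
exact: (cvgM (cvg_cst _) (cvgB (cvg_gauss tn p0 ct c1) (cvg_gauss tn p0 ct c2))).
Qed.

Lemma cvg_kern (t : nat -> R) (x : nat -> 'rV[R]_N) t0 x0 y : (forall n, 0 < t n) ->
  0 < t0 -> t @ \oo --> t0 -> (forall i, x n ord0 i @[n --> \oo] --> x0 ord0 i) ->
  kern m (t n) (x n) y @[n --> \oo] --> kern m t0 x0 y.
Proof.
move=> tn p0 ct cx; rewrite /kern; apply: cvg_big.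
- by move=> p; exact: mul_continuous.
- by move=> i _; exact: cvg_k1.
Qed.

(** By contradiction along a sequence, which permits dominated convergence; [kern_dominated]
    supplies a Gaussian majorant valid near (t0, x0). *)
Lemma heat_jointly_continuous psi : bounded_on m psi ->
  (forall y, Omega m y -> 0 <= psi y) ->
  jointly_continuous clO (fun t => heat m t psi).
Proof.
move=> bpsi psi0 t0 x0 p0 hx0 e e0.
apply: contrapT => /forall2NP H.
have /choice[q hq] : forall n : nat, exists q : R * 'rV[R]_N, [/\ 0 < q.1,
    in_closure m q.2, `|q.1 - t0| < n.+1%:R^-1, nearby n.+1%:R^-1 x0 q.2 &
    e <= `|heat m q.1 psi q.2 - heat m t0 psi x0|].
  move=> n; have [|] := H n.+1%:R^-1; first by case; rewrite invr_gt0.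
  move=> /existsNP[s /existsNP[y]].
  move=> /not_implyP[s0 /not_implyP[hy /not_implyP[h1 /not_implyP[h2 /negP]]]].
  by rewrite -leNgt => h3; exists (s, y).
have tq0 n : 0 < (q n).1 by have [] := hq n.
have ct : (q n).1 @[n --> \oo] --> t0.
  apply/cvgrPdist_lt => d d0; near=> n; have [_ _ h _ _] := hq n.
  rewrite distrC; apply: (lt_trans h); near: n; exact: near_infty_natSinv_lt (PosNum d0).
have cx i : (q n).2 ord0 i @[n --> \oo] --> x0 ord0 i.
  apply/cvgrPdist_lt => d d0; near=> n; have [_ _ _ h _] := hq n.
  rewrite distrC; apply: (lt_trans (h i)); near: n; exact: near_infty_natSinv_lt (PosNum d0).
have [mpsi [B hB]] := bpsi.
have [C C0 hC] := kern_dominated x0 p0.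
(* The majorant is valid only for times comparable with t0, so the first [n0] terms of the sequence
   are dropped. *)
have [n0 hn0] : exists n0, forall n, (n0 <= n)%N -> t0 / 2 <= (q n).1 <= 2 * t0.
  have [n0 _ h] : \forall n \near \oo, `|t0 - (q n).1| < t0 / 2.
    by move/cvgrPdist_lt : ct; apply; rewrite divr_gt0.
  exists n0 => n hn; have := h n hn; rewrite ltr_norml => /andP[h1 h2].
  by apply/andP; split; lra.
pose F n y := (kern m (q (n + n0)%N).1 (q (n + n0)%N).2 y * psi y)%:E.
have iG : mu.-integrable setT (fun y => (C * `|B|)%:E * (gauss_row (4 * t0) x0 y)%:E)%E.
  apply: integrableZl => //; apply/integrableP; split.
    by apply/measurable_EFinP; exact: measurable_gauss_row.
  under eq_integral do rewrite /= ger0_norm ?gauss_row_ge0//.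
  by rewrite integral_gauss_row ?mulr_gt0// ltry.
have [||||_ _ cF] := @dominated_convergence _ _ _ mu setT measurableT F
   (fun y => (kern m t0 x0 y * psi y)%:E) _ _ _ _ iG.
- by move=> n; apply/measurable_EFinP; exact: measurable_kernM.
- by apply/measurable_EFinP; exact: measurable_kernM.
- apply: aeW => y _; apply: cvg_EFin; first exact: nearW.
  apply: cvgM; last exact: cvg_cst.
  apply: cvg_kern => //.
    by have := ct; rewrite -(cvg_shiftn n0).
  by move=> i; have := cx i; rewrite -(cvg_shiftn n0).
- apply: aeW => y n _; rewrite /F abse_EFin -EFinM lee_fin normrM.
  have [_ hx _ hc _] := hq (n + n0)%N.
  have [Oy|Oy] := pselect (Omega m y); last first.
    by rewrite kern_out// normr0 mul0r !mulr_ge0// gauss_row_ge0.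
  rewrite mulrAC; apply: ler_pM => //; last by apply: (le_trans (hB y Oy)); exact: ler_norm.
  rewrite ger0_norm ?kern_ge0//; apply: hC => //; first by rewrite hn0// leq_addl.
  by move=> i; apply: (lt_le_trans (hc i)); rewrite invf_le1// ler1n.
have cE : heat m (q (n + n0)%N).1 psi (q (n + n0)%N).2 @[n --> \oo] --> heat m t0 psi x0.
  have fin t x : 0 < t -> in_closure m x ->
      (\int[mu]_y (kern m t x y * psi y)%:E)%E = (heat m t psi x)%:E.
    move=> t00 hx; rewrite heatE// /Rintegral fineK//.
    by apply: integrable_fin_num => //; exact: integrable_kernM.
  have E1 n : (heat m (q (n + n0)%N).1 psi (q (n + n0)%N).2)%:E = (\int[mu]_y F n y)%E.
    by apply/esym; apply: fin; have [] := hq (n + n0)%N.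
  have E2 := fin _ _ p0 hx0.
  have cF' : (heat m (q (n + n0)%N).1 psi (q (n + n0)%N).2)%:E @[n --> \oo] -->
      (heat m t0 psi x0)%:E.
    by rewrite -E2 (funext E1); exact: cF.
  exact: (fine_cvg cF').
have [n1 _ /(_ n1 (leqnn _))] : \forall n \near \oo,
    `|heat m t0 psi x0 - heat m (q (n + n0)%N).1 psi (q (n + n0)%N).2| < e.
  by move/cvgrPdist_lt : cE; apply.
have [_ _ _ _ h] := hq (n1 + n0)%N.
by rewrite distrC ltNge h.
Unshelve. all: by end_near. Qed.

End heat_continuity.

(** * Space-time maxima and the penalty *)

Section space_time.
Context {R : realType} {N : nat}.
Variable m : nat.
Local Notation leb := (@lebesgue_measure R).
Local Notation clO := [set x : 'rV[R]_N | in_closure m x].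
Implicit Types (a b t s h r B c e d L : R) (x y z : 'rV[R]_N) (f g : 'rV[R]_N -> R).

Lemma Rintegral_ge_cst a b (k : R -> R) c B : a < b -> measurable_fun `]a, b[ k ->
  (forall s, a < s < b -> `|k s| <= B) -> (forall s, a < s < b -> c <= k s) ->
  c * (b - a) <= \int[leb]_(s in `]a, b[) k s.
Proof.
move=> ab mk hB hc.
have mI : measurable (`]a, b[%classic : set R) by [].
have len : leb (`]a, b[%classic : set R) = (b - a)%:E.
  by rewrite lebesgue_measure_itv/= lte_fin ab.
have fin : (leb (`]a, b[%classic : set R) < +oo)%E by rewrite len ltry.
have ic (p : R) : leb.-integrable `]a, b[ (EFin \o cst p).
  apply: measurable_bounded_integrable => //.
  exact: bounded_cst.
have ik : leb.-integrable `]a, b[ (EFin \o k).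
  apply: le_integrable (ic `|B|) => //; first exact/measurable_EFinP.
  move=> s; rewrite /= in_itv/= => hs; rewrite lee_fin normr_id.
  by apply: (le_trans (hB s hs)); exact: ler_norm.
have -> : c * (b - a) = \int[leb]_(s in `]a, b[) c.
  by rewrite Rintegral_cst//; congr (_ * _); exact: (esym (congr1 fine len)).
apply: (le_Rintegral _ (ic c) ik) => // s; rewrite /= in_itv/=; exact: hc.
Qed.

Lemma average_le f g x y : (forall sg, f (flip sg x y) <= g (flip sg x y)) ->
  average f x y <= average g x y.
Proof. by move=> h; rewrite ler_wpM2l ?invr_ge0 ?exprn_ge0//; exact: ler_sum. Qed.

Lemma averageD f g x y :
  average (fun z => f z + g z) x y = average f x y + average g x y.
Proof. by rewrite /average big_split mulrDr. Qed.

Lemma averageN f x y : average (fun z => - f z) x y = - average f x y.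
Proof. by rewrite /average sumrN mulrN. Qed.

Lemma averageZ c f x y : average (fun z => c * f z) x y = c * average f x y.
Proof. by rewrite /average -mulr_sumr mulrCA. Qed.

Lemma average_cst c x y : average (cst c) x y = c.
Proof.
rewrite /average sumr_const card_ffun card_bool card_ord -(mulr_natl c) natrX mulrA.
by rewrite mulVf ?mul1r// expf_neq0// pnatr_eq0.
Qed.

Definition sqnorm x : R := \sum_i x ord0 i ^+ 2.

Definition negate_signs (sg : {ffun 'I_N -> bool}) : {ffun 'I_N -> bool} :=
  [ffun i => ~~ sg i].

(** Opposite sign patterns give the points z and 2 x - z, and |z|^2 + |2 x - z|^2 = 2 |x|^2 + 2 |z -
    x|^2 with |z - x| independent of the pattern. *)
Lemma average_sqnorm x y :
  average sqnorm x y = sqnorm x + \sum_i (y ord0 i - x ord0 i) ^+ 2.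
Proof.
have inj : injective negate_signs.
  by move=> p q /ffunP h; apply/ffunP => i; have := h i; rewrite !ffunE => /negb_inj.
have E : average sqnorm x y = average (fun z => sqnorm (x + x - z)) x y.
  rewrite /average; congr (_ * _); rewrite (reindex_inj inj); apply: eq_bigr => sg _.
  congr sqnorm; apply/rowP => i; rewrite !mxE ffunE.
  by case: (sg i); rewrite /flip_sign/=; ring.
have -> : average sqnorm x y = 2^-1 * average (fun z => sqnorm z + sqnorm (x + x - z)) x y.
  by rewrite averageD -E; field.
rewrite -[RHS](average_cst _ x y) -averageZ /average; congr (_ * _).
apply: eq_bigr => sg _; rewrite /sqnorm -!big_split/= mulr_sumr; apply: eq_bigr => i _.
rewrite !mxE; by case: (sg i); rewrite /flip_sign/=; field.
Qed.

Lemma nearby_min d1 d2 x y : nearby (Num.min d1 d2) x y -> nearby d1 x y /\ nearby d2 x y.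
Proof. by move=> h; split=> i; have := h i; rewrite lt_min => /andP[]. Qed.

Lemma jointly_continuousD (D : set 'rV[R]_N) (u v : R -> 'rV[R]_N -> R) :
  jointly_continuous D u -> jointly_continuous D v ->
  jointly_continuous D (fun t x => u t x + v t x).
Proof.
move=> cu cv t x t0 Dx e e0; have e2 : 0 < e / 2 by rewrite divr_gt0.
have [d1 d10 h1] := cu t x t0 Dx _ e2; have [d2 d20 h2] := cv t x t0 Dx _ e2.
exists (Num.min d1 d2); first by rewrite lt_min d10.
move=> s y s0 Dy; rewrite lt_min => /andP[st1 st2] /nearby_min[xy1 xy2].
rewrite opprD addrACA (splitr e) (le_lt_trans (ler_normD _ _))// ltrD//.
  exact: h1.
exact: h2.
Qed.

Lemma jointly_continuousN (D : set 'rV[R]_N) (u : R -> 'rV[R]_N -> R) :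
  jointly_continuous D u -> jointly_continuous D (fun t x => - u t x).
Proof.
move=> cu t x t0 Dx e e0; have [d d0 h] := cu t x t0 Dx e e0.
by exists d => // s y s0 Dy st xy; rewrite -opprD normrN; exact: h.
Qed.

Lemma jointly_continuous_shift (D : set 'rV[R]_N) (u : R -> 'rV[R]_N -> R) c : 0 <= c ->
  jointly_continuous D u -> jointly_continuous D (fun t => u (c + t)).
Proof.
move=> c0 cu t x t0 Dx e e0.
have [d d0 h] := cu (c + t) x (ltr_wpDl c0 t0) Dx e e0; exists d => // s y s0 Dy st xy.
by apply: h => //; [exact: ltr_wpDl|rewrite opprD addrACA subrr add0r].
Qed.

Lemma jointly_continuous_penalty (D : set 'rV[R]_N) c e :
  jointly_continuous D (fun t x => e * (sqnorm x + c * t + 1)).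
Proof.
move=> t x t0 Dx k k0.
pose S := \sum_(i < N) (2 * `|x ord0 i| + 1).
have S0 : 0 <= S by apply: sumr_ge0 => i _; rewrite addr_ge0// mulr_ge0.
have M0 : 0 < `|e| * (S + `|c|) + 1 by rewrite ltr_wpDl// mulr_ge0// addr_ge0.
exists (Num.min 1 (k / (`|e| * (S + `|c|) + 1))); first by rewrite lt_min ltr01 divr_gt0.
move=> s y s0 Dy; rewrite lt_min => /andP[_ st] xy.
set d := Num.min 1 (k / (`|e| * (S + `|c|) + 1)) in xy.
have d1 : d <= 1 by rewrite ge_min lexx.
have d2 : d <= k / (`|e| * (S + `|c|) + 1) by rewrite ge_min lexx orbT.
have d0 : 0 < d by rewrite lt_min ltr01 divr_gt0.
have q1 : `|sqnorm y - sqnorm x| <= d * S.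
  rewrite /sqnorm -sumrB (le_trans (ler_norm_sum _ _ _))// mulr_sumr; apply: ler_sum => i _.
  rewrite subr_sqr normrM; apply: ler_pM => //; first exact: ltW (xy i).
  rewrite (_ : y ord0 i + x ord0 i = (y ord0 i - x ord0 i) + 2 * x ord0 i); last by ring.
  rewrite (le_trans (ler_normD _ _))// normrM (ger0_norm (ler0n _ 2)) addrC lerD2l.
  exact: le_trans (ltW (xy i)) d1.
rewrite -mulrBr normrM.
have q2 : `|sqnorm y + c * s + 1 - (sqnorm x + c * t + 1)| <=
    k / (`|e| * (S + `|c|) + 1) * (S + `|c|).
  rewrite (_ : _ - _ = (sqnorm y - sqnorm x) + c * (s - t)); last by ring.
  apply: (le_trans (ler_normD _ _)); rewrite [leRHS]mulrDr; apply: lerD.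
    by apply: (le_trans q1); rewrite ler_wpM2r.
  by rewrite normrM mulrC ler_wpM2r// ltW.
apply: le_lt_trans (ler_wpM2l (normr_ge0 e) q2) _.
rewrite mulrCA mulrAC ltr_pdivrMr// ltr_pM2l// ltrDl//.
Qed.

Lemma jointly_continuous_max (U : R -> 'rV[R]_N -> R) a b L : 0 < a -> a <= b -> 0 <= L ->
  jointly_continuous clO U -> exists t x, [/\ a <= t <= b, in_closure m x, box L x &
    forall s y, a <= s <= b -> in_closure m y -> box L y -> U s y <= U t x].
Proof.
move=> a0 ab L0 cU.
pose K := [set` `[a, b]%R] `*` (clO `&` box L).
have cK : compact K.
  by apply: compact_setX; [exact: segment_compact|exact: compact_closure_box].
have K0 : K !=set0.
  exists (a, 0); split; first by rewrite /= in_itv/= lexx.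
  by split=> /= [i im|i]; rewrite mxE ?normr0.
have [|[t x] /set_mem[/= tI [hx Lx]] hmax] :=
    @compact_EVT_max _ R (fun p : R * 'rV[R]_N => U p.1 p.2) K K0 cK.
  apply/subspace_continuousP => -[t x] [/= tI [hx Lx]].
  move: tI; rewrite in_itv/= => /andP[t1 t2].
  apply/cvgrPdist_lt => e e0; have [d d0 hd] := cU t x (lt_le_trans a0 t1) hx e e0.
  apply/nbhs_ballP; exists d => //= -[s y] [/= st [_ xy]] [/= sI [hy Ly]].
  move: sI; rewrite in_itv/= => /andP[s1 s2].
  rewrite distrC; apply: hd => //; first exact: lt_le_trans s1.
  - by rewrite distrC.
  - by move=> i; rewrite distrC; exact: (xy ord0 i).
exists t, x; rewrite in_itv/= in tI; split => //.
move=> s y sI hy Ly; apply: (hmax (s, y)); by rewrite inE; split=> //=; rewrite in_itv.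
Qed.

(** A tube-lemma argument: by compactness of K, local lengths of an initial time interval can be
    replaced by a common one. *)
Lemma uniform_start (K : set 'rV[R]_N) (P : R -> 'rV[R]_N -> Prop) : compact K ->
  (forall x, K x -> exists2 d, 0 < d & forall t y, 0 < t < d -> nearby d x y -> P t y) ->
  exists2 d, 0 < d & forall t y, 0 < t < d -> K y -> P t y.
Proof.
move=> /compact_near_coveringP cK h.
have [|d /= d0 hd] := cK R (0 : R)^'+ P _.
  move=> x Kx; have [d d0 hd] := h x Kx.
  exists ([set y | nearby d x y], [set t | 0 < t < d]); last first.
    by move=> [y t] /= [xy tt]; exact: hd.
  split=> /=.
    apply/nbhs_ballP; exists d => //= y [_ xy] i.
    by rewrite distrC; exact: (xy ord0 i).
  exists d => //= t; rewrite /= sub0r normrN => td t0.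
  by rewrite t0/= (le_lt_trans (ler_norm _)).
exists d => // t y /andP[t0 td] Ky; apply: (hd t) => //=.
by rewrite sub0r normrN gtr0_norm.
Qed.

End space_time.

(** * The comparison principle *)

Section comparison.
Context {R : realType} {N : nat}.
Variables (m : nat) (alpha : R).
Hypothesis alpha_gt0 : 0 < alpha.
Local Notation leb := (@lebesgue_measure R).
Local Notation clO := [set x : 'rV[R]_N | in_closure m x].
Local Notation F := (absorption alpha).
Implicit Types (a b t s h r B c e d L : R) (x y z : 'rV[R]_N).
Implicit Types (u w : R -> 'rV[R]_N -> R) (psi : 'rV[R]_N -> R).

Lemma le_absorption : {homo F : p q / p <= q}.
Proof.
have pos p q : 0 <= p -> p <= q -> F p <= F q.
  move=> p0 pq; have q0 := le_trans p0 pq; rewrite /absorption !ger0_norm//.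
  by apply: ler_pM => //; [exact: powR_ge0|apply: ge0_ler_powR => //; exact: ltW].
have sgn p : 0 <= p -> 0 <= F p by move=> p0; rewrite /absorption mulr_ge0// powR_ge0.
move=> p q pq; have [p0|p0] := leP 0 p; first exact: pos.
have [q0|q0] := leP 0 q.
  apply: (@le_trans _ _ 0); last exact: sgn.
  by rewrite -[p]opprK absorptionN oppr_le0 sgn// oppr_ge0 ltW.
by rewrite -lerN2 -!absorptionN; apply: pos; rewrite ?lerN2// oppr_ge0 ltW.
Qed.

Lemma normr_absorption_le p B : `|p| <= B -> `|F p| <= F B.
Proof.
move=> pB; have -> : `|F p| = F `|p|.
  by rewrite /absorption normrM normr_id ger0_norm// powR_ge0.
exact: le_absorption.
Qed.

(* [a] and [H] stand for the time derivative and the pure second space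
   derivatives; averaging over the reflections of [y - x] removes the terms of
   odd order and the mixed second derivatives. *)
Definition parabolic_jet u t x := exists a (H : 'I_N -> R),
  a - \sum_j H j + F (u t x) = 0 /\
  forall eta, 0 < eta -> exists2 r, 0 < r & forall h y, 0 <= h < r -> nearby r x y ->
    `|average (u (t - h)) x y - u t x + h * a -
      \sum_j H j / 2 * (y ord0 j - x ord0 j) ^+ 2| <=
    eta * (h + \sum_j (y ord0 j - x ord0 j) ^+ 2).

Definition parabolic u := forall t x, 0 < t -> Omega m x -> parabolic_jet u t x.

Lemma cube_nearby r x y : cube r x y != 0 -> nearby r x y.
Proof.
by rewrite /cube /ind; case: (boolP [forall _, _]) => [/forallP//|]; rewrite eqxx.
Qed.

Lemma sum_shifted (H : 'I_N -> R) p (q : 'I_N -> R) :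
  \sum_j (H j / 2 + p) * q j = \sum_j H j / 2 * q j + p * \sum_j q j.
Proof. by rewrite mulr_sumr -big_split; apply: eq_bigr => j _; rewrite /= mulrDl. Qed.

(** Dividing by h and inserting f = S - a leaves e <= eta (2 n + 1) + (K + K') h, while each term on
    the right is at most e / 2, the last strictly. The gain e is there because the penalty grows in
    time at the rate e (2 n + 1), against its Laplacian 2 n e. *)
Lemma jet_balance (n f S a eta e h K K' D : R) : 0 < h -> f = S - a ->
  f * h - K' * h * h <= D ->
  D <= - (h * (a - eta + e * (2 * n + 1))) + 2 * h * (S / 2 + n * (eta + e)) + K * h ^+ 2 ->
  eta * (2 * n + 1) <= e / 2 -> (K + K') * h < e / 2 -> False.
Proof.
move=> h0 fE D1 D2 he hK.
have : 0 <= h * (- f + K' * h - a + eta - e * (2 * n + 1) + S + 2 * n * (eta + e) + K * h).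
  have := le_trans D1 D2; rewrite -subr_ge0; congr (_ <= _); by field.
by rewrite (pmulr_rge0 _ h0) fE; lra.
Qed.

(** [heat_touch] is applied to minus the absorption with no quadratic part, for each q; the
    resulting bound is uniform in q and is integrated over (tau, t). *)
Lemma duhamel_lower w tau t x r B c : tame m w -> 0 < tau < t -> t - tau <= 1 ->
  0 < r -> (forall i : 'I_N, (i < m)%N -> r < x ord0 i) -> 0 <= B ->
  (forall q y, tau <= q <= t -> Omega m y -> `|F (w q y)| <= B) ->
  (forall q y, tau < q < t -> cube r x y != 0 -> c <= F (w q y)) ->
  c * (t - tau) -
    (2 * B + `|c|) * (N%:R * defect r) * (t - tau) * (t - tau) <=
  \int[leb]_(q in `]tau, t[) heat m (t - q) (F \o w q) x.
Proof.
move=> tw /andP[tau0 taut] h1 r0 hr B0 hB hc.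
have hx : in_closure m x by move=> i im; rewrite ltW// (lt_trans r0)// hr.
have hF q : tau < q -> measurable_fun (Omega m) (F \o w q).
  move=> tq; apply: (measurableT_comp (@measurable_absorption R alpha)).
  by apply: tame_measurable => //; exact: lt_trans tq.
rewrite -mulrBl; apply: (Rintegral_ge_cst (B := B)) => //.
- apply: measurable_heat_slice => //; [exact: source_pospart|exact: source_negpart|exact: ltW].
- move=> q /andP[q1 q2]; apply: heat_ubound => //; first by rewrite subr_gt0.
    exact: hF.
  by move=> y Oy /=; apply: hB => //; rewrite !ltW.
move=> q /andP[q1 q2].
have tq0 : 0 < t - q by rewrite subr_gt0.
have tqh : t - q <= t - tau by rewrite lerD2l lerN2 ltW.
have tq : 0 < t - q <= 1 by rewrite tq0 (le_trans tqh).
have hBq y : Omega m y -> `|- (F \o w q) y| <= B.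
  by move=> Oy; rewrite normrN; apply: hB => //; rewrite !ltW.
have := heat_touch tq r0 hr (measurable_funN (hF q q1)) B0 hBq (c := fun=> 0) (A := - c).
rewrite heatN//.
have -> : \sum_(j < N) (0 : R) = 0 by rewrite big1.
have -> : \sum_(j < N) `|0 : R| = 0 by rewrite big1// => j _; rewrite normr0.
rewrite !mulr0 !addr0 normrN => touch.
have {}touch : - heat m (t - q) (F \o w q) x <= - c +
    (2 * B + `|c|) * (N%:R * (defect r * (t - q) ^+ 2)).
  apply: touch => y cy; rewrite big1 ?addr0; last by move=> j _; rewrite mul0r.
  rewrite -[leRHS](average_cst _ x y); apply: average_le => sg; rewrite lerN2.
  by apply: hc; [rewrite q1|rewrite cube_flip].
have Kq : (2 * B + `|c|) * (N%:R * (defect r * (t - q) ^+ 2)) <=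
    (2 * B + `|c|) * (N%:R * defect r) * (t - tau).
  rewrite -!mulrA; apply: ler_wpM2l; first by rewrite addr_ge0// mulr_ge0.
  apply: ler_wpM2l => //; apply: ler_wpM2l; first exact: defect_ge0.
  apply: le_trans tqh; rewrite expr2 ler_piMl//; last by case/andP: tq.
  exact: ltW.
by move: touch Kq; move: (heat _ _ _ _) => H; clear; lra.
Qed.

Lemma max0_lipschitz (p q : R) : `|Num.max 0 p - Num.max 0 q| <= `|p - q|.
Proof.
have := ler_norm (p - q); have := ler_norm (- (p - q)); rewrite normrN.
move: (`|p - q| : R) => D h1 h2; rewrite ler_norml.
by case: (leP 0 p) => hp; case: (leP 0 q) => hq; apply/andP; split; lra.
Qed.

(* The contradiction comes from the restarted formula on [t - h, t], expanded to
   first order in [h]. *)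
Lemma no_interior_max w u psi s t x e : restart m alpha w -> tame m w -> tame m u ->
  bounded_on m psi -> (forall y, Omega m y -> 0 <= psi y) ->
  0 < s < t -> Omega m x -> 0 < e -> parabolic_jet u t x -> u t x < w t x ->
  (forall tau y, s < tau <= t -> Omega m y ->
    w tau y - u tau y - heat m (tau - s) psi y
      - e * (sqnorm y + (2 * N%:R + 1) * (tau - s) + 1) <=
    w t x - u t x - heat m (t - s) psi x
      - e * (sqnorm x + (2 * N%:R + 1) * (t - s) + 1)) -> False.
Proof.
move=> hw tw tu bpsi psi0 /andP[s0 st] Ox e0 [a [H [aE hj]]] uw hmax.
have t0 : 0 < t by exact: lt_trans st.
have hx := Omega_in_closure Ox.
have n0 : 0 <= N%:R :> R by [].
(* The tolerance for the jet of u: its total effect [eta * (2 * N%:R + 1)] uses up half of the gain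
   e. *)
pose eta := e / (2 * (2 * N%:R + 1)).
have k0 : 0 < 2 * N%:R + 1 :> R by lra.
have eta0 : 0 < eta by rewrite divr_gt0// mulr_gt0.
have etaE : eta * (2 * N%:R + 1) = e / 2 by rewrite /eta; field; rewrite gt_eqF.
have [r1 r10 hr1] := hj eta eta0.
have [r2 r20 hr2] := Omega_radius Ox.
have [cw _ Mw] := tw.
have uw0 : 0 < w t x - u t x by rewrite subr_gt0.
have [r3 r30 hr3] := cw t x t0 hx _ uw0.
have [Bw hBw] := Mw s t s0.
have [_ [Bp hBp]] := bpsi.
pose r := Num.min r1 (Num.min r2 r3).
have r0 : 0 < r by rewrite !lt_min r10 r20.
have rr1 : r <= r1 by rewrite ge_min lexx.
have rr2 : r <= r2 by rewrite !ge_min lexx orbT.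
have rr3 : r <= r3 by rewrite !ge_min lexx !orbT.
have hr (i : 'I_N) : (i < m)%N -> r < x ord0 i by move=> im; exact: le_lt_trans rr2 (hr2 i im).
pose z1 := w t x - heat m (t - s) psi x.
(* A bound for |A| below that is valid for all steps h <= 1, so that the error constant [K] is fixed
   before h. *)
pose A0 := `|z1| + `|a - eta + e * (2 * N%:R + 1)|.
pose c j := H j / 2 + (eta + e).
pose B := `|Bw| + `|Bp|.
have B0 : 0 <= B by rewrite addr_ge0.
pose K := (2 * B + A0 + 2 * \sum_j `|c j|) * (N%:R * defect r).
pose BF := F `|Bw|.
have BF0 : 0 <= BF by rewrite (le_trans (normr_ge0 (F 0)))// normr_absorption_le// normr0.
pose K' := (2 * BF + `|F (u t x)|) * (N%:R * defect r).
have dr := defect_ge0 r0.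
have A00 : 0 <= A0 by rewrite addr_ge0.
have K0 : 0 <= K by rewrite mulr_ge0 ?mulr_ge0// addr_ge0 ?addr_ge0 ?mulr_ge0 ?sumr_ge0.
have K'0 : 0 <= K' by rewrite mulr_ge0 ?mulr_ge0// addr_ge0 ?mulr_ge0.
have KK : 0 < K + K' + 1 by lra.
(* The final division by 2 makes the inequalities strict: h < r, s < t - h, and (K + K') h < e /
   2. *)
pose h := Num.min 1 (Num.min r (Num.min (t - s) (e / 2 / (K + K' + 1)))) / 2.
have M0 : 0 < Num.min 1 (Num.min r (Num.min (t - s) (e / 2 / (K + K' + 1)))).
  by rewrite lt_min ltr01/= lt_min r0/= lt_min subr_gt0 st/= !divr_gt0.
have h0 : 0 < h by rewrite divr_gt0.
have : 2 * h <= Num.min 1 (Num.min r (Num.min (t - s) (e / 2 / (K + K' + 1)))).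
  by rewrite /h mulrCA divff// mulr1.
rewrite le_min => /andP[h1]; rewrite le_min => /andP[hr'].
rewrite le_min ler_pdivlMr// => /andP[hts hK].
pose tau := t - h.
have tauE : t - tau = h by rewrite /tau opprB addrC subrK.
have stau : s < tau by rewrite /tau; move: h0 hts; clear; lra.
have taut : tau < t by rewrite /tau gtrBl.
have tau0 : 0 < tau by exact: lt_trans stau.
have h01 : 0 < h <= 1 by rewrite h0/=; move: h0 h1; clear; lra.
have bE := bounded_on_heat (m := m) (ltac:(rewrite subr_gt0; exact: stau) : 0 < tau - s) bpsi psi0.
have bw := tame_bounded_on tw tau0.
pose f y := w tau y - heat m (tau - s) psi y.
have bf : bounded_on m f by exact: bounded_onB.
have hB y : Omega m y -> `|f y| <= B.
  move=> Oy; have hy := Omega_in_closure Oy.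
  rewrite /f (le_trans (ler_normB _ _))// lerD//.
    by apply: (le_trans (hBw tau y _ hy)); [rewrite !ltW|exact: ler_norm].
  apply: heat_ubound => //; first by rewrite subr_gt0.
    exact: bpsi.1.
  by move=> z Oz; apply: (le_trans (hBp z Oz)); exact: ler_norm.
pose D := \int[leb]_(q in `]tau, t[) heat m (t - q) (F \o w q) x.
(* The restarted formula on [t - h, t]; the semigroup law carries the heat flow of psi from tau to
   t. *)
have zE : z1 + D = heat m h f x.
  rewrite /f heatB// /z1 (hw tau t x)//; last by rewrite tau0.
  rewrite tauE -/D heat_semigroup//; last by rewrite subr_gt0.
  rewrite (_ : h + (tau - s) = t - s); last by rewrite -tauE; ring.
  by move: (heat m h (w tau) x) (heat m (t - s) psi x) => p q; ring.
pose A := z1 - h * (a - eta + e * (2 * N%:R + 1)).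
have touch := heat_touch h01 r0 hr bf.1 B0 hB (c := c) (A := A).
have {}touch : heat m h f x <= A + 2 * h * (\sum_j c j) + K * h ^+ 2.
  have avg y : cube r x y != 0 ->
      average f x y <= A + \sum_j c j * (y ord0 j - x ord0 j) ^+ 2.
    move=> cy; have ny := cube_nearby cy.
    have Of sg : Omega m (flip sg x y) by apply: (cube_Omega hr); rewrite cube_flip.
    pose C1 := z1 - u t x - e * (sqnorm x + (2 * N%:R + 1) * h).
    (* Maximality at (t, x) bounds f by u at time tau plus the penalty, up to a constant; then the
       jet of u and [average_sqnorm] expand the average. *)
    have a1 : average f x y <= average (fun z => C1 + (u tau z + e * sqnorm z)) x y.
      apply: average_le => sg; have := hmax tau (flip sg x y).
      rewrite stau (ltW taut) => /(_ isT (Of sg)).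
      rewrite /f /C1 /z1 -tauE.
      move: (w tau _) (u tau _) (heat m (tau - s) psi _) (heat m (t - s) psi x) (sqnorm _) (sqnorm _).
      by clear; move=> *; lra.
    apply: (le_trans a1); rewrite averageD average_cst averageD averageZ average_sqnorm.
    have hy1 : nearby r1 x y by move=> i; exact: lt_le_trans (ny i) rr1.
    have := hr1 h y; rewrite (ltW h0)/= => /(_ _ hy1); rewrite -/tau.
    have -> : h < r1 by move: rr1 hr' h0; clear; lra.
    move=> /(_ isT) /ler_normlP[_]; rewrite /c sum_shifted /A /C1.
    move: (average _ _ _) (\sum_j H j / 2 * _) (\sum_j _ ^+ 2) (sqnorm x) (u t x).
    by clear; move=> *; lra.
  apply: (le_trans (touch avg)); rewrite lerD2l /K -mulrA.
  have Nd : 0 <= N%:R * (defect r * h ^+ 2).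
    exact: (mulr_ge0 n0 (mulr_ge0 dr (sqr_ge0 _))).
  rewrite -(mulrA N%:R); apply: ler_wpM2r => //; rewrite lerD2r lerD2l /A.
  by rewrite (le_trans (ler_normB _ _))// lerD2l normrM gtr0_norm// ler_piMl//; have /andP[] := h01.
(* By continuity w exceeds u t x throughout the small cube and the short time step, and the
   absorption is nondecreasing. *)
have D1 : F (u t x) * h - K' * h * h <= D.
  have := @duhamel_lower w tau t x r BF (F (u t x)) tw _ _ r0 hr BF0.
  rewrite tau0 taut tauE => /(_ isT); apply; first by have /andP[] := h01.
    move=> q y /andP[q1 q2] Oy; apply: normr_absorption_le; apply: le_trans (ler_norm Bw).
    apply: hBw; last exact: Omega_in_closure.
    by rewrite q2 (le_trans (ltW stau)).
  move=> q y /andP[q1 q2] cy; apply: le_absorption.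
  have Oy := cube_Omega hr cy.
  have fn : nearby r3 x y by move=> i; apply: (lt_le_trans _ rr3); exact: cube_nearby.
  have := hr3 q y (lt_trans tau0 q1) (Omega_in_closure Oy) _ fn.
  have -> : `|q - t| < r3.
    rewrite ltr0_norm ?subr_lt0// opprB (@lt_le_trans _ _ h)//; first by rewrite -tauE ltrD2l ltrN2.
    by apply: le_trans rr3; apply: le_trans hr'; clear -h0; lra.
  by move=> /(_ isT); rewrite ltr_norml => /andP[h5 _]; clear -h5; lra.
have cE : \sum_j c j = (\sum_j H j) / 2 + N%:R * (eta + e).
  by rewrite /c big_split/= -mulr_suml sumr_const card_ord mulr_natl.
apply: (@jet_balance N%:R (F (u t x)) (\sum_j H j) a eta e h K K' D) => //.
- by move: aE; clear; lra.
- by rewrite -cE; move: touch; rewrite -zE /A; clear; lra.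
- by rewrite etaE.
- by move: hK h0 e0; clear; lra.
Qed.

Lemma box_sqnorm L y : 1 <= L -> ~ box L y -> L <= sqnorm y.
Proof.
move=> L1 /existsNP[i /negP]; rewrite -ltNge => Li; apply: (@le_trans _ _ (L ^+ 2)).
  by rewrite expr2 ler_peMl//; lra.
rewrite /sqnorm (bigD1 i)//= -[leLHS]addr0; apply: lerD; last first.
  by apply: sumr_ge0 => j _; exact: sqr_ge0.
by rewrite -(real_normK (num_real (y ord0 i))) ler_sqr ?nnegrE//; lra.
Qed.

Lemma sqnorm_ge0 y : 0 <= sqnorm y.
Proof. by apply: sumr_ge0 => i _; exact: sqr_ge0. Qed.

(* The penalty [e * (|x|^2 + (2 N + 1) (t - s) + 1)] is a strict supersolution of
   the heat equation and confines the maximum to a compact set. *)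
Lemma comparison w u s t x : restart m alpha w -> tame m w -> tame m u -> parabolic u ->
  0 < s < t -> in_closure m x ->
  w t x - u t x <= heat m (t - s) (fun y => Num.max 0 (w s y - u s y)) x.
Proof.
move=> hw tw tu pu /andP[s0 st] hx; rewrite leNgt; apply/negP.
set psi := (fun y => _) => bad.
have t0 : 0 < t by lra.
have ts : 0 < t - s by rewrite subr_gt0.
have [cw zw Mw] := tw; have [cu zu Mu] := tu.
have [Bw hBw] := Mw s t s0; have [Bu hBu] := Mu s t s0.
have psi0 y : 0 <= psi y by rewrite /psi le_max lexx.
have psiw y : w s y - u s y <= psi y by rewrite /psi le_max lexx orbT.
have bpsi : bounded_on m psi.
  have [mwu [B hB]] := bounded_onB (tame_bounded_on tw s0) (tame_bounded_on tu s0).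
  split; first by apply: measurable_maxr => //; exact: measurable_cst.
  exists B => y Oy; rewrite ger0_norm// /psi ge_max (le_trans _ (hB y Oy))//=.
  by rewrite (le_trans _ (hB y Oy))// ler_norm.
have cwu := jointly_continuousD cw (jointly_continuousN cu).
have cpsi : continuous_on clO psi.
  move=> y hy e e0; have [d d0 hd] := cwu s y s0 hy e e0; exists d => // z hz yz.
  have := hd s z s0 hz _ yz; rewrite subrr normr0 => /(_ d0).
  exact: le_lt_trans (max0_lipschitz _ _).
have Ox : Omega m x.
  apply: contrapT => nO; move: bad; rewrite zw// zu// subrr ltNge => /negP; apply.
  exact: heat_ge0.
pose k : R := 2 * N%:R + 1.
have k0 : 0 < k by rewrite ltr_wpDl// mulr_ge0.
pose delta := w t x - u t x - heat m (t - s) psi x.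
have d0 : 0 < delta by rewrite subr_gt0.
pose Q := sqnorm x + k * (t - s) + 1.
have Q0 : 0 < Q by rewrite ltr_wpDl// addr_ge0 ?sqnorm_ge0// mulr_ge0// ltW.
(* At (t, x) the penalty then removes only half of the assumed excess [delta]. *)
pose e := delta / (2 * Q).
have e0 : 0 < e by rewrite divr_gt0// mulr_gt0.
pose U tau y := w (s + tau) y - u (s + tau) y + (- heat m tau psi y +
  - (e * (sqnorm y + k * tau + 1))).
have cU : jointly_continuous clO U.
  apply: jointly_continuousD; first exact: (jointly_continuous_shift (ltW s0) cwu).
  apply: jointly_continuousD; apply: jointly_continuousN.
    exact: heat_jointly_continuous.
  exact: jointly_continuous_penalty.
have UT : U (t - s) x = delta / 2.
  rewrite /U (addrC s) subrK -/Q (_ : e * Q = delta / 2); last by rewrite /e; field; rewrite gt_eqF.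
  by rewrite /delta; field.
have UT0 : 0 < U (t - s) x by rewrite UT divr_gt0.
(* Outside the box of half-side L the penalty exceeds [e * L], which is larger than the bounds of w
   and u together. *)
pose L := (`|Bw| + `|Bu|) / e + 1.
have L1 : 1 <= L by rewrite lerDr divr_ge0 ?addr_ge0// ltW.
have heat0 tau y : 0 < tau -> in_closure m y -> 0 <= heat m tau psi y.
  by move=> tau0 hy; exact: heat_ge0.
have pen tau y : 0 < tau -> e <= e * (sqnorm y + k * tau + 1).
  move=> tau0; rewrite ler_peMr//; first exact: ltW.
  by rewrite lerDr addr_ge0 ?sqnorm_ge0// mulr_ge0// ltW.
have far tau y : 0 < tau <= t - s -> in_closure m y -> ~ box L y -> U tau y < 0.
  move=> /andP[tau0 taut] hy /(box_sqnorm L1) Ly.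
  have h1 : w (s + tau) y <= `|Bw|.
    apply: le_trans (ler_norm _) (le_trans (hBw _ y _ hy) (ler_norm _)).
    by apply/andP; split; lra.
  have h2 : - u (s + tau) y <= `|Bu|.
    apply: le_trans (ler_norm _) _; rewrite normrN.
    by apply: le_trans (hBu _ y _ hy) (ler_norm _); apply/andP; split; lra.
  have h3 : `|Bw| + `|Bu| < e * (sqnorm y + k * tau + 1).
    apply: (@lt_le_trans _ _ (e * L)); last first.
      apply: (ler_wpM2l (ltW e0)); apply: (le_trans Ly); rewrite -addrA lerDl.
    by rewrite addr_ge0// mulr_ge0// ltW.
    by rewrite /L mulrDr mulr1 mulrCA divff ?mulr1 ?gt_eqF// ltrDl.
  have := heat0 tau y tau0 hy; move: h1 h2 h3; rewrite /U; clear; lra.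
(* Near time s the function U is negative. In [Omega] the heat flow starts from [psi], which is at
   least w s - u s; at boundary points w and u vanish. In both cases the penalty leaves a margin of
   at least e, hence the tolerances e / 4. *)
have [d d00 hd] : exists2 d, 0 < d & forall tau y, 0 < tau < d -> (clO `&` box L) y ->
    in_closure m y -> U tau y < 0.
  apply: uniform_start; first exact: compact_closure_box.
  move=> x0 [/= hx0 _]; have e4 : 0 < e / 4 by rewrite divr_gt0.
  have [d2 d20 hd2] := cwu s x0 s0 hx0 _ e4.
  have close2 tau y : 0 < tau < d2 -> in_closure m y -> nearby d2 x0 y ->
      w (s + tau) y - u (s + tau) y < w s x0 - u s x0 + e / 4.
    move=> /andP[tau0 taud] hy xy; have := hd2 (s + tau) y (addr_gt0 s0 tau0) hy _ xy.
    rewrite addrAC subrr add0r gtr0_norm// => /(_ taud).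
    by rewrite ltr_norml => /andP[_]; lra.
  have [Ox0|nOx0] := pselect (Omega m x0).
    have [d1 d10 hd1] := heat_initial_lower cpsi bpsi (fun y _ => psi0 y) Ox0 e4.
    exists (Num.min d1 d2); first by rewrite lt_min d10.
    move=> tau y; rewrite lt_min => /andP[tau0 /andP[td1 td2]] /nearby_min[xy1 xy2] hy.
    have := close2 tau y _ hy xy2; rewrite tau0 => /(_ td2).
    have := hd1 tau y _ xy1; rewrite tau0 => /(_ td1).
    have := pen tau y tau0; have := psiw x0; rewrite /U; move: e0; clear; lra.
  exists d2 => // tau y taud xy hy; have := close2 tau y taud hy xy.
  have /andP[tau0 _] := taud; have := pen tau y tau0; have := heat0 tau y tau0 hy.
  rewrite (zw s x0)// (zu s x0)// /U; move: e0; clear; lra.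
(* U is negative before time [a], so its positive maximum is sought on the compact interval
   [a, t - s], which never touches the initial time. *)
pose a := Num.min (d / 2) (t - s).
have a0 : 0 < a by rewrite lt_min ts divr_gt0.
have ad : a < d by rewrite (@le_lt_trans _ _ (d / 2))//; [rewrite ge_min lexx|lra].
have aT : a <= t - s by rewrite ge_min lexx orbT.
have [t1 [x1 [/andP[t1a t1T] hx1 Lx1 hmax]]] :=
  jointly_continuous_max a0 aT (le_trans ler01 L1) cU.
have bx : box L x.
  by apply: contrapT => /(far (t - s) x _ hx); rewrite ts lexx => /(_ isT); rewrite ltNge ltW.
have U10 : 0 < U t1 x1.
  by apply: lt_le_trans UT0 _; apply: hmax => //; rewrite aT lexx.
have t10 : 0 < t1 by apply: lt_le_trans t1a.
have hmax' tau y : 0 < tau <= t - s -> in_closure m y -> U tau y <= U t1 x1.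
  move=> tT hy; have [by_|nb] := pselect (box L y); last first.
    by apply/ltW/(lt_trans _ U10); exact: far.
  have [ta|ta] := ltP tau a; last by apply: hmax => //; rewrite ta; case/andP: tT.
  apply/ltW/(lt_trans _ U10); apply: hd => //.
  by case/andP: tT => -> _ /=; exact: lt_trans ad.
have pen1 := pen t1 x1 t10; have heat1 := heat0 t1 x1 t10 hx1.
have Ox1 : Omega m x1.
  apply: contrapT => nO; have p0 := addr_gt0 s0 t10.
  by move: U10; rewrite /U (zw (s + t1) x1)// (zu (s + t1) x1)//; move: e0 pen1 heat1; clear; lra.
have st1 : 0 < s < s + t1 by rewrite s0 ltrDl.
apply: (@no_interior_max w u psi s (s + t1) x1 e hw tw tu bpsi (fun y _ => psi0 y) st1 Ox1 e0).
- by apply: pu => //; exact: addr_gt0.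
- by move: U10 e0 pen1 heat1; rewrite /U; clear; lra.
move=> tau y /andP[stau taut] Oy.
have := hmax' (tau - s) y _ (Omega_in_closure Oy).
rewrite /U (addrC s (tau - s)) subrK (addrC s t1) addrK -/k.
have -> : 0 < tau - s <= t - s.
  by move: stau taut t1T; clear; move=> *; apply/andP; split; lra.
by move=> /(_ isT); clear; lra.
Qed.

End comparison.

(** * Classical solutions *)

Section jets.
Context {R : realType} {N : nat}.
Variables (m : nat) (alpha : R).
Local Notation F := (absorption alpha).
Implicit Types (a b t s h r c e d H : R) (x y z v : 'rV[R]_N) (f : 'rV[R]_N -> R).
Implicit Types (u : R -> 'rV[R]_N -> R).

Lemma is_derive_line f z v (q : R) : derivable f (z + q *: v) v ->
  is_derive q 1 (fun p : R => f (z + p *: v)) ('D_v f (z + q *: v)).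
Proof.
move=> df.
have E : (fun h : R => h^-1 *: (((fun p : R => f (z + p *: v)) \o shift q) (h *: 1) -
      f (z + q *: v))) =
    (fun h : R => h^-1 *: ((f \o shift (z + q *: v)) (h *: v) - f (z + q *: v))).
  apply/funext => h /=; congr (_ *: (f _ - _)).
  by rewrite [h *: 1]mulr1 scalerDl addrCA.
apply: DeriveDef; first by rewrite /derivable E.
by rewrite /derive E.
Qed.

Lemma second_difference_le (phi dphi ddphi : R -> R) (w H e : R) : 0 <= w ->
  (forall q : R, `|q| <= w -> is_derive q 1 phi (dphi q)) ->
  (forall q : R, `|q| <= w -> is_derive q 1 dphi (ddphi q)) ->
  (forall q : R, `|q| <= w -> ddphi q <= H + e) ->
  phi w + phi (- w) - 2 * phi 0 <= (H + e) * w ^+ 2.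
Proof.
move=> w0 d1 d2 hH.
have [->|wn0] := eqVneq w 0; first by rewrite oppr0 expr0n/= mulr0; lra.
have wp : 0 < w by rewrite lt_neqAle eq_sym wn0.
pose G p := phi p + phi (- p) - (H + e) * p ^+ 2.
have dG (q : R) : `|q| <= w -> is_derive q 1 G (dphi q - dphi (- q) - (H + e) * (2 * q)).
  move=> qw; have i1 := d1 q qw.
  have i2 : is_derive (- q) 1 phi (dphi (- q)) by apply: d1; rewrite normrN.
  have i3 : is_derive q 1 (phi \o -%R) (- dphi (- q)).
    have iN : is_derive q (1 : R) (-%R : R -> R) (-1).
      exact: (@is_deriveN _ _ _ id q 1 1 (is_derive_id q 1)).
    have := @is_derive1_comp R phi (-%R : R -> R) q _ _ i2 iN.
    by rewrite mulrN1.
  rewrite /G; apply: is_derive_eq.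
  by rewrite /GRing.scale/=; ring.
have cont (g dg : R -> R) a b : - w <= a -> b <= w ->
    (forall q : R, `|q| <= w -> is_derive q 1 g (dg q)) -> {within `[a, b], continuous g}.
  move=> wa bw hg; apply: derivable_within_continuous => q; rewrite in_itv/= => /andP[q1 q2].
  have qw : `|q| <= w by rewrite ler_norml (le_trans wa q1) (le_trans q2 bw).
  by have := hg q qw.
have in_w a b q : - w <= a -> b <= w -> q \in `]a, b[ -> `|q| <= w.
  rewrite in_itv/= => wa bw /andP[q1 q2].
  by rewrite ler_norml (le_trans wa (ltW q1)) (le_trans (ltW q2) bw).
have w0' : - w <= 0 by rewrite oppr_le0.
have [p pI] := @MVT R G _ 0 w wp (fun q hq => dG q (in_w 0 w q w0' (lexx w) hq))
  (cont G _ 0 w w0' (lexx w) dG).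
have pw := in_w 0 w p w0' (lexx w) pI.
move: pI; rewrite in_itv/= => /andP[p0 p1].
have Np : - p < p by rewrite gtrN.
have p1' : p <= w by exact: ltW.
have p2' : - w <= - p by rewrite lerN2.
have [c cI] := @MVT R dphi _ (- p) p Np (fun q hq => d2 q (in_w (- p) p q p2' p1' hq))
  (cont dphi _ (- p) p p2' p1' d2).
have cw := in_w (- p) p c p2' p1' cI.
move=> E2; rewrite E2 => E1.
have := hH c cw => hc.
have : (ddphi c * (p - - p) - (H + e) * (2 * p)) * (w - 0) <= 0.
  rewrite subr0; apply: mulr_le0_ge0 => //.
  rewrite opprK (_ : _ - _ = (ddphi c - (H + e)) * (2 * p)); last by ring.
  by apply: mulr_le0_ge0; [rewrite subr_le0|rewrite mulr_ge0// ltW].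
by rewrite -E1 /G oppr0 expr0n/= mulr0; clear; lra.
Qed.

Lemma second_difference (phi dphi ddphi : R -> R) (w H e : R) :
  (forall q : R, `|q| <= `|w| -> is_derive q 1 phi (dphi q)) ->
  (forall q : R, `|q| <= `|w| -> is_derive q 1 dphi (ddphi q)) ->
  (forall q : R, `|q| <= `|w| -> `|ddphi q - H| <= e) ->
  `|phi w + phi (- w) - 2 * phi 0 - H * w ^+ 2| <= e * w ^+ 2.
Proof.
move=> d1 d2 hH.
have sym : phi w + phi (- w) = phi `|w| + phi (- `|w|).
  by case: (leP 0 w) => w0; [rewrite ger0_norm|rewrite ltr0_norm// opprK addrC].
rewrite sym -(real_normK (num_real w)).
move: (normr_ge0 w) d1 d2 hH; move: `|w| => p p0 d1 d2 hH.
have up := second_difference_le p0 d1 d2 (H := H) (e := e).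
have lo := @second_difference_le (fun q => - phi q) (fun q => - dphi q)
  (fun q => - ddphi q) p (- H) e p0.
rewrite ler_norml; apply/andP; split.
  have : - phi p + - phi (- p) - 2 * - phi 0 <= (- H + e) * p ^+ 2.
    apply: lo => q qp.
    - by have i1 := d1 q qp; apply: is_derive_eq.
    - by have i1 := d2 q qp; apply: is_derive_eq.
    - by have := hH q qp; rewrite ler_norml => /andP[? _]; lra.
  by clear; nra.
have : phi p + phi (- p) - 2 * phi 0 <= (H + e) * p ^+ 2.
  by apply: up => q qp; have := hH q qp; rewrite ler_norml => /andP[_ ?]; lra.
by clear; nra.
Qed.

Lemma second_difference_row f z (i : 'I_N) (w H e : R) :
  let v : 'rV[R]_N := delta_mx ord0 i in
  (forall q : R, `|q| <= `|w| -> [/\ derivable f (z + q *: v) v,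
     derivable (partial i f) (z + q *: v) v &
     `|partial i (partial i f) (z + q *: v) - H| <= e]) ->
  `|f (z + w *: v) + f (z - w *: v) - 2 * f z - H * w ^+ 2| <= e * w ^+ 2.
Proof.
move=> v h.
have d1 (q : R) : `|q| <= `|w| ->
    is_derive q 1 (fun p : R => f (z + p *: v)) (partial i f (z + q *: v)).
  by move=> qw; have [h1 _ _] := h q qw; exact: is_derive_line.
have d2 (q : R) : `|q| <= `|w| -> is_derive q 1 (fun p : R => partial i f (z + p *: v))
    (partial i (partial i f) (z + q *: v)).
  by move=> qw; have [_ h2 _] := h q qw; exact: is_derive_line.
have d3 (q : R) : `|q| <= `|w| -> `|partial i (partial i f) (z + q *: v) - H| <= e.
  by move=> qw; have [_ _ h3] := h q qw.
by have := second_difference d1 d2 d3; rewrite scaleNr scale0r addr0.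
Qed.

(* Reflecting one coordinate after the other makes the averaged increment a sum
   of one-dimensional second differences. *)
Definition partial_flip (k : nat) (sg : {ffun 'I_N -> bool}) x y : 'rV[R]_N :=
  \row_i (if (i < k)%N then x ord0 i + flip_sign (sg i) * (y ord0 i - x ord0 i)
          else x ord0 i).

Definition partial_average k f x y : R :=
  (2 ^+ N)^-1 * \sum_(sg : {ffun 'I_N -> bool}) f (partial_flip k sg x y).

Definition toggle (k : 'I_N) (sg : {ffun 'I_N -> bool}) : {ffun 'I_N -> bool} :=
  [ffun i => if i == k then ~~ sg i else sg i].

Lemma toggle_inj k : injective (toggle k).
Proof.
move=> p q /ffunP h; apply/ffunP => i; have := h i; rewrite !ffunE.
by case: (i == k) => // /negb_inj.
Qed.

Lemma partial_flipS (k : 'I_N) sg x y : partial_flip k.+1 sg x y =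
  partial_flip k sg x y +
    (flip_sign (sg k) * (y ord0 k - x ord0 k)) *: delta_mx ord0 k.
Proof.
apply/rowP => i; rewrite !mxE eqxx/= ltnS leq_eqVlt.
have [->|ik] := eqVneq i k; first by rewrite eqxx ltnn/= mulr1.
by rewrite (_ : (i == k :> nat) = false) ?mulr0 ?addr0//; apply/negbTE.
Qed.

Lemma partial_flip_toggle (k : 'I_N) sg x y : partial_flip k.+1 (toggle k sg) x y =
  partial_flip k sg x y -
    (flip_sign (sg k) * (y ord0 k - x ord0 k)) *: delta_mx ord0 k.
Proof.
rewrite partial_flipS ffunE eqxx; congr (_ + _).
  apply/rowP => i; rewrite !mxE ffunE; case: ifP => // ik.
  by rewrite (_ : (i == k) = false)//; apply: contraTF ik => /eqP ->; rewrite ltnn.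
by rewrite -scaleNr; congr (_ *: _); case: (sg k); rewrite /flip_sign/=; ring.
Qed.

Lemma partial_average_le f x y r (H : 'I_N -> R) e k : (k <= N)%N ->
  nearby r x y ->
  (forall z i, nearby r x z -> [/\ derivable f z (delta_mx ord0 i),
     derivable (partial i f) z (delta_mx ord0 i) &
     `|partial i (partial i f) z - H i| <= e]) ->
  `|partial_average k f x y - f x -
     \sum_(j < N | (j < k)%N) H j / 2 * (y ord0 j - x ord0 j) ^+ 2| <=
   e / 2 * \sum_(j < N | (j < k)%N) (y ord0 j - x ord0 j) ^+ 2.
Proof.
move=> + xy hf; elim: k => [_|k ih kN].
  have -> : partial_average 0 f x y = f x.
    rewrite -[RHS](average_cst _ x y); congr (_ * _); apply: eq_bigr => sg _ /=.
    by congr f; apply/rowP => i; rewrite mxE.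
  by rewrite !big_pred0// mulr0 subrr subr0 normr0.
have {}ih := ih (ltnW kN).
pose K := Ordinal kN; pose w := y ord0 K - x ord0 K.
have split (g : 'I_N -> R) : \sum_(j < N | (j < k.+1)%N) g j =
    \sum_(j < N | (j < k)%N) g j + g K.
  rewrite (bigD1 K)//= addrC; congr (_ + _); apply: eq_bigl => j.
  rewrite ltnS leq_eqVlt -val_eqE/=; case: (ltngtP j k) => //.
pose P sg := partial_flip k sg x y.
have near_line sg (q : R) : `|q| <= `|w| -> nearby r x (P sg + q *: delta_mx ord0 K).
  move=> qw i; have [->|iK] := eqVneq i K.
    rewrite !mxE /= ltnn !eqxx/= mulr1 addrAC subrr add0r.
    exact: le_lt_trans (xy K).
  rewrite !mxE eqxx/= (negbTE iK) mulr0 addr0; case: ifP => _.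
    by rewrite addrAC subrr add0r normr_flip_sign.
  by rewrite subrr normr0 (le_lt_trans _ (xy K)).
(* The sum over sign patterns is written twice, as it stands and after toggling the sign at K; half
   the total pairs the two reflections into a symmetric second difference. *)
have E : partial_average k.+1 f x y - partial_average k f x y =
   (2 ^+ N)^-1 * \sum_(sg : {ffun 'I_N -> bool}) (2^-1 *
     (f (P sg + (flip_sign (sg K) * w) *: delta_mx ord0 K) +
      f (P sg - (flip_sign (sg K) * w) *: delta_mx ord0 K) - 2 * f (P sg))).
  rewrite /partial_average -mulrBr; congr (_ * _).
  rewrite -mulr_sumr sumrB big_split/= -mulr_sumr.
  have <- : \sum_(sg : {ffun 'I_N -> bool}) f (partial_flip k.+1 sg x y) =
      \sum_(sg : {ffun 'I_N -> bool}) f (P sg + (flip_sign (sg K) * w) *: delta_mx ord0 K).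
    by apply: eq_bigr => sg _; rewrite (partial_flipS K).
  have <- : \sum_(sg : {ffun 'I_N -> bool}) f (partial_flip k.+1 sg x y) =
      \sum_(sg : {ffun 'I_N -> bool}) f (P sg - (flip_sign (sg K) * w) *: delta_mx ord0 K).
    rewrite (reindex_inj (@toggle_inj K)); apply: eq_bigr => sg _.
    by rewrite (partial_flip_toggle K).
  by move: (\sum_(_ | _) _) (\sum_(_ | _) _) => p q; field.
have step : `|partial_average k.+1 f x y - partial_average k f x y - H K / 2 * w ^+ 2| <=
    e / 2 * w ^+ 2.
  rewrite E -(average_cst (H K / 2 * w ^+ 2) x y) /average -mulrBr -sumrB.
  rewrite normrM ger0_norm ?invr_ge0 ?exprn_ge0//.
  rewrite -[leRHS](average_cst _ x y) /average; apply: ler_wpM2l; first by rewrite invr_ge0 exprn_ge0.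
  apply: (le_trans (ler_norm_sum _ _ _)); apply: ler_sum => sg _ /=.
  have := @second_difference_row f (P sg) K (flip_sign (sg K) * w) (H K) e.
  rewrite exprMn expr2 flip_signK mul1r normr_flip_sign => sd.
  have {}sd := sd (fun q qw => hf _ K (near_line sg q qw)).
  rewrite (_ : 2^-1 * _ - _ = 2^-1 * (f (P sg + (flip_sign (sg K) * w) *: delta_mx ord0 K) +
      f (P sg - (flip_sign (sg K) * w) *: delta_mx ord0 K) - 2 * f (P sg) - H K * w ^+ 2)).
    have -> : e / 2 * w ^+ 2 = 2^-1 * (e * w ^+ 2) by field.
    by rewrite normrM ger0_norm ?invr_ge0// ler_wpM2l ?invr_ge0.
  by move: (f _) (f _) (f _) => *; field.
rewrite !split mulrDr.
rewrite (_ : partial_average k.+1 f x y - f x - _ =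
  (partial_average k f x y - f x - \sum_(j < N | (j < k)%N) H j / 2 * (y ord0 j - x ord0 j) ^+ 2) +
  (partial_average k.+1 f x y - partial_average k f x y - H K / 2 * w ^+ 2)).
  by apply: (le_trans (ler_normD _ _)); exact: lerD.
rewrite -/w; move: (\sum_(_ | _) _) => *; ring.
Qed.

Lemma average_second_order f x y r (H : 'I_N -> R) e : nearby r x y ->
  (forall z i, nearby r x z -> [/\ derivable f z (delta_mx ord0 i),
     derivable (partial i f) z (delta_mx ord0 i) &
     `|partial i (partial i f) z - H i| <= e]) ->
  `|average f x y - f x - \sum_j H j / 2 * (y ord0 j - x ord0 j) ^+ 2| <=
   e / 2 * \sum_j (y ord0 j - x ord0 j) ^+ 2.
Proof.
move=> xy hf; have := partial_average_le (leqnn N) xy hf.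
have -> : partial_average N f x y = average f x y.
  congr (_ * _); apply: eq_bigr => sg _; congr f; apply/rowP => i.
  by rewrite !mxE ltn_ord.
have E (g : 'I_N -> R) : \sum_(j < N | (j < N)%N) g j = \sum_j g j.
  by apply: eq_bigl => j; rewrite ltn_ord.
by rewrite !E.
Qed.

Lemma time_expansion (g : R -> R) t e : derivable g t 1 -> 0 < e ->
  exists2 r, 0 < r & forall h, 0 <= h < r -> `|g (t - h) - g t + h * derive1 g t| <= e * h.
Proof.
move=> dg e0.
have /cvgrPdist_le/(_ e e0)[r /= r0 hr] : h^-1 *: (g (h *: 1 + t) - g t) @[h --> 0^'] --> 'D_1 g t.
  exact: dg.
exists r => // h /andP[h0 hr']; have [->|hn0] := eqVneq h 0.
  by rewrite subr0 subrr mul0r add0r normr0 mulr0.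
have := hr (- h); rewrite /ball_/= sub0r opprK ger0_norm// oppr_eq0 => /(_ hr' hn0).
rewrite -derive1E [(- h) *: 1]mulr1 (addrC (- h)) => hh.
rewrite (_ : g (t - h) - g t + h * derive1 g t =
   (derive1 g t - (- h)^-1 *: (g (t - h) - g t)) * h).
  by rewrite normrM (ger0_norm h0) ler_wpM2r.
rewrite /GRing.scale/= invrN; field.
by [].
Qed.

(** The spatial expansion is made at time t - h, but joint continuity of the second derivatives lets
    its coefficients be taken at (t, x). In time a first-order expansion at x alone suffices. *)
Lemma classical_parabolic u : classical_solution m alpha u -> parabolic m alpha u.
Proof.
move=> [reg pde] t x t0 Ox.
exists (derive1 (u ^~ x) t), (fun j => partial j (partial j (u t)) x).
split; first exact: pde.
move=> eta eta0; have [dt _ _ _] := reg t x t0 Ox.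
have [r1 r10 hr1] := time_expansion dt eta0.
have [r2 r20 hr2] : exists2 r, 0 < r & forall i h, 0 < h <= r -> forall s z,
    `|s - t| < h -> nearby h x z ->
    `|partial i (partial i (u s)) z - partial i (partial i (u t)) x| < eta.
  apply: common_radius => i; have [_ _ _ /(_ i i)[_ ci]] := reg t x t0 Ox.
  move/cvgrPdist_lt : ci => /(_ eta eta0) /nbhs_ballP[r /= r0 hr].
  exists r => // h /andP[h0 hr'] s z st xz; rewrite distrC.
  apply: (hr (s, z)); split => /=.
    by rewrite /ball/= distrC (lt_le_trans st).
  split => // i0 j; rewrite /ball/= !ord1 distrC; exact: lt_le_trans (xz j) hr'.
have [r3 r30 hr3] := Omega_radius Ox.
pose r := Num.min r1 (Num.min r2 (Num.min r3 t)).
have r0 : 0 < r by rewrite lt_min r10/= lt_min r20/= lt_min r30.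
have rr1 : r <= r1 by rewrite ge_min lexx.
have rr2 : r <= r2 by rewrite /r !ge_min lexx orbT.
have rr3 : r <= r3 by rewrite /r !ge_min lexx !orbT.
have rrt : r <= t by rewrite /r !ge_min lexx !orbT.
exists r => // h y /andP[h0 hr] xy.
have th0 : 0 < t - h by rewrite subr_gt0 (lt_le_trans hr).
have Oz z : nearby r x z -> Omega m z.
  move=> xz i im; have := xz i; have := hr3 i im; rewrite ltr_norml => + /andP[+ _].
  by move: rr3; clear; lra.
have so := @average_second_order (u (t - h)) x y r
  (fun j => partial j (partial j (u t)) x) eta xy.
have {}so := so _.
have time := hr1 h; rewrite h0 (lt_le_trans hr rr1) in time; have {}time := time isT.
(* The increment is split at (t - h, x): first along time at the fixed point x, then along space at
   the fixed time t - h. *)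
rewrite mulrDr (_ : _ - _ = (u (t - h) x - u t x + h * derive1 (u ^~ x) t) +
  (average (u (t - h)) x y - u (t - h) x -
   \sum_j partial j (partial j (u t)) x / 2 * (y ord0 j - x ord0 j) ^+ 2)); last first.
  by move: (average _ _ _) (\sum_j _) => *; ring.
apply: (le_trans (ler_normD _ _)); apply: lerD => //.
apply: (@le_trans _ _ (eta / 2 * \sum_j (y ord0 j - x ord0 j) ^+ 2)).
  apply: so => z i xz; have [_ _ /(_ i)[di _] /(_ i i)[dii _]] := reg (t - h) z th0 (Oz z xz).
  split=> //; apply/ltW; apply: (hr2 i r) => //; first by rewrite r0.
  by rewrite addrAC subrr add0r normrN ger0_norm.
apply: ler_wpM2r; first by apply: sumr_ge0 => j _; exact: sqr_ge0.
by rewrite ler_piMr ?(ltW eta0)// invf_le1// ler1n.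
Qed.

(** The equation is preserved when k^alpha = lam^2. The amplitude k is kept apart from lam, and the
    time shift c is 1 in the upper bound and 0 in the lower one. *)
Definition rescale k c lam u : R -> 'rV[R]_N -> R :=
  fun t x => k * u (c + lam ^+ 2 * t) (lam *: x).

Lemma flip_scale sg lam x y : flip sg (lam *: x) (lam *: y) = lam *: flip sg x y.
Proof. by apply/rowP => i; rewrite !mxE; ring. Qed.

Lemma nearby_scale r lam x y : 0 < lam -> nearby r x y -> nearby (lam * r) (lam *: x) (lam *: y).
Proof.
by move=> l0 xy i; rewrite !mxE -mulrBr normrM gtr0_norm// ltr_pM2l.
Qed.

Lemma Omega_scale lam x : 0 < lam -> Omega m x -> Omega m (lam *: x).
Proof. by move=> l0 Ox i im; rewrite mxE mulr_gt0// Ox. Qed.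

Lemma Omega_scaleV lam x : 0 < lam -> Omega m (lam *: x) -> Omega m x.
Proof. by move=> l0 Ox i im; have := Ox i im; rewrite mxE pmulr_rgt0. Qed.

Lemma in_closure_scale lam x : 0 < lam -> in_closure m x -> in_closure m (lam *: x).
Proof. by move=> l0 hx i im; rewrite mxE mulr_ge0 ?hx// ltW. Qed.

Lemma rescale_parabolic k c lam u : 0 <= k -> 0 <= c -> 0 < lam ->
  k `^ alpha = lam ^+ 2 ->
  parabolic m alpha u -> parabolic m alpha (rescale k c lam u).
Proof.
move=> k0 c0 l0 kl pu t x t0 Ox; have l2 : 0 < lam ^+ 2 by rewrite exprn_gt0.
have T0 : 0 < c + lam ^+ 2 * t by rewrite ltr_wpDl// mulr_gt0.
have [a [H [aE hj]]] := pu _ _ T0 (Omega_scale l0 Ox).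
exists (k * lam ^+ 2 * a), (fun j => k * lam ^+ 2 * H j); split.
  rewrite /rescale /absorption normrM powRM// (ger0_norm k0) kl -mulr_sumr.
  transitivity (k * lam ^+ 2 * (a - \sum_j H j + F (u (c + lam ^+ 2 * t) (lam *: x)))).
    by rewrite /absorption; ring.
  by rewrite aE mulr0.
move=> eta eta0; have K0 : 0 < k * lam ^+ 2 + 1 by rewrite ltr_wpDl// mulr_ge0// ltW.
have [r r0 hr] := hj (eta / (k * lam ^+ 2 + 1)) (divr_gt0 eta0 K0).
exists (Num.min (r / lam ^+ 2) (r / lam)); first by rewrite lt_min !divr_gt0.
move=> h y; rewrite lt_min => /and3P[h0 h1 _] /nearby_min[_ xy].
have := hr (lam ^+ 2 * h) (lam *: y).
rewrite mulr_ge0 ?(ltW l2)// mulrC -ltr_pdivlMr// h1 => /(_ isT).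
have xy' : nearby r (lam *: x) (lam *: y).
  by have := nearby_scale l0 xy; rewrite mulrC divfK ?gt_eqF.
move=> /(_ xy').
have E1 : average (rescale k c lam u (t - h)) x y =
    k * average (u (c + lam ^+ 2 * t - h * lam ^+ 2)) (lam *: x) (lam *: y).
  rewrite -averageZ; congr (_ * _); apply: eq_bigr => sg _; rewrite /rescale flip_scale.
  by rewrite mulrBr addrA (mulrC _ h).
have E2 : \sum_j k * lam ^+ 2 * H j / 2 * (y ord0 j - x ord0 j) ^+ 2 =
    k * \sum_j H j / 2 * ((lam *: y) ord0 j - (lam *: x) ord0 j) ^+ 2.
  by rewrite mulr_sumr; apply: eq_bigr => j _; rewrite !mxE; ring.
have E3 : \sum_j ((lam *: y) ord0 j - (lam *: x) ord0 j) ^+ 2 =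
    lam ^+ 2 * \sum_j (y ord0 j - x ord0 j) ^+ 2.
  by rewrite mulr_sumr; apply: eq_bigr => j _; rewrite !mxE; ring.
rewrite E1 E2 E3.
have S0 : 0 <= \sum_j (y ord0 j - x ord0 j) ^+ 2 by apply: sumr_ge0 => j _; exact: sqr_ge0.
move: S0; move: (\sum_j (y ord0 j - x ord0 j) ^+ 2) => S S0.
rewrite /rescale; move: (average _ _ _) (\sum_j _) (u _ _) => p q w hpq.
rewrite (_ : _ - _ = k * (p - w + h * lam ^+ 2 * a - q)); last by ring.
rewrite normrM (ger0_norm k0); apply: (le_trans (ler_wpM2l k0 hpq)).
rewrite [leLHS](_ : _ = (k * lam ^+ 2) / (k * lam ^+ 2 + 1) * (eta * (h + S))); last by ring.
rewrite ler_piMl//; first by rewrite mulr_ge0 ?(ltW eta0)// addr_ge0.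
by rewrite ler_pdivrMr// mul1r lerDl.
Qed.

Lemma parabolicN u : parabolic m alpha u -> parabolic m alpha (fun t x => - u t x).
Proof.
move=> pu t x t0 Ox; have [a [H [aE hj]]] := pu t x t0 Ox.
exists (- a), (fun j => - H j); split; first by rewrite sumrN absorptionN -!opprD aE oppr0.
move=> eta eta0; have [r r0 hr] := hj eta eta0; exists r => // h y h0 xy.
rewrite averageN -normrN.
have -> : \sum_j - H j / 2 * (y ord0 j - x ord0 j) ^+ 2 =
    - \sum_j H j / 2 * (y ord0 j - x ord0 j) ^+ 2.
  by rewrite -sumrN; apply: eq_bigr => j _; rewrite !mulNr.
by apply: le_trans (hr h y h0 xy); rewrite mulrN -!opprD opprK.
Qed.

Lemma parabolic0 : 0 < alpha -> parabolic m alpha (fun _ (_ : 'rV[R]_N) => 0).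
Proof.
move=> a0 t x t0 Ox; exists 0, (fun=> 0); split.
  by rewrite big1// subrr /absorption mulr0 addr0.
move=> eta eta0; exists 1 => // h y /andP[h0 _] _.
have -> : average (fun _ : 'rV[R]_N => 0 : R) x y = 0 by rewrite -[RHS](average_cst _ x y).
rewrite big1; last by move=> j _; rewrite !mul0r.
rewrite mulr0 !subr0 addr0 normr0 mulr_ge0 ?(ltW eta0)// addr_ge0// sumr_ge0// => j _.
exact: sqr_ge0.
Qed.

Lemma rescale_tame k c lam u : 0 <= c -> 0 < lam -> tame m u -> tame m (rescale k c lam u).
Proof.
move=> c0 l0 [cu zu Mu]; have l2 : 0 < lam ^+ 2 by rewrite exprn_gt0.
have T0 t : 0 < t -> 0 < c + lam ^+ 2 * t by move=> t0; rewrite ltr_wpDl// mulr_gt0.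
split.
- move=> t x t0 hx e e0; have K0 : 0 < `|k| + 1 by rewrite ltr_wpDl.
  have [d d0 hd] := cu _ _ (T0 t t0) (in_closure_scale l0 hx) _ (divr_gt0 e0 K0).
  exists (Num.min (d / lam ^+ 2) (d / lam)); first by rewrite lt_min !divr_gt0.
  move=> s y s0 hy; rewrite lt_min => /andP[st _] /nearby_min[_ xy].
  have := hd (c + lam ^+ 2 * s) (lam *: y) (T0 s s0) (in_closure_scale l0 hy).
  rewrite opprD addrACA subrr add0r -mulrBr normrM (gtr0_norm l2) mulrC -ltr_pdivlMr//.
  have xy' : nearby d (lam *: x) (lam *: y).
    by have := nearby_scale l0 xy; rewrite mulrC divfK ?gt_eqF.
  move=> /(_ st xy'); rewrite /rescale -mulrBr normrM ltr_pdivlMr// mulrC.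
  by apply: le_lt_trans; rewrite ler_wpM2r// lerDl.
- move=> t x t0 hx nO; rewrite /rescale zu ?mulr0//; first exact: T0.
    exact: in_closure_scale.
  by apply: contra_not nO; exact: Omega_scaleV.
- move=> a b a0; have [M hM] := Mu (c + lam ^+ 2 * a) (c + lam ^+ 2 * b) (T0 a a0).
  exists (`|k| * M) => t x /andP[at_ tb] hx; rewrite normrM ler_wpM2l// hM//.
    by rewrite !lerD2l !ler_pM2l// at_.
  exact: in_closure_scale.
Qed.

Lemma tameN u : tame m u -> tame m (fun t x => - u t x).
Proof.
move=> [cu zu Mu]; split.
- exact: jointly_continuousN.
- by move=> t x t0 hx nO; rewrite zu// oppr0.
- by move=> a b a0; have [M hM] := Mu a b a0; exists M => t x tab hx; rewrite normrN hM.
Qed.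

Lemma tame0 : tame m (fun _ (_ : 'rV[R]_N) => 0 : R).
Proof.
split=> //.
- by move=> t x t0 hx e e0; exists 1 => // s y *; rewrite subrr normr0.
- by move=> a b a0; exists 0 => *; rewrite normr0.
Qed.

End jets.

(** * The solution with initial value 1: sign, bounds and maximality *)

Section solution_from_one.
Context {R : realType} {N : nat}.
Variables (m : nat) (alpha : R).
Hypothesis alpha_gt0 : 0 < alpha.
Local Notation mu := (@lebesgue_row R N).
Local Notation leb := (@lebesgue_measure R).
Local Notation F := (absorption alpha).
Local Notation absr := (Num.Def.normr : R -> R).
Implicit Types (a b t s h r c e d : R) (x y z : 'rV[R]_N).

(** Absolute continuity of a finite integral, by dominated convergence along s = t / (n + 2), which
    stays strictly between 0 and t. *)
Lemma duhamel_vanish Phi t x e : source m Phi -> 0 < t -> in_closure m x ->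
  (duhamel m 0 t t x Phi < +oo)%E -> 0 < e ->
  exists2 s, 0 < s < t & (duhamel m 0 s t x Phi < e%:E)%E.
Proof.
move=> sP t0 hx fin e0.
pose f (q : R) := (\int[mu]_z (duhamel_integrand m 0 t t x Phi (q, z))%:E)%E.
pose s (n : nat) := t / n.+2%:R.
have s0 n : 0 < s n by rewrite divr_gt0.
have st n : s n < t by rewrite ltr_pdivrMr// ltr_pMr// ltr1n.
pose fn (n : nat) (q : R) := (\int[mu]_z (duhamel_integrand m 0 (s n) t x Phi (q, z))%:E)%E.
have mslice b : b <= t -> measurable_fun setT (fun q : R =>
    \int[mu]_z (duhamel_integrand m 0 b t x Phi (q, z))%:E)%E.
  move=> bt; apply: (measurable_fun_fubini_tonelli_F
    (fun p => (duhamel_integrand m 0 b t x Phi p)%:E)).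
    by apply/measurable_EFinP; exact: measurable_duhamel_integrand.
  by move=> p; rewrite lee_fin duhamel_integrand_ge0.
have f0 q : (0 <= f q)%E.
  by apply: integral_EFin_ge0 => z; exact: duhamel_integrand_ge0.
have fnE n q : fn n q = if (0 < q) && (q < s n) then f q else 0%E.
  rewrite /fn /f; case: ifPn => hq.
    apply: eq_integral => z _; rewrite /duhamel_integrand /between /= hq.
    by have /andP[q0 qs] := hq; rewrite q0 (lt_trans qs (st n)).
  apply: integral0_eq => z _; rewrite /duhamel_integrand /between /= (negbTE hq).
  by rewrite /ind mul0r.
have fi : leb.-integrable setT f.
  apply/integrableP; split; first exact: mslice.
  by under eq_integral do rewrite gee0_abs//.
have [||||_ _] := @dominated_convergence _ _ _ leb setT measurableT fn (cst 0%E) f _ _ _ fi.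
- by move=> n; apply: mslice; exact/ltW.
- exact: measurable_cst.
- apply: aeW => q _; apply: cvg_near_cst; have [q0|q0] := leP q 0.
    by apply: nearW => n; rewrite fnE ltNge q0.
  have [n0 hn0] : exists n0 : nat, t / q < n0%:R.
    by exists (Num.Def.archi_bound (t / q)); rewrite archi_boundP// divr_ge0// ltW.
  exists n0 => // n /= hn; rewrite fnE q0/= ltNge (_ : s n <= q)//.
  rewrite ler_pdivrMr// mulrC -ler_pdivrMr// (le_trans (ltW hn0))// ler_nat.
  by rewrite (leq_trans hn)// -addn2 leq_addr.
- apply: aeW => q n _; rewrite fnE; case: ifP => _; last by rewrite abse0.
  by rewrite gee0_abs.
rewrite integral0 => /fine_cvgP[nfin /cvgrPdist_lt/(_ e e0) nlt].
have [n _ /(_ n (leqnn n)) [h1 h2]] := filterI nfin nlt.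
exists (s n); first by rewrite s0 st.
move: h1 h2; rewrite /= sub0r normrN => h1 h2.
change (\int[leb]_q fn n q < e%:E)%E; rewrite -(fineK h1) lte_fin.
exact: le_lt_trans (ler_norm _) h2.
Qed.

Variable v : R -> 'rV[R]_N -> R.
Hypothesis hv : mild_solution m alpha (cst 1) v.

Let tv : tame m v. Proof. by have [/C0bu_tame] := hv. Qed.

Let sP := source_pospart alpha tv.
Let sM := source_negpart alpha tv.

Lemma mild_duhamel_fin s y : 0 < s -> Omega m y ->
  (duhamel m 0 s s y (restricted m (absorbed alpha v) absr) < +oo)%E.
Proof.
move=> s0 Oy; rewrite -duhamel_normr//; last exact: Omega_in_closure.
by have [_ habs _] := hv; exact: habs.
Qed.

Lemma opp_sub_le (h p q b : R) : 0 <= h -> p <= b -> 0 <= q -> - (h - (p - q)) <= b.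
Proof. by move=> *; lra. Qed.

(** The heat flow of 1 and the negative part of the source only raise v; the positive part of the
    source is bounded by its absolute value. *)
Lemma mild_lower s y : 0 < s -> Omega m y ->
  - v s y <= fine (duhamel m 0 s s y (restricted m (absorbed alpha v) absr)).
Proof.
move=> s0 Oy; have hy := Omega_in_closure Oy; have [_ _ hmild] := hv.
have Aoo := mild_duhamel_fin s0 Oy.
have sA := source_normr alpha tv.
have leP : (duhamel m 0 s s y (restricted m (absorbed alpha v) (@pospart R)) <=
    duhamel m 0 s s y (restricted m (absorbed alpha v) absr))%E.
  by apply: le_duhamel => // r; rewrite /pospart ge_max normr_ge0 ler_norm.
have leM : (duhamel m 0 s s y (restricted m (absorbed alpha v) (@negpart R)) <=
    duhamel m 0 s s y (restricted m (absorbed alpha v) absr))%E.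
  by apply: le_duhamel => // r; rewrite /negpart ge_max normr_ge0 -[X in _ <= X]normrN ler_norm.
have P0 := duhamel_ge0 0 sP (lexx s) hy; have M0 := duhamel_ge0 0 sM (lexx s) hy.
rewrite (hmild s y s0 Oy).
rewrite (Rintegral_duhamel sP sM (lexx 0) (lexx s) hy (le_lt_trans leP Aoo) (le_lt_trans leM Aoo)).
have h0 : 0 <= heat m s (cst 1) y by apply: heat_ge0 => // z _ /=.
have pA : fine (duhamel m 0 s s y (restricted m (absorbed alpha v) (@pospart R))) <=
    fine (duhamel m 0 s s y (restricted m (absorbed alpha v) absr)).
  move: leP P0 Aoo; move: (duhamel _ _ _ _ _ _) (duhamel _ _ _ _ _ _) => [p| |] [q| |]//=.
have m0 := fine_ge0 M0.
exact: opp_sub_le.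
Qed.

(* Comparison of [- v] with the zero solution from time [s]; the negative part of
   [v s] is at most the Duhamel integral up to [s], which vanishes with [s] because
   it converges absolutely. *)
Lemma mild_ge0 t x : 0 < t -> in_closure m x -> 0 <= v t x.
Proof.
move=> t0 hx.
have [Ox|nO] := pselect (Omega m x); last by have [_ z0 _] := tv; rewrite z0.
rewrite -oppr_le0 leNgt; apply/negP => neg.
have sA := source_normr alpha tv.
have [s /andP[s0 st] hs] := duhamel_vanish sA t0 hx (mild_duhamel_fin t0 Ox) neg.
have cmp := comparison alpha_gt0 (restartN (mild_restart hv)) (tameN tv)
  (@tame0 _ _ m) (@parabolic0 _ _ m _ alpha_gt0) (introT andP (conj s0 st)) hx.
have ts : 0 < t - s by rewrite subr_gt0.
have mneg : measurable_fun (Omega m) (fun y => Num.max 0 (- v s y)).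
  apply: measurable_maxr; first exact: measurable_cst.
  by apply: measurable_funN; exact: tame_measurable.
have E : (heat m (t - s) (fun y => Num.max 0 (- v s y - 0)) x)%:E =
    (\int[mu]_y (kern m (t - s) x y * Num.max 0 (- v s y))%:E)%E.
  have -> : (fun y => Num.max 0 (- v s y - 0)) = (fun y => Num.max 0 (- v s y)).
    by apply/funext => y; rewrite subr0.
  rewrite heatE// /Rintegral fineK//.
  apply: integrable_fin_num => //; apply: integrable_kernM => //.
  split => //; have [_ [B hB]] := bounded_onN (tame_bounded_on tv s0).
  exists B => y Oy; rewrite ger0_norm ?le_max ?lexx// ge_max.
  by rewrite (le_trans _ (hB y Oy))//= (le_trans _ (hB y Oy))// ler_norm.
have {}cmp : ((- v t x)%:E <= \int[mu]_y (kern m (t - s) x y * Num.max 0 (- v s y))%:E)%E.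
  by rewrite -E lee_fin; move: cmp; rewrite subr0.
(* The heat flow to time t of the bound in [mild_lower] is the contribution of (0, s) observed at t,
   which s was chosen to make smaller than - v t x. *)
have := @heat_duhamel _ _ m (t - s) 0 s s x _ sA (lexx _) ts hx.
rewrite (_ : s + (t - s) = t); last by rewrite addrC subrK.
move=> HD; move: hs; rewrite -HD ltNge => /negP; apply; apply: (le_trans cmp).
have E2 : (\int[mu]_y ((kern m (t - s) x y)%:E * duhamel m 0 s s y
      (restricted m (absorbed alpha v) absr)) =
    \int[mu]_y ((kern m (t - s) x y)%:E * (if pselect (Omega m y) then
      duhamel m 0 s s y (restricted m (absorbed alpha v) absr) else 0)))%E.
  by apply: eq_integral => y _; case: pselect => Oy//=; rewrite kern_out// !mul0e.
rewrite E2; apply: ge0_le_integral => //.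
- by move=> y _; rewrite lee_fin; apply: (kernM_ge0 (psi := fun y => Num.max 0 (- v s y))) => // z Oz; rewrite le_max lexx.
- by apply/measurable_EFinP; exact: measurable_kernM.
- apply: emeasurable_funM; last exact: measurable_duhamel.
  by apply/measurable_EFinP; exact: measurable_kernr.
move=> y _; case: pselect => Oy/=; last by rewrite kern_out// mul0r mul0e.
have A0 := duhamel_ge0 0 sA (lexx s) (Omega_in_closure Oy).
rewrite -(fineK (_ : duhamel _ _ _ _ _ _ \is a fin_num)); last first.
  by rewrite ge0_fin_numE//; exact: mild_duhamel_fin.
rewrite -EFinM lee_fin ler_wpM2l ?kern_ge0// ge_max fine_ge0//=.
exact: mild_lower.
Qed.

Lemma absorption_ge0 p : 0 <= p -> 0 <= F p.
Proof. by move=> p0; rewrite /absorption mulr_ge0// powR_ge0. Qed.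

Lemma mild_le_heat t x : 0 < t -> in_closure m x -> v t x <= heat m t (cst 1) x.
Proof.
move=> t0 hx; have [_ _ hmild] := hv.
have [Ox|nO] := pselect (Omega m x); last first.
  by have [_ z0 _] := tv; rewrite z0// heat_ge0// => z _ /=.
rewrite (hmild t x t0 Ox) gerBl; apply: Rintegral_ge0 => s; rewrite /= in_itv/= => /andP[s0 st].
apply: heat_ge0; rewrite ?subr_gt0// => y Oy /=; apply: absorption_ge0.
by apply: mild_ge0 => //; exact: Omega_in_closure.
Qed.

Lemma mild_le1 t x : 0 < t -> in_closure m x -> v t x <= 1.
Proof. by move=> t0 hx; apply: (le_trans (mild_le_heat t0 hx)); exact: heat_cst_le. Qed.

Lemma absorption_mild s y : 0 < s -> in_closure m y -> 0 <= F (v s y) <= 1.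
Proof.
move=> s0 hy; have v0 := mild_ge0 s0 hy; rewrite absorption_ge0//=.
apply: (@le_trans _ _ (F 1)); first by apply: le_absorption => //; exact: mild_le1.
by rewrite /absorption normr1 powR1 mulr1.
Qed.

(** Since 0 <= v <= 1, the absorption also lies in [0, 1], and Duhamel's integral over (0, t) is at
    most t. *)
Lemma mild_ge_heat t x : 0 < t -> in_closure m x -> heat m t (cst 1) x - t <= v t x.
Proof.
move=> t0 hx; have [_ _ hmild] := hv.
have [Ox|nO] := pselect (Omega m x); last first.
  have [_ z0 _] := tv; rewrite z0// heatE// /Rintegral integral0_eq/=.
    by rewrite sub0r oppr_le0 ltW.
  by move=> y _; rewrite kern_frontier// mul0r.
rewrite (hmild t x t0 Ox) lerD2l lerN2 -[leRHS]subr0 -[leRHS]mul1r -lerN2 -RintegralN -mulNr.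
have mh : measurable_fun `]0, t[ (fun s => - heat m (t - s) (F \o v s) x).
  by apply: measurable_funN; exact: (measurable_heat_slice sP sM (lexx 0) (lexx t) hx).
apply: (Rintegral_ge_cst (B := 1)) => // s /andP[s0 st].
  rewrite normrN; apply: heat_ubound; rewrite ?subr_gt0//.
    by apply: (measurableT_comp (@measurable_absorption R alpha)); exact: tame_measurable.
  move=> y Oy /=; have /andP[h1 h2] := absorption_mild s0 (Omega_in_closure Oy).
  by rewrite ger0_norm.
rewrite lerN2; apply: (@le_trans _ _ `|heat m (t - s) (F \o v s) x|); first exact: ler_norm.
apply: heat_ubound; rewrite ?subr_gt0//.
  by apply: (measurableT_comp (@measurable_absorption R alpha)); exact: tame_measurable.
move=> y Oy /=; have /andP[h1 h2] := absorption_mild s0 (Omega_in_closure Oy).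
by rewrite ger0_norm.
Qed.

(** No convergence of u at time 0 is required. At a small time s the positive part of u - v is at
    most 1 + s - heat(s) 1, whose heat flow up to t is at most heat(t - s) 1 - heat(t) 1 + s and
    tends to 0 with s. The comparison principle has the mild solution on the left, so it is applied
    to [- v] and [- u]. *)
Lemma le_mild u t x : tame m u -> parabolic m alpha u ->
  (forall s y, 0 < s <= 1 -> in_closure m y -> u s y <= 1) ->
  0 < t -> in_closure m x -> u t x <= v t x.
Proof.
move=> tu pu hu t0 hx; apply/ler_addgt0Pr => e e0.
have one0 (y : 'rV[R]_N) : Omega m y -> 0 <= cst 1 y :> R by [].
have b1 := @bounded_on_cst R N m 1.
have [d d0 hd] := heat_jointly_continuous b1 one0 t0 hx (divr_gt0 e0 (ltr0n _ 2)).
pose s := Num.min (Num.min 1 (t / 2)) (Num.min (d / 2) (e / 2)).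
have s0 : 0 < s by rewrite /s !lt_min !divr_gt0// ltr01.
have : s <= s by [].
rewrite {2}/s !le_min => /andP[/andP[s1 st2] /andP[sd se]].
have st : s < t by rewrite (le_lt_trans st2)// ltr_pdivrMr// ltr_pMr// ltr1n.
have ts : 0 < t - s by rewrite subr_gt0.
have := comparison alpha_gt0 (restartN (mild_restart hv)) (tameN tv) (tameN tu)
  (parabolicN pu) (introT andP (conj s0 st)) hx.
rewrite opprK addrC => cmp.
have bh := bounded_on_heat s0 b1 one0.
have bc := @bounded_on_cst R N m (1 + s).
have bmax : bounded_on m (fun y => Num.max 0 (- v s y - - u s y)).
  have [mw [B hB]] := bounded_onB (bounded_onN (tame_bounded_on tv s0))
    (bounded_onN (tame_bounded_on tu s0)).
  split; first by apply: measurable_maxr => //; exact: measurable_cst.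
  exists B => y Oy; rewrite ger0_norm ?le_max ?lexx// ge_max.
  by rewrite (le_trans _ (hB y Oy))//= (le_trans _ (hB y Oy))// ler_norm.
have le2 : heat m (t - s) (fun y => Num.max 0 (- v s y - - u s y)) x <=
    heat m (t - s) (fun y => cst (1 + s) y - heat m s (cst 1) y) x.
  apply: heat_le => //; first exact: bounded_onB.
  move=> y Oy; have hy := Omega_in_closure Oy.
  have h1 : heat m s (cst 1) y <= 1 by exact: heat_cst_le.
  have h2 := mild_ge_heat s0 hy.
  have h3 : u s y <= 1 by apply: hu => //; rewrite s0.
  by rewrite ge_max /cst; apply/andP; split; lra.
rewrite (heatB ts hx bc bh) (heat_semigroup ts s0 hx b1 one0) subrK in le2.
have h1 : heat m (t - s) (cst (1 + s)) x <= heat m (t - s) (cst 1) x + s.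
  have -> : (cst (1 + s) : 'rV[R]_N -> R) = (fun y => cst 1 y + cst s y) by [].
  rewrite heatD//; last exact: bounded_on_cst.
  by rewrite lerD2l heat_cst_le// ltW.
have := hd (t - s) x ts hx; rewrite addrAC subrr add0r normrN gtr0_norm//.
have -> : s < d by rewrite (le_lt_trans sd)// ltr_pdivrMr// ltr_pMr// ltr1n.
have nx : nearby d x x by move=> i; rewrite subrr normr0.
move=> /(_ isT nx); rewrite ltr_norml => /andP[_ h2].
have {}cmp := le_trans cmp le2; have se' : s <= e / 2 by [].
by move: cmp h1 h2 se'; clear; move=> *; lra.
Qed.

End solution_from_one.

(** * The two bounds *)

Section upper_bound.
Context {R : realType} {N : nat}.
Variables (m : nat) (alpha : R).
Hypothesis alpha_gt0 : 0 < alpha.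
Implicit Types (a b t s h r c e d L tau : R) (x y z : 'rV[R]_N) (u : R -> 'rV[R]_N -> R).

Lemma powR_near_one r e : 0 < e -> exists2 d, 0 < d <= 2^-1 &
  forall tau, `|tau - 1| < d -> `|tau `^ r - 1| < e.
Proof.
move=> e0.
have : {for 1, continuous (fun a : R => a `^ r)}.
  apply: differentiable_continuous; apply/derivable1_diffP.
  have i1 := @is_derive1_powR R r 1 ltr01.
  exact: ex_derive.
move=> /cvgrPdist_lt/(_ e e0) /nbhs_ballP[d /= d0 hd].
exists (Num.min d 2^-1); first by rewrite lt_min d0 invr_gt0 ltr0n ge_min lexx orbT.
move=> tau; rewrite lt_min => /andP[h _]; have := hd tau; rewrite /ball/= distrC => /(_ h).
by rewrite powR1 distrC.
Qed.

Lemma enormZ c x : enorm (c *: x) = `|c| * enorm x.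
Proof.
rewrite /enorm -sqrtr_sqr -sqrtrM ?sqr_ge0//; congr Num.sqrt.
by rewrite mulr_sumr; apply: eq_bigr => i _; rewrite mxE exprMn.
Qed.

Section profile.
Variables (V : R -> 'rV[R]_N -> R) (g : 'rV[R]_N -> R).
Hypothesis gC : C0bu m g.
Hypothesis hV : selfsimilar_profile m alpha V g.

(** A neighbourhood of time 1 is needed because the time shift in the upper bound leads to the time
    1 - 1 / t. *)
Lemma profile_near_one L e : 0 < e -> exists2 d, 0 < d <= 2^-1 &
  forall tau x, `|tau - 1| < d -> in_closure m x -> box L x -> `|V tau x - g x| < e.
Proof.
move=> e0; have [[Mg hMg] ug _] := gC.
have e2 : 0 < e / 2 by rewrite divr_gt0.
have [d1 d10 hd1] := ug (e / 2) e2.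
have M0 : 0 < `|Mg| + 1 by rewrite ltr_wpDl.
have L0 : 0 < N%:R * `|L| + 1 by rewrite ltr_wpDl// mulr_ge0.
have [d2 /andP[d20 d2h] hd2] := powR_near_one (- alpha^-1) (divr_gt0 e2 M0).
have [d3 /andP[d30 d3h] hd3] := powR_near_one (- 2^-1) (divr_gt0 d10 L0).
exists (Num.min d2 d3); first by rewrite lt_min d20 d30/= ge_min d2h.
move=> tau x; rewrite lt_min => /andP[t2 t3] hx Lx.
have tau0 : 0 < tau.
  have := lt_le_trans t2 d2h; rewrite ltr_norml => /andP[+ _].
  by lra.
rewrite hV ?in_closureE//.
have -> : (Num.sqrt tau)^-1 = tau `^ (- 2^-1) by rewrite powRN powR12_sqrt// ltW.
set p := tau `^ (- alpha^-1); set q := tau `^ (- 2^-1).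
have q0 : 0 < q by rewrite powR_gt0.
have hqx : closure (Omega m) (q *: x) by rewrite in_closureE; exact: in_closure_scale.
rewrite (_ : p * g (q *: x) - g x = (p - 1) * g (q *: x) + (g (q *: x) - g x)); last by ring.
rewrite (splitr e) (le_lt_trans (ler_normD _ _))// ltrD//.
  rewrite normrM (@le_lt_trans _ _ (`|p - 1| * (`|Mg| + 1)))//; last first.
    by rewrite -ltr_pdivlMr//; exact: hd2.
  rewrite ler_wpM2l// (le_trans (hMg _ hqx))// (le_trans (ler_norm _))// lerDl//.
apply: hd1 => //; first by rewrite in_closureE.
rewrite -[X in _ - X]scale1r -scalerBl enormZ.
have xL : enorm x <= N%:R * `|L|.
  by apply: enorm_le => // i; rewrite (le_trans (Lx i))// ler_norm.
apply: (@le_lt_trans _ _ (`|q - 1| * (N%:R * `|L| + 1))).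
  by rewrite ler_wpM2l// (le_trans xL)// lerDl.
by rewrite -ltr_pdivlMr//; exact: hd3.
Qed.

Variable v : R -> 'rV[R]_N -> R.
Hypothesis vV : dilation_limit m alpha v V.

Lemma dilation_profile L e : 0 < e -> exists M d, 0 < d <= 2^-1 /\
  forall lam tau x, M < lam -> `|tau - 1| < d -> in_closure m x -> box L x ->
    `|dilation (2 / alpha) lam v tau x - g x| < e.
Proof.
move=> e0; have e2 : 0 < e / 2 by rewrite divr_gt0.
have [d /andP[d0 dh] hd] := profile_near_one L e2.
(* The times at distance at most 1/2 from 1, in accordance with the bound d <= 1/2. *)
pose K := [set` `[1 / 2 : R, 3 / 2]%R] `*` ([set x : 'rV[R]_N | in_closure m x] `&` box L).
have cK : compact K.
  by apply: compact_setX; [exact: segment_compact|exact: compact_closure_box].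
have [|M hM] := (locally_uniformlyP _ _ _).1 vV K cK _ (e / 2) e2.
  move=> [t x] [/=]; rewrite in_itv/= => /andP[t1 _] [hx _]; split => /=.
    by apply: lt_le_trans t1; rewrite divr_gt0.
  by rewrite in_closureE.
exists M, d; rewrite d0; split => // lam tau x Ml td hx Lx.
have h1 := hM lam Ml (tau, x); have h2 := hd tau x td hx Lx.
rewrite (splitr e) -(subrKA (V tau x)) (le_lt_trans (ler_normD _ _))// ltrD// h1//.
split => //=; rewrite in_itv/=; move: (lt_le_trans td dh); rewrite ltr_norml.
by move=> /andP[q1 q2]; apply/andP; split; lra.
Qed.

Hypothesis hv : mild_solution m alpha (cst 1) v.

(** The amplitude of this dilation contains 1 / k, which cancels the small factor k in front of u:
    smallness of the rescaled solution costs nothing in the limit. *)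
Lemma dilate_time (mul t k : R) : 0 < t -> 0 < k -> mul ^+ 2 = t / k `^ alpha -> 0 < mul ->
  mul `^ (2 / alpha) = t `^ alpha^-1 / k.
Proof.
move=> t0 k0 mE m0.
have -> : mul `^ (2 / alpha) = (mul ^+ 2) `^ alpha^-1.
  by rewrite powRrM powR_mulrn// ltW.
rewrite mE powRM ?(ltW t0)// ?invr_ge0 ?powR_ge0//; congr (_ * _).
rewrite -powR_inv1 ?powR_ge0// -!powRrM.
have -> : alpha * (-1 / alpha) = -1 by field; rewrite gt_eqF.
by rewrite powR_inv1// ltW.
Qed.

(** The shift to time 1 avoids the possibly unbounded initial value. Only a bound on [1, 2] is used:
    [le_mild] looks at times up to 1, and lam <= 1 maps them into that interval. *)
Lemma upper_bound u L e : tame m u -> parabolic m alpha u -> 0 < e ->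
  exists M, forall t, M < t -> forall x, in_closure m x -> box L x ->
    t `^ alpha^-1 * u t (Num.sqrt t *: x) <= g x + e.
Proof.
move=> tu pu e0; have [_ _ /(_ 1 2 ltr01)[B hB]] := tu.
pose k := (`|B| + 1)^-1.
have B1 : 0 < `|B| + 1 by rewrite ltr_wpDl.
have k0 : 0 < k by rewrite invr_gt0.
have k1 : k <= 1 by rewrite invf_le1// lerDr.
have ka0 : 0 < k `^ alpha by rewrite powR_gt0.
have ka1 : k `^ alpha <= 1.
  apply: (@le_trans _ _ (1 `^ alpha)); last by rewrite powR1.
  by apply: ge0_ler_powR; rewrite ?nnegrE ?(ltW k0) ?(ltW alpha_gt0).
(* The spatial scale forced by the equation, k^alpha = lam^2; k <= 1 gives lam <= 1. *)
pose lam := Num.sqrt (k `^ alpha).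
have l0 : 0 < lam by rewrite sqrtr_gt0.
have l2 : lam ^+ 2 = k `^ alpha by rewrite sqr_sqrtr// ltW.
have le_v s y : 0 < s -> in_closure m y -> rescale k 1 lam u s y <= v s y.
  apply: (le_mild alpha_gt0 hv).
  - exact: rescale_tame.
  - by apply: rescale_parabolic => //; exact: ltW.
  move=> q z /andP[q0 q1] hz; rewrite /rescale l2.
  apply: (@le_trans _ _ (k * `|B|)); last first.
    by rewrite /k mulrC ler_pdivrMr// mul1r lerDl.
  rewrite ler_wpM2l ?(ltW k0)// (le_trans (ler_norm _))// (le_trans (hB _ _ _ _)) ?ler_norm//.
    rewrite lerDl mulr_ge0 ?(ltW ka0) ?(ltW q0)//= -[leRHS]/(1 + 1) lerD2l.
    by rewrite -[leRHS]mulr1 ler_pM// ?(ltW ka0) ?(ltW q0).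
  exact: in_closure_scale.
have [M [d [/andP[d0 dh] hM]]] := dilation_profile L e0.
(* In turn: 1 - 1 / t is positive, it is within d of 1, and the dilation factor [mul] exceeds M. *)
exists (Num.max 2 (Num.max (d^-1 + 1) ((`|M| + 1) ^+ 2))) => t.
rewrite !gt_max => /and3P[t2 td tM] x hx Lx.
have t0 : 0 < t by apply: lt_trans t2.
(* Chosen so that [lam * mul] is sqrt t; at time 1 - 1 / t the shifted time 1 + (lam mul)^2 (1 - 1 /
   t) is then exactly t. *)
pose mul := Num.sqrt t / lam.
have st0 : 0 < Num.sqrt t by rewrite sqrtr_gt0.
have m0 : 0 < mul by rewrite divr_gt0.
have m2 : mul ^+ 2 = t / k `^ alpha by rewrite expr_div_n sqr_sqrtr ?(ltW t0)// l2.
have mM : M < mul.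
  apply: (@lt_le_trans _ _ (Num.sqrt t)).
    apply: (@lt_trans _ _ (`|M| + 1)); first by rewrite (le_lt_trans (ler_norm _))// ltrDl.
    by rewrite -[ltLHS]ger0_norm ?addr_ge0// -sqrtr_sqr ltr_sqrt.
  rewrite ler_pdivlMr// ler_piMr ?(ltW st0)//.
  by rewrite -(@sqrtr1 R) ler_wsqrtr.
have tau_d : `|1 - t^-1 - 1| < d.
  rewrite addrAC subrr add0r normrN gtr0_norm ?invr_gt0// invf_plt ?posrE//.
  by apply: lt_trans td; rewrite ltrDl.
have h1 := hM mul (1 - t^-1) x mM tau_d hx Lx.
have s0 : 0 < mul ^+ 2 * (1 - t^-1).
  by rewrite mulr_gt0 ?exprn_gt0// subr_gt0 invf_lt1//; apply: lt_trans t2; rewrite ltr1n.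
have h2 := le_v _ _ s0 (in_closure_scale m0 hx).
have E : rescale k 1 lam u (mul ^+ 2 * (1 - t^-1)) (mul *: x) = k * u t (Num.sqrt t *: x).
  rewrite /rescale scalerA; congr (_ * u _ (_ *: _)); last by rewrite mulrC divfK ?gt_eqF.
  by rewrite m2 l2; field; rewrite !gt_eqF.
move: h1; rewrite /dilation (dilate_time t0 k0 m2 m0) ltr_norml => /andP[_ h1].
rewrite E in h2; have : t `^ alpha^-1 / k * (k * u t (Num.sqrt t *: x)) <=
    t `^ alpha^-1 / k * v (mul ^+ 2 * (1 - t^-1)) (mul *: x).
  by rewrite ler_wpM2l// divr_ge0 ?powR_ge0 ?(ltW k0).
rewrite -mulrA mulKf ?gt_eqF// => h3; apply: (le_trans h3).
by move: h1; clear; lra.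
Qed.

End profile.
End upper_bound.

(** * The weight, and a singular integrand in dimension one *)

Section singular_weight.
Context {R : realType} {N : nat}.
Variables (m : nat).
Local Notation mu := (@lebesgue_row R N).
Local Notation leb := (@lebesgue_measure R).
Implicit Types (a b t s c d e L T tau lam : R) (x y z : 'rV[R]_N).

(** The fundamental theorem of calculus on [1/(n+2), 1], where the power is continuous, followed by
    monotone convergence. *)
Lemma integral_powR_singular b : 0 < b < 1 ->
  (\int[leb]_a (ind (0 < a <= 1)%R * a `^ (- b))%:E <= (1 / (1 - b))%:E)%E.
Proof.
move=> /andP[b0 b1]; have b10 : 0 < 1 - b by rewrite subr_gt0.
pose eps (n : nat) : R := n.+2%:R^-1.
have eps0 n : 0 < eps n by rewrite invr_gt0.
have eps1 n : eps n < 1 by rewrite invf_lt1// ltr1n.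
pose fn (n : nat) (a : R) := (ind (eps n <= a <= 1)%R * a `^ (- b))%:E.
have mp : measurable_fun setT (fun a : R => a `^ (- b)) by exact: measurable_powR.
have mfn n : measurable_fun setT (fn n).
  apply/measurable_EFinP; apply: measurable_funM => //; apply: measurable_ind.
  by apply: measurable_and; exact: measurable_fun_ler.
have fn0 n a : (0 <= fn n a)%E by rewrite lee_fin mulr_ge0 ?ind_ge0 ?powR_ge0.
have ndfn a : {homo fn^~ a : n k / (n <= k)%N >-> (n <= k)%E}.
  move=> n k nk; rewrite lee_fin; apply: ler_wpM2r; first exact: powR_ge0.
  rewrite /ind; case: (boolP (eps n <= a <= 1)) => [/andP[h1 h2]|_]; last exact: ler0n.
  by rewrite h2 (_ : eps k <= a)// (le_trans _ h1)// lef_pV2 ?posrE// ler_nat !ltnS.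
have := @cvg_monotone_convergence _ _ _ leb setT measurableT fn mfn (fun n a _ => fn0 n a)
  (fun a _ => ndfn a).
have -> : (fun a => limn (fn^~ a)) = (fun a => (ind (0 < a <= 1)%R * a `^ (- b))%:E).
  apply/funext => a; apply: cvg_lim => //; apply: cvg_near_cst.
  have [a0|a0] := leP a 0.
    apply: nearW => n; rewrite /fn leNgt (le_lt_trans a0 (eps0 n))/=.
    by rewrite /ind mul0r.
  exists (Num.bound a^-1) => // n /= hn; rewrite /fn (_ : eps n <= a)//.
  rewrite invf_ple ?posrE//; apply: ltW; apply: lt_le_trans (archi_boundP _) _.
    by rewrite invr_ge0 ltW.
  by rewrite ler_nat (leq_trans hn)// -addn2 leq_addr.
move=> cv; rewrite -(cvg_lim _ cv)//; apply: lime_le; first by apply/cvg_ex; eexists; exact: cv.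
apply: nearW => n.
pose G (a : R) := a `^ (1 - b) / (1 - b).
have dG (a : R) : 0 < a -> is_derive a 1 G (a `^ (- b)).
  move=> a0; have i1 := is_derive1_powR (1 - b) a0.
  rewrite /G; apply: is_derive_eq.
  rewrite /GRing.scale/= mulr0 add0r mulrA mulVf ?gt_eqF// mul1r.
  by congr (_ `^ _); ring.
have cG (a : R) : 0 < a -> {for a, continuous G}.
  move=> a0; apply: differentiable_continuous; apply/derivable1_diffP.
  by have := dG a a0 => ?; exact: ex_derive.
have cp (a : R) : 0 < a -> {for a, continuous (fun a : R => a `^ (- b))}.
  move=> a0; apply: differentiable_continuous; apply/derivable1_diffP.
  by have := is_derive1_powR (- b) a0 => ?; exact: ex_derive.
have cpw : {within `[eps n, 1], continuous (fun a : R => a `^ (- b))}.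
  apply: continuous_in_subspaceT => a; rewrite inE/= in_itv/= => /andP[h1 _].
  by apply: cp; exact: lt_le_trans h1.
have LR : derivable_oo_LRcontinuous G (eps n) 1.
  split.
  - move=> a; rewrite in_itv/= => /andP[h1 _].
    by have := dG a (lt_trans (eps0 n) h1) => ?; exact: ex_derive.
  - by apply: cvg_at_right_filter; exact: cG.
  - by apply: cvg_at_left_filter; exact: cG.
have GE : {in `]eps n, 1[, derive1 G =1 (fun a : R => a `^ (- b))}.
  move=> a; rewrite in_itv/= => /andP[h1 _]; rewrite derive1E.
  by have := dG a (lt_trans (eps0 n) h1) => ?; exact: derive_val.
have E : (\int[leb]_a fn n a = (G 1)%:E - (G (eps n))%:E)%E.
  rewrite -(continuous_FTC2 (eps1 n) cpw LR GE) [in RHS]integral_mkcond.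
  apply: eq_integral => a _; rewrite patchE /fn; case: ifPn => [|h].
    by rewrite inE/= in_itv/= => ->; rewrite /ind mul1r.
  have -> : (eps n <= a <= 1) = false by apply: contraNF h => h'; rewrite inE/= in_itv.
  by rewrite /ind mul0r.
rewrite E -EFinB lee_fin {1}/G powR1 gerBl divr_ge0 ?powR_ge0 ?(ltW b10)//.
Qed.

Definition singular tau b a : R := gauss tau a * `|a| `^ (- b).

Lemma singular_ge0 tau b a : 0 <= singular tau b a.
Proof. by rewrite mulr_ge0 ?gauss_ge0 ?powR_ge0. Qed.

Lemma measurable_singular tau b : measurable_fun setT (singular tau b).
Proof.
apply: measurable_funM; first exact: measurable_gauss.
by apply: (measurableT_comp (measurable_powR _)); exact: normr_measurable.
Qed.

Lemma gauss_le0 tau a : 0 < tau -> gauss tau a <= gauss tau 0.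
Proof. by move=> t0; apply: gauss_le => //; rewrite normr0. Qed.

Lemma peak_le (g1 g2 p : R) : 0 <= g1 -> g1 <= g2 -> 0 <= p ->
  g1 * p + g1 * p <= 2 * g2 * p + 2 * g1.
Proof.
by move=> h1 h2 h3; have : 0 <= (g2 - g1) * p by [rewrite mulr_ge0// subr_ge0]; lra.
Qed.

(** On |a| <= 1 the Gaussian is bounded and the power is integrable; on |a| > 1 the power is at most
    1 and the Gaussian is integrable. *)
Lemma integral_singular_lty tau b : 0 < tau -> 0 < b < 1 ->
  (\int[leb]_a (singular tau b a)%:E < +oo)%E.
Proof.
move=> t0 b01; have /andP[b0 b1] := b01.
rewrite -(integral_half_line (measurable_singular tau b)); last exact: singular_ge0.
have g0 := gauss_ge0 tau (0 : R).
pose q (a : R) := 2 * gauss tau 0 * (ind (0 < a <= 1) * a `^ (- b)).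
have mi : measurable_fun setT (fun a : R => ind (0 < a <= 1) * a `^ (- b)).
  apply: measurable_funM; last exact: measurable_powR.
  by apply: measurable_ind; apply: measurable_and; [exact: measurable_fun_ltr|exact: measurable_fun_ler].
have mq : measurable_fun setT q by apply: measurable_funM.
have q0 a : 0 <= q a by rewrite !mulr_ge0 ?ind_ge0 ?powR_ge0.
have mg : measurable_fun setT (fun a : R => 2 * gauss tau a).
  by apply: measurable_funM => //; exact: measurable_gauss.
have mg0 (a : R) : 0 <= 2 * gauss tau a by rewrite mulr_ge0 ?gauss_ge0.
have msum : measurable_fun setT (fun a : R => ind (0 < a) * (singular tau b a + singular tau b (- a))).
  apply: measurable_funM; first by apply: measurable_ind; exact: measurable_fun_ltr.
  apply: measurable_funD; first exact: measurable_singular.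
  by apply: (measurableT_comp (measurable_singular tau b)); exact: oppr_measurable.
apply: (@le_lt_trans _ _ (\int[leb]_a (q a + 2 * gauss tau a)%:E)%E).
  apply: le_integral_EFin => //.
  - by apply: measurable_funD.
  - by move=> a; rewrite mulr_ge0 ?ind_ge0// addr_ge0 ?singular_ge0.
  move=> a; case: (ltP 0 a) => a0; last by rewrite /ind mul0r addr_ge0.
  rewrite {1}/ind mul1r /singular gaussN normrN gtr0_norm//.
  have ga := gauss_ge0 tau a; have gal := gauss_le0 a t0.
  rewrite /q a0/=; case: (leP a 1) => a1.
    rewrite /ind mul1r; have p0 := powR_ge0 a (- b).
    exact: peak_le.
  rewrite /ind mul0r mulr0 add0r -mulr2n mulr_natl lerMn2r/=.
  rewrite ler_piMr// powRN invf_le1 ?powR_gt0//.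
  apply: (@le_trans _ _ (1 `^ b)); first by rewrite powR1.
  by apply: ge0_ler_powR; rewrite ?nnegrE ?ltW.
have E1 : (\int[leb]_a (q a + 2 * gauss tau a)%:E =
    \int[leb]_a (q a)%:E + \int[leb]_a (2 * gauss tau a)%:E)%E by exact: integral_EFinD.
have E2 : (\int[leb]_a (q a)%:E = (2 * gauss tau 0)%:E *
    \int[leb]_a (ind (0 < a <= 1)%R * a `^ (- b))%:E)%E.
  by apply: integral_EFinZ => // a; rewrite mulr_ge0 ?ind_ge0 ?powR_ge0.
have E3 : (\int[leb]_a (2 * gauss tau a)%:E = 2%:E)%E.
  rewrite -[RHS]mule1 -(integral_gauss0 t0); apply: integral_EFinZ => //.
  - exact: measurable_gauss.
  - by move=> a; exact: gauss_ge0.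
rewrite E1 E3 lte_add_pinfty ?ltry// E2.
apply: lte_mul_pinfty => //; first by rewrite lee_fin mulr_ge0.
exact: le_lt_trans (integral_powR_singular b01) (ltry _).
Qed.

Definition wgt1 (c : bool) tau a : R := (if c then `|a| else 1) * gauss tau a.

(** A constant multiple of |y_1 ... y_m| exp(- |y|^2 / (4 tau)); keeping the Gaussian normalized
    lets the kernel estimates be reused. *)
Definition wgt tau y : R := \prod_(i < N) wgt1 (i < m)%N tau (y ord0 i).

Lemma wgt1_ge0 (c : bool) tau a : 0 <= wgt1 c tau a.
Proof. by rewrite mulr_ge0 ?gauss_ge0//; case: c. Qed.

Lemma wgt_ge0 tau y : 0 <= wgt tau y.
Proof. by apply: prodr_ge0 => i _; exact: wgt1_ge0. Qed.

Lemma measurable_wgt1 (c : bool) tau : measurable_fun setT (wgt1 c tau).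
Proof.
apply: measurable_funM; last exact: measurable_gauss.
by case: c => //; exact: normr_measurable.
Qed.

Lemma measurable_wgt tau : measurable_fun [set: 'rV[R]_N] (wgt tau).
Proof.
apply: (@measurable_coord_prod _ _ (fun i a => wgt1 (i < m)%N tau a)) => i.
exact: measurable_wgt1.
Qed.

(** [k1_le_weight] yields |y_i| x_i / t in each Dirichlet direction, where x_i <= L and t >= T / 2;
    [gauss_dominated] recenters the Gaussian at 0. *)
Lemma kern_le_wgt T L : 0 < T -> 0 <= L -> exists2 C, 0 <= C & forall t x y,
  T / 2 <= t <= T -> in_closure m x -> box L x -> kern m t x y <= C * wgt (4 * T) y.
Proof.
move=> T0 L0; have [C C0 hC] := gauss_dominated 0 L T0.
pose D := C * (1 + 2 * L / T).
have D1 : 0 <= 2 * L / T by rewrite divr_ge0 ?mulr_ge0// ltW.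
have D0 : 0 <= D by rewrite mulr_ge0// addr_ge0.
exists (\prod_(i < N) D); first exact: prodr_ge0.
move=> t x y /andP[t1 t2] hx Lx; have t0 : 0 < t by rewrite (lt_le_trans _ t1)// divr_gt0.
rewrite /kern /wgt -big_split/=; apply: ler_prod => i _.
rewrite k1_ge0//=; last by move=> im; exact: hx.
have gi : gauss t (x ord0 i - y ord0 i) <= C * gauss (4 * T) (y ord0 i).
  have -> : gauss (4 * T) (y ord0 i) = gauss (4 * T) (0 - y ord0 i) by rewrite sub0r gaussN.
  apply: hC; last by rewrite subr0; exact: Lx.
  by rewrite t1 (le_trans t2)// ler_peMl ?ler1n// ltW.
have CD : C <= D by rewrite /D ler_peMr// lerDl.
have g0 := gauss_ge0 (4 * T) (y ord0 i).
rewrite /wgt1; case: (boolP (i < m)%N) => im.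
  apply: (le_trans (k1_le_weight _ t0 (hx i im))).
  have xL : x ord0 i <= L by apply: le_trans (ler_norm _) (Lx i).
  apply: (@le_trans _ _ (C * gauss (4 * T) (y ord0 i) * (2 * L / T * `|y ord0 i|))).
    apply: ler_pM => //; rewrite ?gauss_ge0//.
      by rewrite divr_ge0 ?mulr_ge0 ?hx// ltW.
    rewrite mulrAC; apply: ler_wpM2r => //.
    apply: (@le_trans _ _ (L / t)); first by rewrite ler_wpM2r// invr_ge0 ltW.
    rewrite (_ : 2 * L / T = L / (T / 2)); last by field; rewrite gt_eqF.
    by rewrite ler_wpM2l// lef_pV2 ?posrE ?divr_gt0.
  rewrite (_ : C * _ * _ = C * (2 * L / T) * (`|y ord0 i| * gauss (4 * T) (y ord0 i))); last first.
    by move: (gauss _ _) (`|_|) => p q; ring.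
  apply: ler_wpM2r; first by rewrite mulr_ge0.
  by rewrite /D ler_wpM2l// lerDr.
rewrite mul1r; apply: (le_trans gi); exact: ler_wpM2r.
Qed.

(** Doubling the time frees a factor exp(a^2 / (8 tau)) >= 1 + a^2 / (8 tau), which absorbs |a| up
    to the constant 1 + 8 tau. *)
Lemma wgt1_le tau : 0 < tau -> exists2 C, 0 <= C & forall (c : bool) a, wgt1 c tau a <= C * gauss (2 * tau) a.
Proof.
move=> t0; have t2 : 0 < 2 * tau by rewrite mulr_gt0.
have s1 : 0 < Num.sqrt (4 * pi * (2 * tau)) by rewrite sqrtr_gt0 mulr_gt0// mulr_gt0// pi_gt0.
have s2 : 0 < Num.sqrt (4 * pi * tau) by rewrite sqrtr_gt0 mulr_gt0// mulr_gt0// pi_gt0.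
pose C := (1 + 8 * tau) * Num.sqrt (4 * pi * (2 * tau)) / Num.sqrt (4 * pi * tau).
have p0 : 0 <= 1 + 8 * tau by rewrite addr_ge0// mulr_ge0// ltW.
exists C; first by rewrite divr_ge0 ?mulr_ge0// ltW.
move=> c a.
have h1 : (if c then `|a| else 1) <= (1 + 8 * tau) * expR (a ^+ 2 / (8 * tau)).
  apply: (@le_trans _ _ ((1 + 8 * tau) * (1 + a ^+ 2 / (8 * tau)))); last first.
    by rewrite ler_wpM2l// expR_ge1Dx.
  have -> : (1 + 8 * tau) * (1 + a ^+ 2 / (8 * tau)) =
      1 + 8 * tau + a ^+ 2 / (8 * tau) + a ^+ 2 by field; rewrite gt_eqF.
  have q1 : 0 <= a ^+ 2 / (8 * tau) by rewrite divr_ge0 ?sqr_ge0// mulr_ge0// ltW.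
  have q2 := sqr_ge0 a.
  case: c; last by lra.
  have := sqr_ge0 (`|a| - 1); rewrite sqrrB real_normK ?num_real// expr1n mulr1.
  by rewrite -mulr_natl; have := normr_ge0 a; lra.
rewrite /wgt1 !gaussE//.
have -> : C * ((Num.sqrt (4 * pi * (2 * tau)))^-1 * expR (- a ^+ 2 / (4 * (2 * tau)))) =
  ((1 + 8 * tau) * expR (a ^+ 2 / (8 * tau))) *
  ((Num.sqrt (4 * pi * tau))^-1 * expR (- a ^+ 2 / (4 * tau))).
  rewrite (_ : - a ^+ 2 / (4 * (2 * tau)) = a ^+ 2 / (8 * tau) + - a ^+ 2 / (4 * tau)).
    by rewrite expRD /C; field; rewrite !gt_eqF.
  by field; rewrite gt_eqF.
by rewrite ler_wpM2r// mulr_ge0 ?invr_ge0 ?sqrtr_ge0 ?expR_ge0.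
Qed.

Lemma wgt_le tau : 0 < tau -> exists2 C, 0 <= C & forall y, wgt tau y <= C * gauss_row (2 * tau) 0 y.
Proof.
move=> t0; have [C C0 hC] := wgt1_le t0.
exists (\prod_(i < N) C); first exact: prodr_ge0.
move=> y; rewrite /wgt /gauss_row -big_split/=; apply: ler_prod => i _.
by rewrite wgt1_ge0 mxE sub0r gaussN; exact: hC.
Qed.

Lemma integral_wgt_lty tau : 0 < tau -> (\int[mu]_y (wgt tau y)%:E < +oo)%E.
Proof.
move=> t0; have [C C0 hC] := wgt_le t0.
have mg := measurable_gauss_row (2 * tau) (0 : 'rV[R]_N).
apply: (@le_lt_trans _ _ (\int[mu]_y (C * gauss_row (2 * tau) 0 y)%:E)%E).
  apply: le_integral_EFin => //; first exact: measurable_wgt.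
  - exact: measurable_funM.
  - exact: wgt_ge0.
rewrite (integral_EFinZ _ mg)//; last by move=> y; exact: gauss_row_ge0.
by rewrite integral_gauss_row ?mulr_gt0// mule1 ltry.
Qed.

Lemma wgt_bounded tau : 0 < tau -> exists2 C, 0 <= C & forall y, wgt tau y <= C.
Proof.
move=> t0; have [C C0 hC] := wgt_le t0; have t2 : 0 < 2 * tau by rewrite mulr_gt0.
exists (C * \prod_(i < N) gauss (2 * tau) 0).
  by rewrite mulr_ge0//; apply: prodr_ge0 => i _; exact: gauss_ge0.
move=> y; apply: (le_trans (hC y)); apply: ler_wpM2l => //; apply: ler_prod => i _.
by rewrite gauss_ge0 gauss_le0.
Qed.

Lemma gauss_scale tau lam a : 0 < tau -> 0 < lam ->
  gauss tau (a / lam) = lam * gauss (lam ^+ 2 * tau) a.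
Proof.
move=> t0 l0; have l2 : 0 < lam ^+ 2 by rewrite exprn_gt0.
rewrite !gaussE ?mulr_gt0//.
rewrite (_ : 4 * pi * (lam ^+ 2 * tau) = lam ^+ 2 * (4 * pi * tau)); last by ring.
have -> : - a ^+ 2 / (4 * (lam ^+ 2 * tau)) = - (a / lam) ^+ 2 / (4 * tau).
  by field; rewrite !gt_eqF.
rewrite [Num.sqrt (lam ^+ 2 * _)]sqrtrM ?(ltW l2)// sqrtr_sqr gtr0_norm// (invfM lam).
by rewrite -(mulrA lam^-1) mulVKf ?gt_eqF.
Qed.

Lemma wgt_scale tau lam : 0 < tau -> 0 < lam -> exists2 C, 0 <= C &
  forall y, wgt tau (lam^-1 *: y) = C * wgt (lam ^+ 2 * tau) y.
Proof.
move=> t0 l0; exists (\prod_(i < N) (if (i < m)%N then 1 else lam)).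
  by apply: prodr_ge0 => i _; case: ifP => // _; exact: ltW.
move=> z; rewrite /wgt -big_split/=; apply: eq_bigr => i _.
rewrite mxE (mulrC _ (z _ _)) /wgt1 gauss_scale//; case: ifP => _; last by rewrite !mul1r.
by rewrite normrM normfV (gtr0_norm l0) mul1r; field; rewrite gt_eqF.
Qed.

End singular_weight.

(** * Weighted convergence to the initial value *)

Section weighted_convergence.
Context {R : realType} {N : nat}.
Variables (m : nat) (gam : R).
Hypotheses (m_ge1 : (1 <= m)%N) (m_leN : (m <= N)%N).
Hypotheses (gam_gt0 : 0 < gam) (gam_ltN : gam < N%:R).
Local Notation mu := (@lebesgue_row R N).
Local Notation leb := (@lebesgue_measure R).
Implicit Types (a b t s c d e L M T tau lam : R) (x y z : 'rV[R]_N).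
Implicit Types (psi : 'rV[R]_N -> R).

Lemma Xnorm_ae psi M : (Xnorm m gam psi <= M%:E)%E ->
  {ae mu, forall x, Omega m x -> `|rho m gam x * psi x| <= M}.
Proof.
rewrite /Xnorm unlock; case: ifPn => [_ /ess_supP|mu0 _].
  apply: filterS => x /= + Ox; rewrite patchE mem_set//= lee_fin; exact.
(* The remaining branch of the definition of the sup norm: if the whole space is null, every
   property holds almost everywhere. *)
have {mu0} : mu setT = 0%E by apply/eqP; rewrite -measure_le0 leNgt.
by move=> E; exists setT.
Qed.

(** Zero raised to a negative power is 0 and not infinite, so the product majorant [sing] fails on
    coordinate hyperplanes; these are null. *)
Lemma coord_neq0_ae : {ae mu, forall x, forall j, x ord0 j != 0}.
Proof.
apply: filter_forall => j.
exists [set x : 'rV[R]_N | forall i, (if i == j then [set 0] else setT) (x ord0 i)]; split.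
- rewrite (_ : [set _ | _] = (fun x : 'rV[R]_N => x ord0 j) @^-1` [set 0]).
    by rewrite -[X in measurable X]setTI; apply: measurable_coord.
  apply/seteqP; split => x /=; first by move=> /(_ j); rewrite eqxx.
  by move=> xj i; case: eqP => [->|].
- rewrite (@lebesgue_row_prod _ _ (fun i => if i == j then [set 0] else setT)); last first.
    by move=> i; case: ifP.
  by rewrite (bigD1 j)//= eqxx lebesgue_measure_set1 mul0e.
- move=> x /= /negP; rewrite negbK => /eqP xj i.
  by case: eqP => [->|].
Qed.

Lemma Omega_enorm_gt0 x : Omega m x -> 0 < enorm x.
Proof.
move=> Ox; have N0 : (0 < N)%N by exact: leq_trans m_leN.
have := Ox (Ordinal N0) m_ge1; move/lt_le_trans; apply.
by apply: le_trans (ler_norm _) (enorm_ge _ _).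
Qed.

Lemma coord_prod_gt0 x : Omega m x -> 0 < coord_prod m x.
Proof. by move=> Ox; apply: prodr_gt0 => i im; exact: Ox. Qed.

Lemma coord_prod_le x : Omega m x -> coord_prod m x <= enorm x ^+ m.
Proof.
move=> Ox; have -> : enorm x ^+ m = \prod_(i < N | (i < m)%N) enorm x.
  by rewrite -(big_ord_widen N (fun=> enorm x) m_leN) prodr_const card_ord.
apply: ler_prod => i im; rewrite ltW ?Ox//=.
by apply: le_trans (ler_norm _) (enorm_ge _ _).
Qed.

Lemma wgtE tau x : Omega m x -> wgt m tau x = coord_prod m x * \prod_i gauss tau (x ord0 i).
Proof.
move=> Ox; rewrite /wgt big_split/=; congr (_ * _).
rewrite /coord_prod [RHS]big_mkcond/=; apply: eq_bigr => i _.
by case: ifP => // im; rewrite gtr0_norm// Ox.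
Qed.

(* [|x|^(-gam) <= \prod_j |x_j|^(-gam / N)] reduces the integrability of the
   singularity at the origin to dimension one. *)
Definition sing tau x : R := \prod_(i < N) singular tau (gam / N%:R) (x ord0 i).

Lemma sing_ge0 tau x : 0 <= sing tau x.
Proof. by apply: prodr_ge0 => i _; exact: singular_ge0. Qed.

Lemma measurable_sing tau : measurable_fun [set: 'rV[R]_N] (sing tau).
Proof.
apply: (@measurable_coord_prod _ _ (fun i a => singular tau (gam / N%:R) a)) => i.
exact: measurable_singular.
Qed.

Lemma prode_lty n (I : 'I_n -> \bar R) : (forall i, 0 <= I i < +oo)%E ->
  (0 <= \prod_i I i < +oo)%E.
Proof.
move=> h; apply: (@big_ind _ (fun p => 0 <= p < +oo)%E) => //.
- by rewrite lee_fin ler01 ltry.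
- move=> p q /andP[p0 p1] /andP[q0 q1]; rewrite mule_ge0//=.
  by apply: lte_mul_pinfty => //; rewrite ge0_fin_numE.
Qed.

Let N_gt0 : 0 < N%:R :> R. Proof. exact: lt_trans gam_ltN. Qed.

Let beta01 : 0 < gam / N%:R < 1.
Proof. by rewrite divr_gt0//= ltr_pdivrMr// mul1r. Qed.

Lemma integral_sing_lty tau : 0 < tau -> (\int[mu]_x (sing tau x)%:E < +oo)%E.
Proof.
move=> t0; rewrite (@integral_row_prod _ _ (fun i a => singular tau (gam / N%:R) a)).
- have h : forall i : 'I_N, (0 <= \int[leb]_a (singular tau (gam / N%:R) a)%:E < +oo)%E.
    move=> i; rewrite integral_singular_lty// andbT.
    by apply: integral_EFin_ge0 => a; exact: singular_ge0.
  by have := prode_lty h => /andP[].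
- by move=> i; exact: measurable_singular.
- by move=> i a; exact: singular_ge0.
Qed.

(** The X-norm gives |psi| <= M x_1 ... x_m |x|^(- gam - 2 m), the weight contributes a second
    factor x_1 ... x_m, and x_1 ... x_m <= |x|^m. What remains is M |x|^(- gam) times a Gaussian. *)
Lemma wgt_le_sing tau psi M x : Omega m x -> (forall j, x ord0 j != 0) ->
  `|rho m gam x * psi x| <= M -> wgt m tau x * `|psi x| <= M * sing tau x.
Proof.
move=> Ox xn0; rewrite /rho.
have E0 := Omega_enorm_gt0 Ox; have cp0 := coord_prod_gt0 Ox.
have Eg : 0 < enorm x `^ (gam + 2 * m%:R) by rewrite powR_gt0.
rewrite normrM (gtr0_norm (divr_gt0 Eg cp0)) => hM.
have M0 : 0 <= M by apply: le_trans hM; rewrite mulr_ge0// divr_ge0// ltW.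
have psiM : `|psi x| <= M * (coord_prod m x / enorm x `^ (gam + 2 * m%:R)).
  by rewrite mulrA ler_pdivlMr//; move: hM; rewrite mulrAC ler_pdivrMr// (mulrC (_ `^ _)).
have G0 : 0 <= \prod_i gauss tau (x ord0 i) by apply: prodr_ge0 => i _; exact: gauss_ge0.
rewrite (wgtE _ Ox); apply: (@le_trans _ _ (coord_prod m x * \prod_i gauss tau (x ord0 i) *
    (M * (coord_prod m x / enorm x `^ (gam + 2 * m%:R))))).
  by apply: ler_wpM2l => //; rewrite mulr_ge0// ltW.
have key : coord_prod m x * (coord_prod m x / enorm x `^ (gam + 2 * m%:R)) <=
    enorm x `^ (- gam).
  rewrite powRD; last by rewrite (gt_eqF E0) implybT.
  have -> : enorm x `^ (2 * m%:R) = enorm x ^+ m * enorm x ^+ m.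
    by rewrite -exprD addnn -mul2n -powR_mulrn ?ltW// natrM.
  have Em : 0 < enorm x ^+ m by rewrite exprn_gt0.
  rewrite powRN mulrA ler_pdivrMr; last by rewrite !mulr_gt0// powR_gt0.
  rewrite mulKf ?gt_eqF ?powR_gt0//; apply: ler_pM; rewrite ?(ltW cp0)//; exact: coord_prod_le.
have sp : enorm x `^ (- gam) * \prod_i gauss tau (x ord0 i) <= sing tau x.
  have -> : enorm x `^ (- gam) = \prod_(i < N) enorm x `^ (- (gam / N%:R)).
    rewrite prodr_const card_ord -powR_mulrn ?powR_ge0// -powRrM; congr (_ `^ _).
    by field; rewrite gt_eqF.
  rewrite -big_split/= /sing; apply: ler_prod => i _.
  rewrite mulr_ge0 ?powR_ge0 ?gauss_ge0//= mulrC /singular; apply: ler_wpM2l; first exact: gauss_ge0.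
  have xi : 0 < `|x ord0 i| by rewrite normr_gt0.
  rewrite !powRN lef_pV2 ?posrE ?powR_gt0//.
  apply: ge0_ler_powR; rewrite ?nnegrE ?(ltW E0)//; last exact: enorm_ge.
  by have /andP[/ltW] := beta01.
rewrite (_ : _ * _ * _ = M * (coord_prod m x * (coord_prod m x / enorm x `^ (gam + 2 * m%:R)) *
   \prod_i gauss tau (x ord0 i))); last first.
  by move: (coord_prod m x) (\prod_i _) (_ `^ _)^-1 => p q r; ring.
apply: ler_wpM2l => //; apply: le_trans sp; exact: ler_wpM2r.
Qed.

(** Compact boxes that increase to [Omega]: on each of them the L^1_loc convergence applies and the
    dilated initial value becomes large. *)
Definition exhaust (n : nat) : set 'rV[R]_N :=
  [set x | forall i : 'I_N, (if (i < m)%N then n.+1%:R^-1 else - n.+1%:R) <= x ord0 i <= n.+1%:R].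

Lemma exhaust_sub n : exhaust n `<=` Omega m.
Proof.
move=> x h i im; have := h i; rewrite im => /andP[h1 _]; apply: lt_le_trans h1.
by rewrite invr_gt0.
Qed.

Lemma measurable_exhaust n : measurable (exhaust n).
Proof.
rewrite (_ : exhaust n = \bigcap_(i in [set: 'I_N]) ((fun x : 'rV[R]_N => x ord0 i) @^-1`
   [set` `[(if (i < m)%N then n.+1%:R^-1 else - n.+1%:R), n.+1%:R]%R])).
  apply: fin_bigcap_measurable => // i _.
  by rewrite -[X in measurable X]setTI; exact: measurable_coord.
by apply/seteqP; split=> x /= h i; have := h i; rewrite /= in_itv/=; [|exact].
Qed.

Lemma exhaust_eventually x : Omega m x -> exists n0, forall n, (n0 <= n)%N -> exhaust n x.
Proof.
(* A single number above every |x_i| and every 1/|x_i|; a vanishing coordinate is harmless, since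
   its inverse is 0. *)
move=> Ox; pose B := \sum_i (`|x ord0 i| + `|x ord0 i|^-1).
have B0 : 0 <= B by apply: sumr_ge0 => i _; rewrite addr_ge0// invr_ge0.
exists (Num.bound B) => n hn i.
have Bn : B <= n.+1%:R.
  rewrite ltW// (lt_le_trans (archi_boundP B0))// ler_nat (leq_trans hn)//.
have Bi : `|x ord0 i| + `|x ord0 i|^-1 <= n.+1%:R.
  apply: le_trans Bn; rewrite /B (bigD1 i)//= lerDl.
  by apply: sumr_ge0 => j _; rewrite addr_ge0// invr_ge0.
have a0 := normr_ge0 (x ord0 i); have ai0 : 0 <= `|x ord0 i|^-1 by rewrite invr_ge0.
have h1 : `|x ord0 i| <= n.+1%:R by apply: le_trans Bi; rewrite lerDl.
have := h1; rewrite ler_norml => /andP[h2 h3]; rewrite h3 andbT.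
case: ifP => // im; have xi := Ox i im.
rewrite invf_ple ?posrE// -[in leLHS](gtr0_norm xi); apply: le_trans Bi; rewrite lerDr//.
Qed.

Lemma tail_vanish (f : 'rV[R]_N -> R) e : measurable_fun setT f -> (forall x, 0 <= f x) ->
  (\int[mu]_x (f x)%:E < +oo)%E -> 0 < e ->
  exists n, (\int[mu]_(x in Omega m `\` exhaust n) (f x)%:E < e%:E)%E.
Proof.
move=> mf f0 foo e0.
have mfE : measurable_fun [set: 'rV[R]_N] (fun x => (f x)%:E) by exact/measurable_EFinP.
have mD n : measurable (Omega m `\` exhaust n).
  by apply: measurableD; [exact: measurable_Omega|exact: measurable_exhaust].
have isg : mu.-integrable setT (fun x => (f x)%:E).
  by apply/integrableP; split => //; under eq_integral do rewrite gee0_abs ?lee_fin//.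
pose fn n := (fun x => (f x)%:E) \_ (Omega m `\` exhaust n).
have [||||_ _] := @dominated_convergence _ _ _ mu setT measurableT fn (cst 0%E) _ _ _ _ isg.
- move=> n; apply: (measurable_restrictT (fun x => (f x)%:E) (mD n)).1.
  exact: measurable_funTS.
- exact: measurable_cst.
- apply: aeW => x _; apply: cvg_near_cst.
  have [Ox|nO] := pselect (Omega m x); last first.
    by apply: nearW => n; rewrite /fn patchE; case: ifPn => // /set_mem[].
  have [n0 hn] := exhaust_eventually Ox; exists n0 => // n /= nn.
  by rewrite /fn patchE; case: ifPn => // /set_mem[_]; case; exact: hn.
- apply: aeW => x n _; rewrite /fn patchE; case: ifPn => _.
    by rewrite gee0_abs// lee_fin.
  by rewrite abse0 lee_fin.
rewrite integral0 => /fine_cvgP[nfin /cvgrPdist_lt/(_ e e0) nlt].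
have [n _ /(_ n (leqnn n)) [h1 h2]] := filterI nfin nlt.
exists n; rewrite integral_mkcond -/(fn n); move: h1 h2; rewrite /= sub0r normrN => h1 h2.
by rewrite -(fineK h1) lte_fin; exact: le_lt_trans (ler_norm _) h2.
Qed.

(** Off a large compact box the integrable function 2 M [sing] dominates, uniformly in s, by the
    X-norm bounds; on the box the weight is bounded and L^1_loc convergence finishes. *)
Lemma weighted_vanish tau psi (u : R -> 'rV[R]_N -> R) M e : 0 < tau ->
  measurable_fun (Omega m) psi -> (forall s, 0 < s -> measurable_fun (Omega m) (u s)) ->
  (Xnorm m gam psi <= M%:E)%E -> (forall s, (0 < s)%R -> Xnorm m gam (u s) <= M%:E)%E ->
  L1loc_initial_value m u psi -> 0 <= M -> 0 < e ->
  exists2 d, 0 < d & forall s, 0 < s < d ->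
    (\int[mu]_(x in Omega m) (wgt m tau x * `|u s x - psi x|)%:E < e%:E)%E.
Proof.
move=> t0 mpsi mus Xpsi Xu L1 M0 e0.
have e2 : 0 < e / 2 by rewrite divr_gt0.
have M20 : 0 <= 2 * M by rewrite mulr_ge0.
have msing : measurable_fun [set: 'rV[R]_N] (fun x => 2 * M * sing tau x).
  by apply: measurable_funM => //; exact: measurable_sing.
have sing_lty : (\int[mu]_x (2 * M * sing tau x)%:E < +oo)%E.
  have -> : (\int[mu]_x (2 * M * sing tau x)%:E = (2 * M)%:E * \int[mu]_x (sing tau x)%:E)%E.
    by apply: integral_EFinZ => //; [exact: measurable_sing|move=> x; exact: sing_ge0].
  by apply: lte_mul_pinfty; rewrite ?lee_fin//; exact: integral_sing_lty.
have [|n hn] := tail_vanish msing _ sing_lty e2.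
  by move=> x; rewrite mulr_ge0 ?sing_ge0.
have [C C0 hC] := wgt_bounded m (N := N) t0.
have Cp : 0 < C + 1 by rewrite ltr_wpDl.
have cK : compact (exhaust n).
  exact: (@compact_coord_box _ _
    (fun i : 'I_N => if (i < m)%N then n.+1%:R^-1 else - n.+1%:R) (fun=> n.+1%:R)).
have /fine_cvgP[nfin /cvgrPdist_lt/(_ _ (divr_gt0 e2 Cp)) nlt] := L1 _ cK (@exhaust_sub n).
have [d /= d0 hd] := filterI nfin nlt.
exists d => // s /andP[s0 sd].
have [|h1 h2] := hd s _ s0; first by rewrite /= sub0r normrN gtr0_norm.
have mO := measurable_Omega m (R := R) (N := N).
have mK := measurable_exhaust n.
have mdiff : measurable_fun (Omega m) (fun x => `|u s x - psi x|).
  apply: (measurableT_comp (@normr_measurable R setT)).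
  by apply: measurable_funB => //; exact: mus.
have mint : measurable_fun (Omega m) (fun x => (wgt m tau x * `|u s x - psi x|)%:E).
  apply/measurable_EFinP; apply: measurable_funM => //.
  by apply: measurable_funTS; exact: measurable_wgt.
have int0 x : (0 <= (wgt m tau x * `|u s x - psi x|)%:E)%E.
  by rewrite lee_fin mulr_ge0 ?wgt_ge0.
have OE : Omega m = exhaust n `|` (Omega m `\` exhaust n) :> set 'rV[R]_N.
  by rewrite setDUK//; exact: exhaust_sub.
have hT : (\int[mu]_(x in Omega m `\` exhaust n) (wgt m tau x * `|u s x - psi x|)%:E < (e / 2)%:E)%E.
  apply: le_lt_trans hn; apply: ae_ge0_le_integral => //.
  + exact: measurableD.
  + by apply: measurable_funS mint => //; exact: subDsetl.
  + by move=> x _; rewrite lee_fin mulr_ge0 ?sing_ge0.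
  + by apply/measurable_EFinP; exact: measurable_funTS.
  have a1 := Xnorm_ae Xpsi; have a2 := Xnorm_ae (Xu s s0); have a3 := coord_neq0_ae.
  apply: filterS3 a1 a2 a3 => x h3 h4 h5 [Ox _]; rewrite lee_fin.
  have q1 := wgt_le_sing tau Ox h5 (h3 Ox); have q2 := wgt_le_sing tau Ox h5 (h4 Ox).
  apply: (@le_trans _ _ (wgt m tau x * (`|u s x| + `|psi x|))).
    by rewrite ler_wpM2l ?wgt_ge0// ler_normB.
  by rewrite mulrDr -mulrA mulr_natl mulr2n lerD.
rewrite OE ge0_integral_setU//; last 3 first.
- exact: measurableD.
- by rewrite -OE.
- by apply/disj_setPS => x [h []].
rewrite (splitr e) EFinD; apply: lteD => //.
have E1 : (\int[mu]_(x in exhaust n) (wgt m tau x * `|u s x - psi x|)%:E <=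
    C%:E * \int[mu]_(x in exhaust n) (`|u s x - psi x|)%:E)%E.
  rewrite -ge0_integralZl_EFin//.
  - apply: ge0_le_integral => //.
    + by apply: measurable_funS mint => //; exact: exhaust_sub.
    + apply: measurable_funeM; apply/measurable_EFinP.
      by apply: measurable_funS mdiff => //; exact: exhaust_sub.
    by move=> x _; rewrite -EFinM lee_fin ler_wpM2r.
  - by apply/measurable_EFinP; apply: measurable_funS mdiff => //; exact: exhaust_sub.
apply: (le_lt_trans E1); move: h1 h2; rewrite /= sub0r normrN => h1 h2.
rewrite -(fineK h1) -EFinM lte_fin.
apply: (@le_lt_trans _ _ (C * (e / 2 / (C + 1)))).
  by rewrite ler_wpM2l// ltW// (le_lt_trans (ler_norm _)).
by rewrite mulrC mulrAC ltr_pdivrMr// ltr_pM2l// ltrDl.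
Qed.

End weighted_convergence.

(** * Dilations of the initial value *)

Section dilated_data.
Context {R : realType} {N : nat}.
Variables (m : nat) (gam : R).
Hypotheses (m_ge1 : (1 <= m)%N) (m_leN : (m <= N)%N).
Hypotheses (gam_gt0 : 0 < gam) (gam_ltN : gam < N%:R).
Local Notation mu := (@lebesgue_row R N).
Implicit Types (a b t s c d e L M T tau lam : R) (x y z : 'rV[R]_N).

Lemma integral_scale lam (f : 'rV[R]_N -> \bar R) : 0 < lam ->
  measurable_fun setT f -> (forall x, 0 <= f x)%E ->
  (\int[mu]_x f (lam *: x) = (\prod_(i < N) lam^-1)%R%:E * \int[mu]_x f x)%E.
Proof.
move=> l0 mf f0; have -> : \prod_(i < N) lam^-1 = \prod_(i < N) `|(const_mx lam : 'rV[R]_N) ord0 i|^-1.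
  by apply: eq_bigr => i _; rewrite mxE gtr0_norm.
rewrite -(@integral_row_affine _ _ _ 0)//; last by move=> i; rewrite mxE gt_eqF.
apply: eq_integral => x _; congr (f _).
by apply/rowP => i; rewrite !mxE addr0.
Qed.

Lemma integral_Omega_scale lam (f : 'rV[R]_N -> \bar R) : 0 < lam ->
  measurable_fun (Omega m) f -> (forall x, 0 <= f x)%E ->
  (\int[mu]_(x in Omega m) f (lam *: x) =
   (\prod_(i < N) lam^-1)%R%:E * \int[mu]_(x in Omega m) f x)%E.
Proof.
move=> l0 mf f0; rewrite integral_mkcond [in RHS]integral_mkcond -integral_scale//.
- apply: eq_integral => x _; rewrite !patchE.
  have -> // : (x \in Omega m) = (lam *: x \in Omega m).
  by apply/idP/idP => /set_mem h; apply/mem_set; [exact: Omega_scale|exact: Omega_scaleV h].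
- exact: (measurable_restrictT f (measurable_Omega m)).1.
- by move=> x; rewrite patchE; case: ifP.
Qed.

Lemma measurable_scale lam : measurable_fun [set: 'rV[R]_N] (fun x => lam *: x).
Proof.
apply: measurable_fun_row => i; rewrite (_ : (fun _ => _) = fun x : 'rV[R]_N => lam * x ord0 i).
  by apply: measurable_funM => //; exact: measurable_coord.
by apply/funext => x; rewrite mxE.
Qed.

Lemma measurable_Omega_scale lam (f : 'rV[R]_N -> R) : 0 < lam ->
  measurable_fun (Omega m) f -> measurable_fun (Omega m) (fun x => f (lam *: x)).
Proof.
move=> l0 mf; apply: (measurable_comp (measurable_Omega m) _ mf).
  by move=> _ [x Ox <-]; exact: Omega_scale.
by apply: measurable_funTS; exact: measurable_scale.
Qed.

Lemma ae_scale lam (P : 'rV[R]_N -> Prop) : 0 < lam ->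
  {ae mu, forall x, P x} -> {ae mu, forall x, P (lam *: x)}.
Proof.
move=> l0 [A [mA A0 hA]].
have mB : measurable ((fun x : 'rV[R]_N => lam *: x) @^-1` A).
  by rewrite -[X in measurable X]setTI; exact: measurable_scale.
exists ((fun x : 'rV[R]_N => lam *: x) @^-1` A); split => //; last by move=> x h; exact: hA.
have E B : measurable B -> (\int[mu]_x (\1_B x)%:E = mu B)%E.
  by move=> hB; rewrite integral_indic// setIT.
rewrite -(E _ mB); have := @integral_scale lam (fun x => (\1_A x)%:E) l0.
rewrite (E _ mA) A0 mule0; apply.
- by apply/measurable_EFinP; exact: measurable_indic.
- by move=> x; rewrite lee_fin.
Qed.

(** The dilation factor is fixed while s tends to 0: a change of variables turns the weight into a
    multiple of the one with time lam^2 tau, to which [weighted_vanish] applies. *)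
Lemma weighted_vanish_scale tau lam psi (u : R -> 'rV[R]_N -> R) M e : 0 < tau -> 0 < lam ->
  measurable_fun (Omega m) psi -> (forall s, 0 < s -> measurable_fun (Omega m) (u s)) ->
  (Xnorm m gam psi <= M%:E)%E -> (forall s, (0 < s)%R -> Xnorm m gam (u s) <= M%:E)%E ->
  L1loc_initial_value m u psi -> 0 <= M -> 0 < e ->
  exists2 d, 0 < d & forall s, 0 < s < d ->
    (\int[mu]_(x in Omega m)
      (wgt m tau x * `|u (lam ^+ 2 * s) (lam *: x) - psi (lam *: x)|)%:E < e%:E)%E.
Proof.
move=> t0 l0 mpsi mus Xpsi Xu L1 M0 e0.
have [C C0 hC] := wgt_scale m (N := N) t0 l0.
pose A := \prod_(i < N) lam^-1.
have A0 : 0 < A by apply: prodr_gt0 => i _; rewrite invr_gt0.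
have l2 : 0 < lam ^+ 2 by rewrite exprn_gt0.
have AC0 : 0 < A * C + 1 by rewrite ltr_wpDl// mulr_ge0// ltW.
have [d d0 hd] := weighted_vanish m_ge1 m_leN gam_gt0 gam_ltN (mulr_gt0 l2 t0)
  mpsi mus Xpsi Xu L1 M0 (divr_gt0 e0 AC0).
exists (d / lam ^+ 2); first exact: divr_gt0.
move=> s /andP[s0 sd]; have ls0 : 0 < lam ^+ 2 * s by exact: mulr_gt0.
have {hd} := hd (lam ^+ 2 * s); rewrite ls0 (mulrC _ s) -ltr_pdivlMr// sd => /(_ isT).
rewrite (mulrC s); set q := u (lam ^+ 2 * s) => hI.
have mq : measurable_fun (Omega m) (fun z => `|q z - psi z|).
  apply: (measurableT_comp (@normr_measurable R setT)).
  by apply: measurable_funB => //; exact: mus.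
pose f (z : 'rV[R]_N) := (C * (wgt m (lam ^+ 2 * tau) z * `|q z - psi z|))%:E.
have mf0 : measurable_fun (Omega m) (fun z => (wgt m (lam ^+ 2 * tau) z * `|q z - psi z|)%:E).
  apply/measurable_EFinP; apply: measurable_funM => //.
  by apply: measurable_funTS; exact: measurable_wgt.
have mf : measurable_fun (Omega m) f.
  by rewrite /f; under eq_fun do rewrite EFinM; exact: measurable_funeM.
have f00 z : 0 <= wgt m (lam ^+ 2 * tau) z * `|q z - psi z| by rewrite mulr_ge0// wgt_ge0.
have f0 z : (0 <= f z)%E by rewrite lee_fin mulr_ge0.
have -> : (\int[mu]_(x in Omega m) (wgt m tau x * `|q (lam *: x) - psi (lam *: x)|)%:E =
    \int[mu]_(x in Omega m) f (lam *: x))%E.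
  apply: eq_integral => x _; rewrite /f mulrA -hC scalerA mulVf ?gt_eqF// scale1r//.
rewrite integral_Omega_scale//.
have -> : (\int[mu]_(x in Omega m) f x =
    C%:E * \int[mu]_(x in Omega m) (wgt m (lam ^+ 2 * tau) x * `|q x - psi x|)%:E)%E.
  rewrite /f; under eq_integral do rewrite EFinM.
  apply: ge0_integralZl_EFin => //; first exact: measurable_Omega.
  by move=> z _; rewrite lee_fin.
have I0 : (0 <= \int[mu]_(x in Omega m) (wgt m (lam ^+ 2 * tau) x * `|q x - psi x|)%:E)%E.
  by apply: integral_ge0 => z _; rewrite lee_fin.
move: I0 hI; rewrite -/A; case: (\int[mu]_(x in _) _)%E => // r; rewrite lee_fin lte_fin => r0 hr.
rewrite -!EFinM lte_fin mulrA; apply: (@le_lt_trans _ _ (A * C * (e / (A * C + 1)))).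
  by rewrite ler_wpM2l ?(ltW hr)// mulr_ge0// ltW.
by rewrite mulrA ltr_pdivrMr// mulrC ltr_pM2l// ltrDl.
Qed.

Lemma coord_prodZ lam x : coord_prod m (lam *: x) = lam ^+ m * coord_prod m x.
Proof.
have -> : lam ^+ m = \prod_(i < N | (i < m)%N) lam.
  by rewrite -(big_ord_widen N (fun=> lam) m_leN) prodr_const card_ord.
by rewrite -big_split/=; apply: eq_bigr => i _; rewrite mxE.
Qed.

Lemma psi0Z lam x : 0 < lam -> psi0 m gam (lam *: x) = lam `^ (- gam - m%:R) * psi0 m gam x.
Proof.
move=> l0; rewrite /psi0 coord_prodZ enormZ (gtr0_norm l0) powRM ?(ltW l0)//; last exact: sqrtr_ge0.
have -> : lam `^ (- gam - m%:R) = lam ^+ m * lam `^ (- gam - 2 * m%:R).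
  rewrite -powR_mulrn ?(ltW l0)// -powRD; last by rewrite (gt_eqF l0) implybT.
  by congr (_ `^ _); ring.
by move: (\prod_(k < m) _) (_ `^ _) (enorm x `^ _) => p q r; ring.
Qed.

Lemma psi0_exhaust n : exists2 q, 0 < q & forall y, exhaust m n y -> q <= psi0 m gam y.
Proof.
pose P := \prod_(k < m) (gam + 2 * k%:R : R).
have P0 : 0 < P by apply: prodr_gt0 => k _; rewrite ltr_wpDr// mulr_ge0.
have n0 : 0 < n.+1%:R :> R by [].
have N0 : 0 < N%:R :> R by exact: lt_trans gam_ltN.
have B0 : 0 < N%:R * n.+1%:R :> R by exact: mulr_gt0.
exists (P * n.+1%:R^-1 ^+ m * (N%:R * n.+1%:R) `^ (- gam - 2 * m%:R)).
  by rewrite !mulr_gt0// ?powR_gt0// exprn_gt0// invr_gt0.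
move=> y hy; have Oy := exhaust_sub hy; have E0 := Omega_enorm_gt0 m_ge1 m_leN Oy.
rewrite /psi0 -/P; apply: ler_pM.
- by rewrite mulr_ge0 ?(ltW P0)// exprn_ge0// invr_ge0.
- exact: powR_ge0.
- rewrite ler_wpM2l ?(ltW P0)//.
  have -> : n.+1%:R^-1 ^+ m = \prod_(i < N | (i < m)%N) (n.+1%:R^-1 : R).
    by rewrite -(big_ord_widen N (fun=> n.+1%:R^-1) m_leN) prodr_const card_ord.
  apply: ler_prod => i im; rewrite invr_ge0 ltW//=.
  by have := hy i; rewrite im => /andP[].
have -> : - gam - 2 * m%:R = - (gam + 2 * m%:R) by rewrite opprD.
have g0 : 0 <= gam + 2 * m%:R by rewrite addr_ge0 ?(ltW gam_gt0)// mulr_ge0.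
rewrite !powRN lef_pV2 ?posrE ?powR_gt0//; apply: ge0_ler_powR => //; rewrite ?nnegrE ?(ltW E0) ?(ltW B0)//.
apply: enorm_le => // i; have := hy i; case: ifP => im /andP[h1 h2].
  by rewrite gtr0_norm// Oy.
by rewrite ler_norml h1.
Qed.

(** psi0 is homogeneous of degree - gam - m, so its dilation carries the power lam^sg with sg = 2 /
    alpha - gam - m, positive by the condition on alpha; on the compact box psi0 is bounded
    below. *)
Lemma psi0_dilation_large alpha c0 R0 n : 0 < alpha -> alpha < 2 / (gam + m%:R) ->
  0 < c0 -> exists2 Lam, 0 <= Lam & forall lam, Lam < lam -> forall y, exhaust m n y ->
    R0 <= enorm (lam *: y) /\ 1 <= lam `^ (2 / alpha) * (c0 * psi0 m gam (lam *: y)).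
Proof.
move=> a0 alt c00; have [q q0 hq] := psi0_exhaust n.
have gm0 : 0 < gam + m%:R by rewrite ltr_wpDr.
have sg0 : 0 < 2 / alpha - gam - m%:R.
  by rewrite -addrA -opprD subr_gt0 ltr_pdivlMr// mulrC -ltr_pdivlMr.
set sg := 2 / alpha - gam - m%:R in sg0.
have cq0 : 0 < c0 * q by exact: mulr_gt0.
(* The first summand brings lam y beyond radius R0, because |y| >= 1/(n+1) on the box; the second
   makes lam^sg at least 1 / (c0 q). *)
exists (`|R0| * n.+1%:R + (c0 * q)^-1 `^ sg^-1); first by rewrite addr_ge0 ?powR_ge0// mulr_ge0.
move=> lam hlam y hy; have E0 := Omega_enorm_gt0 m_ge1 m_leN (exhaust_sub hy).
have p0 : 0 <= (c0 * q)^-1 `^ sg^-1 by exact: powR_ge0.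
have R00 : 0 <= `|R0| * n.+1%:R by rewrite mulr_ge0.
have l1 : `|R0| * n.+1%:R < lam by apply: le_lt_trans hlam; rewrite lerDl.
have l2 : (c0 * q)^-1 `^ sg^-1 < lam by apply: le_lt_trans hlam; rewrite lerDr.
have l0 : 0 < lam by exact: le_lt_trans l1.
have N0 : (0 < N)%N by exact: leq_trans m_leN.
split.
  rewrite enormZ (gtr0_norm l0); apply: (@le_trans _ _ (lam * n.+1%:R^-1)).
    by rewrite ler_pdivlMr// ltW// (le_lt_trans _ l1)// ler_wpM2r// ler_norm.
  rewrite ler_wpM2l ?(ltW l0)//; have := hy (Ordinal N0); rewrite /= m_ge1 => /andP[h _].
  by apply: le_trans h _; apply: le_trans (ler_norm _) (enorm_ge _ _).
have h : 1 <= lam `^ sg * (c0 * q).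
  rewrite -ler_pdivrMr// div1r.
  have -> : (c0 * q)^-1 = ((c0 * q)^-1 `^ sg^-1) `^ sg.
    by rewrite -powRrM mulVf ?gt_eqF// powRr1// invr_ge0 ltW.
  by apply: ge0_ler_powR; rewrite ?nnegrE ?(ltW sg0) ?(ltW l0) ?(ltW l2).
apply: (le_trans h); rewrite psi0Z// (mulrCA c0) [leRHS]mulrA -powRD; last by rewrite (gt_eqF l0) implybT.
rewrite (_ : 2 / alpha + (- gam - m%:R) = sg); last by rewrite addrA.
by rewrite ler_wpM2l ?powR_ge0// ler_wpM2l ?(ltW c00)// hq.
Qed.

End dilated_data.

(** To be read with p = v, a = u at a small time, c = u0, and b for membership in a compact box.
    Where k c >= 1 >= p only the deviation of a from c can make the positive part nonzero; elsewhere
    at most 1 is added. *)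
Lemma max_sub_le (R : realType) (b : bool) (p k a c : R) : p <= 1 -> 0 <= k -> 0 <= c ->
  (b -> 1 <= k * c) -> Num.max 0 (p - k * a) <= (~~ b)%:R + k * `|a - c|.
Proof.
move=> p1 k0 c0 hb.
have h1 : k * (c - a) <= k * `|a - c| by rewrite ler_wpM2l// distrC ler_norm.
have h2 : 0 <= k * `|a - c| by rewrite mulr_ge0.
have h3 : 0 <= k * c by rewrite mulr_ge0.
rewrite mulrBr in h1; rewrite ge_max addr_ge0//=.
case: b hb => /= h; last by move: p1 h1 h3; clear; lra.
by move: (h isT) p1 h1; clear; lra.
Qed.

(** * The lower bound *)

Section lower_bound.
Context {R : realType} {N : nat}.
Variables (m : nat) (gam alpha : R).
Hypotheses (m_ge1 : (1 <= m)%N) (m_leN : (m <= N)%N).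
Hypotheses (gam_gt0 : 0 < gam) (gam_ltN : gam < N%:R).
Hypotheses (alpha_gt0 : 0 < alpha) (alpha_lt : alpha < 2 / (gam + m%:R)).
Local Notation mu := (@lebesgue_row R N).
Implicit Types (a b t s c d e L T tau lam : R) (x y z : 'rV[R]_N).

Lemma heat_le_wgt T L : 0 < T -> exists2 C, 0 <= C & forall t x (psi : 'rV[R]_N -> R),
  T / 2 <= t <= T -> in_closure m x -> box L x ->
  measurable_fun (Omega m) psi -> (forall y, 0 <= psi y) ->
  ((heat m t psi x)%:E <= C%:E * \int[mu]_(y in Omega m) (wgt m (4 * T) y * psi y)%:E)%E.
Proof.
move=> T0; have [C C0 hC] := kern_le_wgt m (N := N) T0 (normr_ge0 L).
exists C => // t x psi tT hx Lx mpsi psi0.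
have t0 : 0 < t by case/andP: tT => h _; apply: lt_le_trans h; rewrite divr_gt0.
have LLx : box `|L| x by move=> i; apply: le_trans (ler_norm L).
have mO := measurable_Omega m (R := R) (N := N).
pose J := (\int[mu]_(y in Omega m) (kern m t x y * psi y)%:E)%E.
have k0 y : 0 <= kern m t x y * psi y by rewrite mulr_ge0// kern_ge0.
have J0 : (0 <= J)%E by apply: integral_ge0 => y _; rewrite lee_fin.
have -> : heat m t psi x = fine J.
  rewrite heatE// /J integral_mkcond /Rintegral; congr fine.
  apply: eq_integral => y _; rewrite patchE; case: ifPn => // /negP nO.
  by rewrite kern_out ?mul0r// => Oy; apply: nO; exact/mem_set.
apply: (@le_trans _ _ J); first by case: (J) J0.
have mw : measurable_fun (Omega m) (fun y => (wgt m (4 * T) y * psi y)%:E).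
  apply/measurable_EFinP; apply: measurable_funM => //.
  by apply: measurable_funTS; exact: measurable_wgt.
rewrite -ge0_integralZl_EFin//; last by move=> y _; rewrite lee_fin mulr_ge0 ?wgt_ge0.
apply: ge0_le_integral => //.
- by move=> y _; rewrite lee_fin.
- apply/measurable_EFinP; apply: measurable_funM => //.
  by apply: measurable_funTS; exact: measurable_kern.
- exact: measurable_funeM.
- by move=> y _; rewrite -EFinM lee_fin mulrA ler_wpM2r// hC.
Qed.

Variables (v u : R -> 'rV[R]_N -> R) (u0 : 'rV[R]_N -> R) (M R0 c0 : R).
Hypothesis hv : mild_solution m alpha (cst 1) v.
Hypotheses (tu : tame m u) (pu : parabolic m alpha u).
Hypotheses (mu0 : measurable_fun (Omega m) u0) (M_ge0 : 0 <= M).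
Hypotheses (u0M : (Xnorm m gam u0 <= M%:E)%E) (uM : forall t, (0 < t)%R -> (Xnorm m gam (u t) <= M%:E)%E).
Hypothesis u_u0 : L1loc_initial_value m u u0.
Hypothesis u0_ge0 : {ae mu, forall x, Omega m x -> 0 <= u0 x}.
Hypothesis c0_gt0 : 0 < c0.
Hypothesis u0_lower : {ae mu, forall x, Omega m x -> R0 <= enorm x -> c0 * psi0 m gam x <= u0 x}.

Lemma rescale_ge_mild T L d : 0 < T -> 0 < d -> exists2 Lam, 0 <= Lam &
  forall lam x, Lam < lam -> in_closure m x -> box L x ->
    v T x - rescale (lam `^ (2 / alpha)) 0 lam u T x <= d.
Proof.
move=> T0 d0; have [C C0 hC] := heat_le_wgt L T0.
have T4 : 0 < 4 * T by rewrite mulr_gt0.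
have C1 : 0 < C + 1 by rewrite ltr_wpDl.
pose e := d / (C + 1) / 2.
have e0 : 0 < e by rewrite !divr_gt0.
have mW := measurable_wgt m (4 * T) (N := N).
(* The order of choices matters: n makes the weight small off the box, Lam depends on n, and only
   afterwards is the time s chosen, depending on lam. *)
have [n hn] := tail_vanish m mW (wgt_ge0 m (4 * T)) (integral_wgt_lty m T4) e0.
have [Lam Lam0 hLam] := psi0_dilation_large m_ge1 m_leN gam_gt0 gam_ltN R0 n alpha_gt0 alpha_lt c0_gt0.
exists Lam => // lam x lamL hx Lx; have l0 : 0 < lam by exact: le_lt_trans lamL.
have {}hLam := hLam lam lamL.
set k := lam `^ (2 / alpha) in hLam *.
have k0 : 0 <= k by exact: powR_ge0.
have k1 : 0 < k + 1 by rewrite ltr_wpDl.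
have mu_t t : 0 < t -> measurable_fun (Omega m) (u t) by move=> t0; exact: tame_measurable.
(* The tolerance is divided by k + 1 since the deviation of u from u0 is later multiplied by the
   amplitude k. *)
have [s1 s10 hs1] := weighted_vanish_scale m_ge1 m_leN gam_gt0 gam_ltN T4 l0
  mu0 mu_t u0M uM u_u0 M_ge0 (divr_gt0 e0 k1).
pose s := Num.min (T / 2) (s1 / 2).
have s0 : 0 < s by rewrite lt_min !divr_gt0.
have sT : s <= T / 2 by rewrite ge_min lexx.
have ss : s < s1.
  by apply: (@le_lt_trans _ _ (s1 / 2)); [rewrite ge_min lexx orbT|rewrite ltr_pdivrMr// ltr_pMr// ltr1n].
have sT' : s < T by apply: le_lt_trans sT _; rewrite ltr_pdivrMr// ltr_pMr// ltr1n.
have {}hs1 := hs1 s; rewrite s0 ss in hs1; have {}hs1 := hs1 isT.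
have [/C0bu_tame tv _ _] := hv.
have tw : tame m (rescale k 0 lam u) by exact: rescale_tame.
have pw : parabolic m alpha (rescale k 0 lam u).
  apply: rescale_parabolic => //; rewrite /k -powRrM divfK ?gt_eqF// powR_mulrn ?(ltW l0)//.
set w := rescale k 0 lam u in tw pw *.
have := comparison alpha_gt0 (mild_restart hv) tv tw pw _ hx; move=> /(_ s T).
rewrite s0 sT' => /(_ isT) hcmp; apply: (le_trans hcmp); rewrite -lee_fin.
set psi := (fun y => _).
have mpsi : measurable_fun (Omega m) psi.
  apply: measurable_maxr; first exact: measurable_cst.
  by apply: measurable_funB; exact: tame_measurable.
have psi_ge0 y : 0 <= psi y by rewrite /psi le_max lexx.
have Ts : T / 2 <= T - s <= T by rewrite gerBl (ltW s0) andbT lerBrDr [leRHS]splitr lerD2l.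
apply: (le_trans (hC _ _ _ Ts hx Lx mpsi psi_ge0)).
have mO := measurable_Omega m (R := R) (N := N).
have mE : measurable (~` exhaust m n : set 'rV[R]_N) by apply: measurableC; exact: measurable_exhaust.
(* The two terms of [max_sub_le] times the weight: [W1] is the weight off the box, [W2] the weighted
   deviation from the initial value. *)
pose W1 y := (((EFin \o wgt m (4 * T)) \_ (~` exhaust m n)) y : \bar R).
pose W2 y := (wgt m (4 * T) y * `|u (lam ^+ 2 * s) (lam *: y) - u0 (lam *: y)|)%:E.
have mW1 : measurable_fun (Omega m) W1.
  apply: measurable_funTS; apply: (measurable_restrictT (EFin \o wgt m (4 * T)) mE).1.
  by apply: measurable_funTS; exact/measurable_EFinP.
have W10 y : (0 <= W1 y)%E by rewrite /W1 patchE; case: ifP => // _; rewrite lee_fin wgt_ge0.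
have W20 y : (0 <= W2 y)%E by rewrite lee_fin mulr_ge0// wgt_ge0.
have l2s : 0 < lam ^+ 2 * s by rewrite mulr_gt0// exprn_gt0.
have mW2 : measurable_fun (Omega m) W2.
  apply/measurable_EFinP; apply: measurable_funM; first exact: measurable_funTS.
  apply: (measurableT_comp (@normr_measurable R setT)).
  by apply: measurable_funB; apply: measurable_Omega_scale => //; exact: mu_t.
have hle : (\int[mu]_(y in Omega m) (wgt m (4 * T) y * psi y)%:E <=
    \int[mu]_(y in Omega m) (W1 y + k%:E * W2 y))%E.
  apply: ae_ge0_le_integral => //.
  - by move=> y _; rewrite lee_fin mulr_ge0 ?wgt_ge0.
  - apply/measurable_EFinP; apply: measurable_funM => //; exact: measurable_funTS.
  - by move=> y _; apply: adde_ge0 => //; apply: mule_ge0 => //; rewrite lee_fin.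
  - by apply: emeasurable_funD => //; exact: measurable_funeM.
  have a1 := ae_scale l0 u0_ge0; have a2 := ae_scale l0 u0_lower.
  apply: filterS2 a1 a2 => y h1 h2 Oy.
  have lOy := Omega_scale l0 Oy.
  have v1 : v s y <= 1 by apply: (mild_le1 alpha_gt0 hv) => //; exact: Omega_in_closure.
  have hb : y \in exhaust m n -> 1 <= k * u0 (lam *: y).
    move=> /set_mem/hLam[q1 q2]; apply: (le_trans q2); rewrite ler_wpM2l//; exact: h2.
  have := max_sub_le (u (lam ^+ 2 * s) (lam *: y)) v1 k0 (h1 lOy) hb.
  have -> : Num.max 0 (v s y - k * u (lam ^+ 2 * s) (lam *: y)) = psi y.
    by rewrite /psi /w /rescale add0r.
  move=> h; have -> : (W1 y + k%:E * W2 y = (wgt m (4 * T) y *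
     ((y \notin exhaust m n)%:R + k * `|u (lam ^+ 2 * s) (lam *: y) - u0 (lam *: y)|))%:E)%E.
    rewrite /W1 /W2 patchE in_setC mulrDr EFinD -EFinM mulrCA; congr (_ + _)%E.
    by case: ifP => _ /=; rewrite ?mulr1 ?mulr0.
  by rewrite lee_fin ler_wpM2l ?wgt_ge0.
have hsum : (\int[mu]_(y in Omega m) (W1 y + k%:E * W2 y) <= (d / (C + 1))%:E)%E.
  rewrite ge0_integralD//; last 2 first.
  - by move=> y _; apply: mule_ge0 => //; rewrite lee_fin.
  - exact: measurable_funeM.
  rewrite ge0_integralZl_EFin// -integral_mkcondr -setDE (splitr (d / (C + 1))) EFinD.
  apply: leeD; first exact: ltW hn.
  move: hs1; rewrite -/W2.
  have : (0 <= \int[mu]_(y in Omega m) W2 y)%E by apply: integral_ge0.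
  case: (\int[mu]_(y in Omega m) W2 y)%E => // r; rewrite lee_fin lte_fin => r0 hr.
  rewrite -EFinM lee_fin -/e; apply: (@le_trans _ _ (k * (e / (k + 1)))).
    by rewrite ler_wpM2l// ltW.
  by rewrite mulrCA ler_piMr ?(ltW e0)// ler_pdivrMr// mul1r lerDl.
have : (0 <= \int[mu]_(y in Omega m) (wgt m (4 * T) y * psi y)%:E)%E.
  by apply: integral_ge0 => y _; rewrite lee_fin mulr_ge0 ?wgt_ge0.
move: (le_trans hle hsum).
case: (\int[mu]_(y in Omega m) _)%E => // r; rewrite !lee_fin => hr r0.
apply: (@le_trans _ _ (C * (d / (C + 1)))); first by rewrite ler_wpM2l.
by rewrite mulrCA ler_piMr ?(ltW d0)// ler_pdivrMr// mul1r lerDl.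
Qed.

Variables (V : R -> 'rV[R]_N -> R) (g : 'rV[R]_N -> R).
Hypothesis gC : C0bu m g.
Hypothesis hV : selfsimilar_profile m alpha V g.
Hypothesis vV : dilation_limit m alpha v V.

Lemma lower_bound L e : 0 < e ->
  exists M, forall t, M < t -> forall x, in_closure m x -> box L x ->
    g x - e <= t `^ alpha^-1 * u t (Num.sqrt t *: x).
Proof.
move=> e0; have e2 : 0 < e / 2 by rewrite divr_gt0.
have [M1 [d [/andP[d0 _] hM]]] := dilation_profile gC hV vV L e2.
(* One fixed dilation factor q already brings v within e / 2 of the profile g. The growth of t is
   left to lam = sqrt t / q, so that the comparison is made at the fixed time q^2. *)
pose q := `|M1| + 1.
have q0 : 0 < q by rewrite ltr_wpDl.
have Mq : M1 < q by rewrite (le_lt_trans (ler_norm _))// ltrDl.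
pose K := q `^ (2 / alpha).
have K0 : 0 < K by rewrite powR_gt0.
have q2 : 0 < q ^+ 2 by rewrite exprn_gt0.
(* Divided by K because the inequality is multiplied by the amplitude K of the dilation; the box
   grows to q L since x is replaced by q x. *)
have [Lam Lam0 hLam] := rescale_ge_mild (q * L) q2 (divr_gt0 e2 K0).
exists ((Lam * q) ^+ 2) => t ht x hx Lx.
have t0 : 0 < t by apply: le_lt_trans ht; rewrite sqr_ge0.
have st0 : 0 < Num.sqrt t by rewrite sqrtr_gt0.
pose lam := Num.sqrt t / q.
have l0 : 0 < lam by rewrite divr_gt0.
have Ll : Lam < lam.
  rewrite ltr_pdivlMr// -[ltLHS]ger0_norm ?mulr_ge0 ?(ltW q0)// -sqrtr_sqr ltr_sqrt//.
have qx : in_closure m (q *: x) by exact: in_closure_scale.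
have qLx : box (q * L) (q *: x).
  by move=> i; rewrite mxE normrM (gtr0_norm q0) ler_wpM2l// ltW.
have h1 := hM q 1 x Mq; rewrite subrr normr0 d0 in h1; have {}h1 := h1 isT hx Lx.
have h2 := hLam lam (q *: x) Ll qx qLx.
have E1 : dilation (2 / alpha) q v 1 x = K * v (q ^+ 2) (q *: x) by rewrite /dilation mulr1.
have E2 : K * rescale (lam `^ (2 / alpha)) 0 lam u (q ^+ 2) (q *: x) =
    t `^ alpha^-1 * u t (Num.sqrt t *: x).
  rewrite /rescale mulrA add0r scalerA; congr (_ * u _ (_ *: _)).
  - rewrite /K -powRM ?(ltW q0) ?(ltW l0)// /lam (mulrC q) divfK ?gt_eqF//.
    by rewrite powRrM powR_mulrn ?(ltW st0)// sqr_sqrtr ?(ltW t0).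
  - by rewrite -exprMn /lam divfK ?gt_eqF// sqr_sqrtr// ltW.
  - by rewrite /lam divfK ?gt_eqF.
have close (p r o : R) : - (e / 2) < p - o -> p - r <= e / 2 -> o - e <= r by move=> *; lra.
have h3 : K * v (q ^+ 2) (q *: x) - t `^ alpha^-1 * u t (Num.sqrt t *: x) <= e / 2.
  rewrite -E2 -mulrBr (le_trans (ler_wpM2l (ltW K0) h2))//.
  by rewrite mulrCA divff ?mulr1 ?gt_eqF.
move: h1; rewrite E1 ltr_norml => /andP[h1 _]; exact: close h1 h3.
Qed.

End lower_bound.

(** * Conclusion from the two bounds *)

Unset Implicit Arguments.

Theorem theorem1p11 (R : realType) (N m : nat) (gam alpha : R)
    (m_ge1 : (1 <= m)%N) (m_leN : (m <= N)%N)
    (gam_gt0 : 0 < gam) (gam_ltN : gam < N%:R)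
    (alpha_gt0 : 0 < alpha) (alpha_lt : alpha < 2 / (gam + m%:R))
    (S : R -> ('rV[R]_N -> R) -> 'rV[R]_N -> R)
    (S_solution : solution_operator m gam alpha S)
    (u0 : 'rV[R]_N -> R) (u0_X : Xspace m gam u0)
    (u0_ge0 : {ae lebesgue_row N, forall x, Omega m x -> 0 <= u0 x})
    (u0_lower : exists R0 c0 : R, [/\ 0 < R0, 0 < c0 &
       {ae lebesgue_row N, forall x, Omega m x -> R0 <= enorm x ->
          c0 * psi0 m gam x <= u0 x}])
    (v : R -> 'rV[R]_N -> R) (v_solution : mild_solution m alpha (cst 1) v)
    (V : R -> 'rV[R]_N -> R) (V_limit : dilation_limit m alpha v V)
    (g : 'rV[R]_N -> R) (g_C0bu : C0bu m g)
    (g_profile : selfsimilar_profile m alpha V g) :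
  locally_uniformly (closure (Omega m))
    (fun t x => t `^ alpha^-1 * S t u0 (Num.sqrt t *: x)) g.
Proof.
have [C hS] := S_solution; have [tc cs L1 XS] := hS u0 u0_X.
have [mu0 Xu0] := u0_X; have [R0 [c0 [_ c00 lower]]] := u0_lower.
have tu : tame m (S ^~ u0) by exact: C0_tame.
have pu : parabolic m alpha (S ^~ u0) by exact: classical_parabolic.
have X0 : (0 <= Xnorm m gam u0)%E by exact: Lnorm_ge0.
have Xfin : Xnorm m gam u0 \is a fin_num by rewrite ge0_fin_numE.
have q0 : 0 <= fine (Xnorm m gam u0) by exact: fine_ge0.
move: Xfin XS => /fineK <-; set q := fine (Xnorm m gam u0) in q0 * => XS.
(* The sign of C is not given; [q + |C| * q] is nonnegative and bounds the X-norm of u0 and of u(t)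
   for all t > 0. *)
have Cq : C * q <= q + `|C| * q.
  by rewrite (le_trans (ler_wpM2r q0 (ler_norm C)))// lerDr.
have M0 : 0 <= q + `|C| * q by rewrite addr_ge0// mulr_ge0.
have u0M : (Xnorm m gam u0 <= (q + `|C| * q)%:E)%E.
  rewrite -(fineK (_ : Xnorm m gam u0 \is a fin_num)) ?ge0_fin_numE//.
  by rewrite lee_fin lerDl mulr_ge0.
have uM t : 0 < t -> (Xnorm m gam (S t u0) <= (q + `|C| * q)%:E)%E.
  by move=> /XS/le_trans; apply; rewrite -EFinM lee_fin.
apply/locally_uniformlyP => K cK KO e e0.
have e2 : 0 < e / 2 by rewrite divr_gt0.
have [L L0 KL] := compact_in_box cK.
have [M1 h1] := upper_bound alpha_gt0 g_C0bu g_profile V_limit v_solution L tu pu e2.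
have [M2 h2] := lower_bound m_ge1 m_leN gam_gt0 gam_ltN alpha_gt0 alpha_lt v_solution
  tu pu mu0 M0 u0M uM L1 u0_ge0 c00 lower g_C0bu g_profile V_limit L e2.
exists (Num.max M1 M2) => t; rewrite gt_max => /andP[t1 t2] x Kx.
have hx : in_closure m x by rewrite -in_closureE; exact: KO.
have ee : e / 2 < e by rewrite ltr_pdivrMr// ltr_pMr// ltr1n.
rewrite ltr_distl; apply/andP; split.
  by apply: lt_le_trans (h2 t t2 x hx (KL _ Kx)); rewrite ltrD2l ltrN2.
by apply: le_lt_trans (h1 t t1 x hx (KL _ Kx)) _; rewrite ltrD2l.
Qed.
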